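(* Let $n,d\ge1$ be integers, $p\in[2,3)$ and $T>0$. Let $\mathbf{X}=(X,\mathbb{X})\in\mathcal{D}^p([0,T];\mathbb{R}^d)$ be a càdlàg $p$-rough path, $L\in D^p([0,T];\mathbb{R}^n)$ and $f\in C_b^3(\mathbb{R}^n;\mathcal{L}(\mathbb{R}^d;\mathbb{R}^n))$. Then, for every $y\in\mathbb{R}^n$ with $y\ge L_0$ (componentwise), there exists a solution $(Y,Y',K)$ on $[0,T]$ to the reflected rough differential equation $$Y_t=y+\int_0^tf(Y_s)\,\mathrm{d}\mathbf{X}_s+K_t,\qquad t\in[0,T],$$ with reflecting lower barrier $L$.
   Context: Variation norms. For $r\ge1$ and a finite-dimensional normed space $E$, $D^r([0,T];E)$ is the space of càdlàg paths $Z:[0,T]\to E$ with $\|Z\|_{r,[0,T]}<\infty$, where $\|Z\|_{r,[s,t]}:=\big(\sup_{\mathcal{P}}\sum_{[u,v]\in\mathcal{P}}|Z_{u,v}|^r\big)^{1/r}$, $Z_{u,v}:=Z_v-Z_u$, the supremum being over finite partitions $\mathcal{P}$ of $[s,t]$. Let $\Delta_T:=\{(s,t)\in[0,T]^2:s\le t\}$. For two-parameter functions $\Xi:\Delta_T\to E$, $\|\Xi\|_{r,[s,t]}:=\big(\sup_{\mathcal{P}}\sum_{[u,v]\in\mathcal{P}}|\Xi_{u,v}|^r\big)^{1/r}$, and $D^{r}(\Delta_T;E)$ denotes those $\Xi$ with $\|\Xi\|_{r,[0,T]}<\infty$ such that $s\mapsto\Xi_{s,t}$ (fixed $t$) and $t\mapsto\Xi_{s,t}$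 (fixed $s$) are càdlàg. Function spaces. $\mathcal{L}(\mathbb{R}^d;\mathbb{R}^n)$ is the space of linear maps $\mathbb{R}^d\to\mathbb{R}^n$; $C_b^k(\mathbb{R}^n;\mathcal{L}(\mathbb{R}^d;\mathbb{R}^n))$ is the space of $k$-times Fréchet differentiable functions which, with all derivatives up to order $k$, are continuous and bounded. Rough paths. For $p\in[2,3)$, $\mathbf{X}=(X,\mathbb{X})$ is a càdlàg $p$-rough path over $\mathbb{R}^d$ (written $\mathbf{X}\in\mathcal{D}^p([0,T];\mathbb{R}^d)$) if $X\in D^p([0,T];\mathbb{R}^d)$, $\mathbb{X}\in D^{p/2}(\Delta_T;\mathbb{R}^{d\times d})$ and $\mathbb{X}_{s,t}-\mathbb{X}_{s,u}-\mathbb{X}_{u,t}=X_{s,u}\otimes X_{u,t}$ for all $0\le s\le u\le t\le T$. Controlled paths. $(Y,Y')\in\mathcal{V}_X^p([0,T];E)$ (controlled path with respect to $X$) if $Y\in D^p([0,T];E)$, $Y'\in D^p([0,T];\mathcal{L}(\mathbb{R}^d;E))$ and $R^Y\in D^{p/2}(\Delta_T;E)$, where $R^Y_{s,t}:=Y_{s,t}-Y'_sX_{s,t}$. Rough integral. For $(H,H')\in\mathcal{V}_X^p([0,T];\mathcal{L}(\mathbb{R}^d;\mathbb{R}^n))$, $\int_s^tH_r\,\mathrm{d}\mathbf{X}_r:=\lim_{|\mathcal{P}|\to0}\sum_{[u,v]\in\mathcal{P}}\big(H_uX_{u,v}+H'_u\mathbb{X}_{u,v}\big)$ over partitions of $[s,t]$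 with mesh tending to $0$, where $H'_u\in\mathcal{L}(\mathbb{R}^d;\mathcal{L}(\mathbb{R}^d;\mathbb{R}^n))$ is identified with a linear map $\mathbb{R}^{d\times d}\to\mathbb{R}^n$ (so that $x\otimes z\mapsto (H'_ux)z$); this limit exists. For $(Y,Y')\in\mathcal{V}_X^p([0,T];\mathbb{R}^n)$ and $f\in C_b^3$, $\int f(Y)\,\mathrm{d}\mathbf{X}$ is the rough integral of the controlled path $(f(Y),\mathrm{D}f(Y)Y')$. Solution. $(Y,Y',K)$ is a solution to the reflected rough differential equation if $(Y,Y')\in\mathcal{V}_X^p([0,T];\mathbb{R}^n)$ and $K\in D^1([0,T];\mathbb{R}^n)$ satisfy the displayed equation and, for every $i=1,\dots,n$: (a) $Y^i_t\ge L^i_t$ for all $t\in[0,T]$; (b) $K^i:[0,T]\to\mathbb{R}$ is non-decreasing with $K^i_0=0$ and $\int_0^t(Y^i_s-L^i_s)\,\mathrm{d}K^i_s=0$ for all $t\in[0,T]$, this last integral being a Lebesgue–Stieltjes integral. *)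

(* Defs.v *)
From HB Require Import structures.
From mathcomp Require Import all_boot all_order all_algebra.
From mathcomp Require Import all_classical all_reals all_analysis.

Set Implicit Arguments.
Unset Strict Implicit.
Unset Printing Implicit Defensive.

Import Order.TTheory GRing.Theory Num.Theory.
Import numFieldNormedType.Exports.

Local Open Scope classical_set_scope.
Local Open Scope ring_scope.

(* Conventions.
   - R^n is 'rV[R]_n and L(R^d; R^n) is 'M[R]_(d, n), acting on the right:
     the matrix A sends x to x *m A.  R^(d x d) is 'M[R]_d, and x (x) z is
     x^T *m z.
   - All these spaces carry the sup norm of the entries; on finite-dimensional
     spaces the choice of norm changes none of the notions below.
   - Paths on [0, T] (resp. functions on the simplex) are total functions of one
     (resp. two) real variables, only ever evaluated on [0, T] (resp. at
     0 <= s <= t <= T).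
   - As in itv_partition, a partition s = t_0 < t_1 < ... < t_k = t of [s, t] is
     the sequence [:: t_1; ...; t_k] without its first point; the partition of
     [s, s] is empty. *)

Section partitions.
Context {R : realType}.

Definition partition_sum (V : zmodType) (Xi : R -> R -> V) (s : R) (P : seq R)
    : V :=
  \sum_(0 <= i < size P) Xi (nth s (s :: P) i) (nth s (s :: P) i.+1).

Definition mesh (s : R) (P : seq R) : R :=
  \big[Num.max/0]_(0 <= i < size P)
    (nth s (s :: P) i.+1 - nth s (s :: P) i).

Definition small_mesh (s t : R) : set_system (seq R) :=
  filter_from [set delta : R | 0 < delta]
    (fun delta => [set P | itv_partition s t P /\ mesh s P < delta]).

Global Instance small_mesh_filter s t : Filter (small_mesh s t).
Proof.
apply: filter_from_filter; first by exists 1; exact: ltr01.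
move=> a b /= a0 b0; exists (Num.min a b); first by rewrite /= lt_min a0.
by move=> P [? /=]; rewrite lt_min => /andP[].
Qed.

End partitions.

Section variation_spaces.
Context {R : realType}.

Definition increment (V : zmodType) (Z : R -> V) (s t : R) : V := Z t - Z s.

Definition pvariation (V : normedModType R) (r : R) (Xi : R -> R -> V)
    (s t : R) : \bar R :=
  poweR (ereal_sup
    [set (partition_sum (fun u v => `|Xi u v| `^ r) s P)%:E
      | P in itv_partition s t]) r^-1.

Definition cadlag (V : normedModType R) (a b : R) (Z : R -> V) : Prop :=
  (forall t, a <= t < b -> Z u @[u --> t^'+] --> Z t) /\
  (forall t, a < t <= b -> exists l : V, Z u @[u --> t^'-] --> l).

Definition D_path (V : normedModType R) (r T : R) (Z : R -> V) : Prop :=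
  cadlag 0 T Z /\ (pvariation r (increment Z) 0 T < +oo)%E.

Definition D_simplex (V : normedModType R) (r T : R) (Xi : R -> R -> V)
    : Prop :=
  [/\ forall t, 0 <= t <= T -> cadlag 0 t (fun s => Xi s t),
      forall s, 0 <= s <= T -> cadlag s T (fun t => Xi s t)
    & (pvariation r Xi 0 T < +oo)%E].

End variation_spaces.

(* lin_mx ('d f x) is the matrix of the Frechet derivative of f at x, so that
   the derivative is again a matrix-valued map. *)
Fixpoint Cb (R : realType) (n k a b : nat) (f : 'rV[R]_n -> 'M[R]_(a, b))
    : Prop :=
  [/\ continuous f,
      exists M : R, forall x, `|f x| <= M
    & match k with
      | 0%N => True
      | k'.+1 => (forall x, differentiable f x) /\
                 Cb k' (fun x => lin_mx ('d f x))
      end].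

Section rough_paths.
Context {R : realType}.
Implicit Types (p T : R) (n d : nat).

Definition rough_path d p T (X : R -> 'rV[R]_d) (XX : R -> R -> 'M[R]_d)
    : Prop :=
  [/\ D_path p T X,
      D_simplex (p / 2) T XX
    & forall s u t, 0 <= s -> s <= u -> u <= t -> t <= T ->
        XX s t - XX s u - XX u t = (increment X s u)^T *m increment X u t].

Definition remainder n d (X : R -> 'rV[R]_d) (Y : R -> 'rV[R]_n)
    (Y' : R -> 'M[R]_(d, n)) (s t : R) : 'rV[R]_n :=
  increment Y s t - increment X s t *m Y' s.

Definition controlled_path n d p T (X : R -> 'rV[R]_d) (Y : R -> 'rV[R]_n)
    (Y' : R -> 'M[R]_(d, n)) : Prop :=
  [/\ D_path p T Y, D_path p T Y' & D_simplex (p / 2) T (remainder X Y Y')].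

(* The linear extension to R^(d x d) of x (x) z |-> (A x) z, evaluated using
   M = \sum_i e_i (x) row i M. *)
Definition tensor_apply n d (A : {linear 'rV[R]_d -> 'M[R]_(d, n)})
    (M : 'M[R]_d) : 'rV[R]_n :=
  \sum_(i < d) row i M *m A (delta_mx 0 i).

Lemma tensor_applyE n d (A : {linear 'rV[R]_d -> 'M[R]_(d, n)})
    (x z : 'rV[R]_d) : tensor_apply A (x^T *m z) = z *m A x.
Proof.
rewrite [in RHS](row_sum_delta x) linear_sum mulmx_sumr /tensor_apply.
apply: eq_bigr => i _; rewrite linearZ -scalemxAr [RHS]scalemxAl.
by congr (_ *m _); apply/rowP => j; rewrite !mxE big_ord1 !mxE.
Qed.

Definition is_rough_integral n d (X : R -> 'rV[R]_d) (XX : R -> R -> 'M[R]_d)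
    (H : R -> 'M[R]_(d, n)) (H' : R -> {linear 'rV[R]_d -> 'M[R]_(d, n)})
    (s t : R) (I : 'rV[R]_n) : Prop :=
  partition_sum
    (fun u v => increment X u v *m H u + tensor_apply (H' u) (XX u v)) s P
  @[P --> small_mesh s t] --> I.

Definition compose_derivative n d (f : 'rV[R]_n -> 'M[R]_(d, n))
    (Y : R -> 'rV[R]_n) (Y' : R -> 'M[R]_(d, n)) (u : R)
    : {linear 'rV[R]_d -> 'M[R]_(d, n)} :=
  'd f (Y u) \o mulmxr (Y' u).

(* \int_0^t Z_s dk_s = 0 for all t in [0, T], for a cadlag non-decreasing k on
   [0, T].  The Stieltjes measure needs an integrator defined on the whole line;
   on ]0, T] it depends only on the values of k on [0, T], so any extension of
   k will do.  As k_0 = 0 in our use, 0 carries no mass. *)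
Definition null_stieltjes_integral T (Z k : R -> R) : Prop :=
  exists2 kbar : cumulative R R,
    forall t, 0 <= t <= T -> kbar t = k t &
    forall t, 0 <= t <= T ->
      (\int[lebesgue_stieltjes_measure kbar]_(s in `]0%R, t]) (Z s)%:E = 0)%E.

Definition rrde_solution n d p T (X : R -> 'rV[R]_d) (XX : R -> R -> 'M[R]_d)
    (L : R -> 'rV[R]_n) (f : 'rV[R]_n -> 'M[R]_(d, n)) (y : 'rV[R]_n)
    (Y : R -> 'rV[R]_n) (Y' : R -> 'M[R]_(d, n)) (K : R -> 'rV[R]_n) : Prop :=
  [/\ controlled_path p T X Y Y',
      D_path 1 T K,
      forall t, 0 <= t <= T ->
        exists2 I : 'rV[R]_n,
          is_rough_integral X XX (f \o Y) (compose_derivative f Y Y') 0 t I &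
          Y t = y + I + K t
    & forall i : 'I_n,
        (forall t, 0 <= t <= T -> L t 0 i <= Y t 0 i) /\
        [/\ forall s t, 0 <= s -> s <= t -> t <= T -> K s 0 i <= K t 0 i,
            K 0 0 i = 0
          & null_stieltjes_integral T (fun s => Y s 0 i - L s 0 i)
              (fun s => K s 0 i)]].

End rough_paths.

(* Main.v *)
Require Import Defs.
From HB Require Import structures.
From mathcomp Require Import all_boot all_order all_algebra.
From mathcomp Require Import all_classical all_reals all_analysis.
From mathcomp Require Import ring lra zify.
Set Implicit Arguments.
Unset Strict Implicit.
Unset Printing Implicit Defensive.
Import Order.TTheory GRing.Theory Num.Theory.
Import numFieldNormedType.Exports.
Local Open Scope classical_set_scope.
Local Open Scope ring_scope.

(** The solution is a limit of reflected Euler schemes with a second-order term.  On a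
    finite grid put
      Z' = Z + X_{s,t} f(Y) + (Df f)(Y) XX_{s,t},  Y = Z + K,
    and raise each component of K just enough to keep Y above L.  Everything is
    measured by the control w(s,t), the sum of the p-variation of X, the p/2-variation
    of XX and the p-variation of L, each raised to its power.

    Uniform bounds.  The local error
      J_{s,t} = Z_{s,t} - X_{s,t} f(Y_s) - (Df f)(Y_s) XX_{s,t}
    vanishes over one step, and Chen's relation expresses J_{s,t} - J_{s,u} - J_{u,t} by
    the remainder of Y on [s,u] and by X, XX on [u,t].  The remainder contains K,
    which is monotone, so that ka(s,t), the increment of the sum of its components, is
    an additive control; with W = w + ka the defect is of order W^(3/p), and 3/p > 1.
    Davie's induction (davie_estimate) gives |J| <= M W^(3/p) at small scales.
    Conversely K is bounded by the oscillation of Z and L (Skorokhod), hence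
    ka <= A w^(1/p): the two bounds close up when w is small, and boundedness of f
    extends them to all scales (rough_scheme_bounds), with constants independent of
    the grid.

    Passage to the limit.  The limit is taken along an ultrafilter refining the filter
    of grids that contain any given finite set (reflected_scheme_limit).  Every time
    is eventually a grid point, so the bounds hold for the limit at all times, jump
    times included.

    Identification.  A jump at t inside or at the end of an interval makes w(s,t) large,
    and |J| <= A W^(3/p) alone does not give convergence of the Riemann sums.  But since
    the last step of a scheme makes no error, J_{s,t} is small with the control
    strictly before t.  A short interval carries at most one large jump
    (control_one_jump), and cutting there bounds J by a small multiple of W, which
    is summable (local_error_one_jump, limit_rough_integral).

    Complementarity.  Where Y_r > L_r, the schemes are strictly above the barrier at r and
    shortly after, uniformly, so K has no jump at r and is constant to the right of r;
    countably many such intervals cover the set where Y > L, which is therefore null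
    for dK (null_stieltjes_skorokhod). *)

(** * A priori estimates for reflected schemes *)

(** A product of two powers of total degree ga + 1 is a small power ga of one
    factor times one full power of the larger quantity D: in the sums over
    partitions D is summable, and the power ga supplies the smallness. *)
Lemma powR_sum_split (R : realType) (al be ga a b D : R) :
  0 <= a <= D -> 0 <= b <= D -> 0 <= ga -> ga <= al -> 0 <= be ->
  0 < al -> al + be = ga + 1 -> a `^ al * b `^ be <= a `^ ga * D.
Proof.
move=> /andP[a0 aD] /andP[b0 bD] ga0 gaal be0 al0 e.
have D0 : 0 <= D by exact: le_trans aD.
have -> : a `^ al = a `^ ga * a `^ (al - ga).
  rewrite -powRD; first by congr (_ `^ _); ring.
  by apply/implyP => /eqP h; exfalso; move: h; lra.
rewrite -mulrA; apply: ler_wpM2l; first exact: powR_ge0.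
have -> : D = D `^ (al - ga) * D `^ be.
  rewrite -powRD; last by apply/implyP => /eqP h; exfalso; move: h; lra.
  by rewrite (_ : al - ga + be = 1) ?powRr1//; lra.
apply: ler_pM; rewrite ?powR_ge0//.
  by apply: ge0_ler_powR => //; rewrite ?nnegrE// subr_ge0.
by apply: ge0_ler_powR => //; rewrite ?nnegrE.
Qed.

Lemma powRX (R : realType) (q : R) k (x : R) : (x `^ q) ^+ k = x `^ (q * k%:R).
Proof. by rewrite powRrM powR_mulrn// powR_ge0. Qed.

Lemma le_powR (R : realType) (q x y : R) :
  0 <= q -> 0 <= x -> x <= y -> x `^ q <= y `^ q.
Proof.
by move=> q0 x0 xy; apply: ge0_ler_powR; rewrite ?nnegrE//; exact: le_trans xy.
Qed.

Lemma le1_powR (R : realType) (x a b : R) :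
  0 <= x <= 1 -> 0 < a -> a <= b -> x `^ b <= x `^ a.
Proof.
move=> /andP[]; rewrite le_eqVlt => /predU1P[<- _|x0 x1] a0 ab.
  by rewrite !powR0// gt_eqF// (lt_le_trans a0).
by apply: ger_powR => //; rewrite x0.
Qed.

Lemma le_powR_ge1 (R : realType) (x a : R) :
  0 <= x -> 0 <= a <= 1 -> x `^ a <= 1 + x.
Proof.
move=> x0 /andP[a0 a1]; have [x1|x1] := leP x 1.
  by apply: (@le_trans _ _ (1 `^ a)); [exact: le_powR|rewrite powR1; lra].
by apply: (@le_trans _ _ x); [rewrite ler1_powR// ltW|lra].
Qed.

Lemma powR1_split (R : realType) (x a : R) : 0 <= x -> x `^ (1 - a) * x `^ a = x.
Proof.
by move=> x0; rewrite -powRD; rewrite subrK ?powRr1// oner_eq0.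
Qed.

Lemma cube_le_split (R : realType) (q W D : R) : 1 < q * 3 ->
  0 <= W -> W <= D -> (W `^ q) ^+ 3 <= W `^ (q * 3 - 1) * D.
Proof.
move=> q3 W0 WD; apply: (@le_trans _ _ (W `^ (q * 3 - 1) * W)).
  rewrite powRX -{3}(powRr1 W0) -powRD; first by rewrite subrK.
  by apply/implyP => /eqP h; exfalso; move: h q3; clear; lra.
by apply: ler_wpM2l => //; exact: powR_ge0.
Qed.

(** Once k is dominated by w ^ q, smallness of w makes w + k small: here q < 1, so
    w itself is dominated by w ^ q on bounded ranges. *)
Lemma powR_add_le (R : realType) (q w k Om Cb : R) : 1 < q * 3 -> q * 2 <= 1 ->
  0 <= Cb -> 0 <= w <= Om -> 0 <= k <= Cb * w `^ q ->
  (w + k) `^ (q * 3 - 1) <=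
  (1 + Om + Cb) `^ (q * 3 - 1) * (w `^ q) `^ (q * 3 - 1).
Proof.
move=> q3 q2 Cb0 /andP[w0 wOm] /andP[k0 kle].
have Om0 : 0 <= 1 + Om + Cb by lra.
rewrite -powRM ?powR_ge0//; apply: le_powR; [lra|lra|].
rewrite [leRHS]mulrDl; apply: lerD => //.
rewrite -{1}(@powR1_split _ w q)//; apply: ler_wpM2r; first exact: powR_ge0.
apply: le_trans (le_powR_ge1 w0 _) _; first by clear -q3 q2; lra.
by rewrite lerD2l.
Qed.

(** Degree count: q + 2 q = (3 q - 1) + 1.  Since 2 q <= 1, either factor alone
    carries the surplus power 3 q - 1, so the product is negligible as soon as
    one of a and b is small. *)
Lemma powR_mixed_le (R : realType) (q a b D : R) : 1 < q * 3 -> q * 2 <= 1 ->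
  0 <= a <= D -> 0 <= b <= D ->
  a `^ q * (b `^ q) ^+ 2 <= a `^ (q * 3 - 1) * D /\
  a `^ q * (b `^ q) ^+ 2 <= b `^ (q * 3 - 1) * D.
Proof.
move=> q3 q2 aD bD; rewrite powRX; split; last rewrite mulrC.
  by apply: powR_sum_split => //; clear -q3 q2; lra.
by apply: powR_sum_split => //; clear -q3 q2; lra.
Qed.

(** The defect is the failure of additivity of the local error J over two adjacent
    intervals; w and w' are the controls of the first and of the second one, k
    and z bound the increments of the reflection term and of the rough integral
    over the first.  It is small when either interval is: this is what makes the
    left-point sums insensitive to where a jump sits inside an interval. *)
Lemma defect_le (R : realType) (q w w' k z J D Om Q Cb Cj : R) :
  1 < q * 3 -> q * 2 <= 1 -> 0 <= Cb -> 0 <= Cj -> 0 <= w <= Om ->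
  0 <= w' -> 0 <= k <= Q -> 0 <= z -> 0 <= J ->
  k <= Cb * w `^ q -> z <= Cb * w `^ q -> J <= Cj * ((w + k) `^ q) ^+ 3 ->
  w + k <= D -> w' <= D ->
  let E := 4 * Cb ^+ 2 + (1 + Om + Q) * (1 + Cj) + 1 in
  let defect := w' `^ q * ((z + k) ^+ 2 + k + J + (w `^ q) ^+ 2)
                + (z + k) * (w' `^ q) ^+ 2 in
  defect <= (E + 2 * Cb) * ((w + k) `^ (q * 3 - 1) * D) /\
  defect <= (E + 2 * Cb) * (w' `^ (q * 3 - 1) * D).
Proof.
move=> q3 q2 Cb0 Cj0 /andP[w0 wOm] w'0 /andP[k0 kQ] z0 J0 kle zle Jle WD w'D E.
set W := w + k => defect.
have W0 : 0 <= W by rewrite addr_ge0.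
have q0 : 0 <= q by clear -q3; lra.
have wW : w <= W by rewrite lerDl.
have WOQ : 1 + W <= 1 + Om + Q by rewrite -addrA lerD2l lerD.
have OQ0 : 0 <= 1 + Om + Q by apply: le_trans WOQ; rewrite addr_ge0.
have E0 : 0 <= E.
  rewrite /E addr_ge0 ?ler01// addr_ge0 ?mulr_ge0 ?sqr_ge0// addr_ge0//.
have wq0 : 0 <= w `^ q := powR_ge0 _ _.
have Wq0 : 0 <= W `^ q := powR_ge0 _ _.
have w'q0 : 0 <= w' `^ q := powR_ge0 _ _.
have wWq : w `^ q <= W `^ q by exact: le_powR.
have X2 : 0 <= (W `^ q) ^+ 2 := sqr_ge0 _.
have Wpow a : 0 <= a <= 1 -> W `^ a <= 1 + Om + Q.
  by move=> a01; apply: le_trans WOQ; exact: le_powR_ge1.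
have Y0 : 0 <= z + k by rewrite addr_ge0.
have Y2 : z + k <= 2 * Cb * w `^ q.
  by clear -kle zle; move: kle zle; rewrite -mulrA; lra.
have Z1 : (z + k) ^+ 2 <= 4 * Cb ^+ 2 * (W `^ q) ^+ 2.
  rewrite (_ : 4 * _ * _ = (2 * Cb * W `^ q) ^+ 2); last by ring.
  rewrite ler_sqr ?nnegrE ?mulr_ge0//; apply: le_trans Y2 _.
  by apply: ler_wpM2l => //; exact: mulr_ge0.
have Z2 : k <= (1 + Om + Q) * (W `^ q) ^+ 2.
  apply: (@le_trans _ _ W); first by rewrite lerDr.
  rewrite -{1}(@powR1_split _ W (q * 2))// -powRX; apply: ler_wpM2r => //.
  by apply: Wpow; clear -q3 q2; lra.
have Z3 : J <= (1 + Om + Q) * Cj * (W `^ q) ^+ 2.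
  apply: le_trans Jle _; rewrite exprS mulrA [_ * Cj]mulrC.
  apply: ler_wpM2r => //; apply: ler_wpM2l => //.
  by apply: Wpow; clear -q3 q2; lra.
have Z4 : (w `^ q) ^+ 2 <= (W `^ q) ^+ 2 by rewrite ler_sqr// nnegrE.
have Z : (z + k) ^+ 2 + k + J + (w `^ q) ^+ 2 <= E * (W `^ q) ^+ 2.
  rewrite (_ : E * _ = 4 * Cb ^+ 2 * (W `^ q) ^+ 2 + (1 + Om + Q) * (W `^ q) ^+ 2
    + (1 + Om + Q) * Cj * (W `^ q) ^+ 2 + (W `^ q) ^+ 2); last by rewrite /E; ring.
  by apply: lerD => //; apply: lerD => //; apply: lerD.
have h : defect <= E * (w' `^ q * (W `^ q) ^+ 2)
    + 2 * Cb * (W `^ q * (w' `^ q) ^+ 2).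
  apply: lerD; first by rewrite mulrCA; exact: ler_wpM2l.
  rewrite mulrA; apply: ler_wpM2r; first exact: sqr_ge0.
  by apply: le_trans Y2 _; apply: ler_wpM2l => //; exact: mulr_ge0.
have W0D : 0 <= W <= D by rewrite W0.
have w0D : 0 <= w' <= D by rewrite w'0.
have [m1 m2] := powR_mixed_le q3 q2 w0D W0D.
have [m3 m4] := powR_mixed_le q3 q2 W0D w0D.
by split; apply: le_trans h _; rewrite [leRHS]mulrDl; apply: lerD;
  apply: ler_wpM2l => //; exact: mulr_ge0.
Qed.

Lemma powR_modulus (R : realType) (q B e : R) : 0 < q -> 0 <= B -> 0 < e ->
  exists2 h : R, 0 < h & forall x : R, 0 <= x <= h -> B * x `^ q < e.
Proof.
move=> q0 B0 e0; have B1 : 0 < B + 1 by rewrite ltr_wpDl.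
exists ((e / (B + 1)) `^ q^-1); first by rewrite powR_gt0 ?divr_gt0.
move=> x /andP[x0 xh].
have xq : x `^ q <= e / (B + 1).
  apply: le_trans (le_powR (ltW q0) x0 xh) _.
  by rewrite -powRrM mulVf ?gt_eqF// powRr1// divr_ge0// ltW.
apply: (@le_lt_trans _ _ (B * (e / (B + 1)))); first exact: ler_wpM2l.
by rewrite mulrCA gtr_pMr// ltr_pdivrMr// mul1r ltrDl.
Qed.

(** u is the last point whose interval from s carries at most half of W; passing
    to its successor u + 1 leaves at most half on the right, by superadditivity. *)
Lemma superadditive_midpoint (R : realType) (W : nat -> nat -> R) (s t : nat) :
  (forall i j, 0 <= W i j) ->
  (forall i j k, (i <= j <= k)%N -> W i j + W j k <= W i k) ->
  (s < t)%N -> exists u, [/\ (s <= u < t)%N, W s u <= W s t / 2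
    & W u.+1 t <= W s t / 2].
Proof.
move=> W0 Wsup st.
have diag i : W i i = 0.
  by have := Wsup i i i; have := W0 i i; rewrite leqnn => ? /(_ isT); lra.
have half0 i j : 0 <= W i j / 2 by rewrite divr_ge0.
pose P u := (s <= u < t)%N && (W s u <= W s t / 2).
have exP : exists u, P u by exists s; rewrite /P leqnn st diag half0.
have Pb u : P u -> (u <= t)%N by case/andP => /andP[_ /ltnW].
case: (ex_maxnP exP Pb) => u /andP[/andP[su ut] Wu] umax.
exists u; split=> //; first by rewrite su.
have [/eqP <-|] := boolP (u.+1 == t); first by rewrite diag half0.
move=> nu1t; have {nu1t}u1t : (u.+1 < t)%N by rewrite ltn_neqAle nu1t.
have Hu : ~~ P u.+1 by apply/negP => /umax; rewrite ltnn.
have : W s t / 2 < W s u.+1.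
  move: Hu; rewrite /P u1t ltNge; apply: contra => ->.
  by rewrite andbT andbT leqW.
have /Wsup : (s <= u.+1 <= t)%N by lia.
lra.
Qed.

(** The real-number content of a reflected Euler scheme on a grid with points
    indexed by nat: w is the control of the data, ka the increment of the
    reflection terms, aZ and aJ the sizes of the increment of the unreflected part
    and of the local error.  rs_J_step holds because the scheme makes no
    error over one step, rs_ka_le is the Skorokhod estimate, and rs_J_defect is the
    sewing inequality.  The exponent q is 1/p. *)
Record rough_scheme (R : realType) (q C Om : R) (w ka aZ aJ : nat -> nat -> R)
    : Prop := RoughScheme {
  rs_w_ge0 : forall i j, 0 <= w i j;
  rs_w_super : forall i j k, (i <= j <= k)%N -> w i j + w j k <= w i k;
  rs_w_le : forall i j, (i <= j)%N -> w i j <= Om;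
  rs_ka_ge0 : forall i j, (i <= j)%N -> 0 <= ka i j;
  rs_ka_add : forall i j k, (i <= j <= k)%N -> ka i k = ka i j + ka j k;
  rs_Z_ge0 : forall i j, 0 <= aZ i j;
  rs_Z_sub : forall i j k, (i <= j <= k)%N -> aZ i k <= aZ i j + aZ j k;
  rs_J_ge0 : forall i j, 0 <= aJ i j;
  rs_J_diag : forall i, aJ i i = 0;
  rs_J_step : forall i, aJ i i.+1 = 0;
  rs_Z_le : forall i j, (i <= j)%N ->
    aZ i j <= C * (w i j `^ q + (w i j `^ q) ^+ 2) + aJ i j;
  rs_J_le : forall i j, (i <= j)%N ->
    aJ i j <= C * (w i j `^ q + (w i j `^ q) ^+ 2) + aZ i j;
  rs_ka_le : forall i j B, (i <= j)%N ->
    (forall r, (i <= r <= j)%N -> aZ i r + w i r `^ q <= B) -> ka i j <= C * B;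
  rs_J_defect : forall i j k, (i <= j <= k)%N ->
    aJ i k <= aJ i j + aJ j k +
      C * (w j k `^ q * ((aZ i j + ka i j) ^+ 2 + ka i j + aJ i j
                          + (w i j `^ q) ^+ 2)
           + (aZ i j + ka i j) * (w j k `^ q) ^+ 2) }.

(* W = w + ka is the control in which the local error is estimated: ka is additive,
   hence summable over partitions, whereas the bound ka <= A w ^ q is not. *)
Section rough_scheme_bounds.
Context {R : realType} (q C Om : R).
Hypothesis (q13 : 1 < q * 3) (q12 : q * 2 <= 1) (C1 : 1 <= C) (Om0 : 0 <= Om).

(* linear arithmetic under the standing bounds on q and C *)
Ltac lra_qC := move: q13 q12 C1; lra.

(* The constants are variables with a defining equation, which keeps the arithmetic
   from unfolding them. *)
Context (la : R) (laE : la = 2 * (2^-1 `^ q) ^+ 3).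
Context (C2 : R) (C2E : C2 = C * ((2 * C + 2) ^+ 2 + (2 * C + 5))).
Context (M : R) (ME : M = 2 * C2 / (1 - la)).

Let q0 : 0 < q. Proof. move: q13; lra_qC. Qed.
Let qge0 : 0 <= q. Proof. exact: ltW. Qed.
Let qle1 : q <= 1. Proof. by move: q12; lra_qC. Qed.

Let la1 : la < 1.
Proof.
rewrite laE powRX.
rewrite (_ : 2^-1 `^ (q * 3) = 2^-1 * 2^-1 `^ (q * 3 - 1)); last first.
  rewrite -{2}(@powRr1 _ 2^-1)// -powRD ?invr_eq0//; last first.
    by rewrite pnatr_eq0 implybT.
  by congr powR; ring.
rewrite mulrA mulfV// mul1r.
have -> : (2^-1 : R) `^ (q * 3 - 1) = (2 `^ (q * 3 - 1))^-1.
  by rewrite -powR_inv1// -powRrM mulN1r powRN.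
rewrite invf_lt1 ?powR_gt0//.
have e0 : 0 < q * 3 - 1 by lra_qC.
have := @gt0_ltr_powR _ _ e0 1 2; rewrite powR1 !nnegrE; apply=> //.
by rewrite ltr1n.
Qed.

Let C20 : 0 < C2.
Proof. by rewrite C2E; apply: mulr_gt0; [lra_qC|have := sqr_ge0 (2*C+2); lra_qC]. Qed.

Let M0 : 0 < M.
Proof. by rewrite ME; apply: divr_gt0; [exact: mulr_gt0|rewrite subr_gt0]. Qed.

Let MlaC2 : M * la + 2 * C2 = M.
Proof.
have h : 1 - la != 0 by rewrite subr_eq0 eq_sym lt_eqF.
by rewrite ME; field.
Qed.

(** Scales of W below which the error term M W ^ (3 q) is absorbed by W ^ (2 q), and
    then by half of W in the Skorokhod estimate. *)
Definition small_scale (eta : R) := [/\ 0 < eta, eta <= 1, M * eta `^ q <= 1 &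
  C * M * eta `^ (q * 3 - 1) <= 2^-1].

Lemma exists_small_scale : exists eta, small_scale eta.
Proof.
pose e1 := (M^-1) `^ q^-1.
pose e2 := (2 * C * M)^-1 `^ (q * 3 - 1)^-1.
have e10 : 0 < e1 by rewrite powR_gt0// invr_gt0.
have C0 : 0 < C by lra_qC.
have e20 : 0 < e2 by rewrite powR_gt0// invr_gt0; exact: (mulr_gt0 (mulr_gt0 (ltr0Sn R 1) C0) M0).
have [[m1 m2] m3] : (Num.min 1 (Num.min e1 e2) <= 1 /\
    Num.min 1 (Num.min e1 e2) <= e1) /\ Num.min 1 (Num.min e1 e2) <= e2.
  by rewrite !ge_min !lexx !orbT.
exists (Num.min 1 (Num.min e1 e2)); set m := Num.min _ _ in m1 m2 m3 *.
have mp : 0 < m by rewrite /m !lt_min ltr01 e10 e20.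
split=> //.
- rewrite -(@mulfV _ M) ?gt_eqF//; apply: ler_wpM2l; first exact: ltW.
  apply: le_trans (le_powR _ _ m2) _ => //; first exact: ltW.
  by rewrite /e1 -powRrM mulVf ?gt_eqF// powRr1// invr_ge0 ltW.
- have CM0 : 0 < C * M by exact: mulr_gt0.
  rewrite -ler_pdivlMl//.
  have -> : (C * M)^-1 * 2^-1 = (2 * C * M)^-1 by rewrite -invfM; congr (_^-1); ring.
  apply: le_trans (le_powR _ _ m3) _; [lra_qC|exact: ltW|].
  rewrite /e2 -powRrM mulVf ?powRr1//; last by rewrite gt_eqF//; lra_qC.
  by rewrite invr_ge0 -mulrA mulr_ge0// ltW.
Qed.

Section one_scheme.
Variables (w ka aZ aJ : nat -> nat -> R).
Hypothesis H : rough_scheme q C Om w ka aZ aJ.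
Let W i j := w i j + ka i j.

Let w0 := rs_w_ge0 H.
Let ka0 := rs_ka_ge0 H.
Let W0 i j : (i <= j)%N -> 0 <= W i j.
Proof. by move=> ij; rewrite addr_ge0// ka0. Qed.

Lemma scheme_W_super i j k : (i <= j <= k)%N -> W i j + W j k <= W i k.
Proof.
move=> ijk; rewrite /W (rs_ka_add H ijk).
by have := rs_w_super H ijk; lra_qC.
Qed.

Lemma scheme_W_subl i j k : (i <= j <= k)%N -> W i j <= W i k.
Proof.
move=> ijk; have := scheme_W_super ijk; have : 0 <= W j k by apply: W0; case/andP: ijk.
by lra_qC.
Qed.
Lemma scheme_W_subr i j k : (i <= j <= k)%N -> W j k <= W i k.
Proof.
move=> ijk; have := scheme_W_super ijk; have : 0 <= W i j by apply: W0; case/andP: ijk.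
by lra_qC.
Qed.
Lemma scheme_w_subl i j k : (i <= j <= k)%N -> w i j <= w i k.
Proof. by move=> ijk; have := rs_w_super H ijk; have := w0 j k; lra_qC. Qed.

Lemma scheme_path_le i j x : (i <= j)%N -> W i j <= 1 -> W i j `^ q <= x -> x <= 1 ->
  aJ i j <= x ^+ 2 ->
  [/\ aZ i j + ka i j <= (2 * C + 2) * x & ka i j + aJ i j + (w i j `^ q) ^+ 2 <= 3 * x ^+ 2].
Proof.
move=> ij W1 Wx x1 Jx.
have wW : w i j <= W i j by rewrite /W lerDl ka0.
have kW : ka i j <= W i j by rewrite /W lerDr.
have wq : w i j `^ q <= x by apply: le_trans Wx; exact: le_powR.
have wq0 : 0 <= w i j `^ q := powR_ge0 _ _.
have Wq0 : 0 <= W i j `^ q := powR_ge0 _ _.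
have x0 : 0 <= x by exact: le_trans Wx.
have WW : W i j <= x ^+ 2.
  apply: (@le_trans _ _ ((W i j `^ q) ^+ 2)); last by rewrite ler_sqr// nnegrE.
  by rewrite powRX -{1}(powRr1 (W0 ij)); apply: le1_powR; rewrite ?W0//; lra_qC.
have w2 : (w i j `^ q) ^+ 2 <= x ^+ 2 by rewrite ler_sqr// nnegrE.
have x2x : x ^+ 2 <= x by rewrite expr2 ler_piMl.
split; last by lra_qC.
have := rs_Z_le H ij.
have : C * (w i j `^ q + (w i j `^ q) ^+ 2) <= C * (2 * x).
  by apply: ler_wpM2l; lra_qC.
by lra_qC.
Qed.

Lemma scheme_defect_le i j k : (i <= j <= k)%N -> W i k <= 1 ->
  aJ i j <= (W i k `^ q) ^+ 2 ->
  aJ i k <= aJ i j + aJ j k + C2 * (W i k `^ q) ^+ 3.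
Proof.
move=> ijk W1; set x := W i k `^ q => Jx.
have [ij jk] := andP ijk; have ik := leq_trans ij jk.
have x0 : 0 <= x := powR_ge0 _ _.
have x1 : x <= 1.
  by have := le_powR qge0 (W0 ik) W1; rewrite powR1.
have Wx : W i j `^ q <= x.
  by apply: le_powR => //; [exact: W0|exact: scheme_W_subl].
have W1' : W i j <= 1 by apply: le_trans W1; exact: scheme_W_subl.
have [YC RC] := scheme_path_le ij W1' Wx x1 Jx.
have wx : w j k `^ q <= x.
  apply: le_powR => //; apply: le_trans (scheme_W_subr ijk).
  by rewrite /W lerDl ka0.
have wq0 : 0 <= w j k `^ q := powR_ge0 _ _.
apply: le_trans (rs_J_defect H ijk) _; apply: lerD => //.
rewrite C2E -mulrA; apply: ler_wpM2l; first by lra_qC.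
have Y0 : 0 <= aZ i j + ka i j by rewrite addr_ge0 ?(rs_Z_ge0 H)// ka0.
have a1 : (aZ i j + ka i j) ^+ 2 <= ((2 * C + 2) * x) ^+ 2.
  by rewrite ler_sqr// nnegrE// mulr_ge0//; lra_qC.
have a2 : (w j k `^ q) ^+ 2 <= x ^+ 2 by rewrite ler_sqr// nnegrE.
apply: (@le_trans _ _
  (x * (((2 * C + 2) * x) ^+ 2 + 3 * x ^+ 2) + (2 * C + 2) * x * x ^+ 2)).
  apply: lerD.
    apply: ler_pM => //; last by lra_qC.
    rewrite -!addrA; apply: addr_ge0; first exact: sqr_ge0.
    by rewrite !addr_ge0 ?sqr_ge0 ?ka0 ?(rs_J_ge0 H).
  by apply: ler_pM => //; exact: sqr_ge0.
by rewrite le_eqVlt; apply/orP; left; apply/eqP; ring.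
Qed.

(** Davie's induction on the number of steps.  Split at the midpoint u of W and at
    its successor: the step from u to u + 1 makes no error, and the two outer pieces
    cost 2 (1/2) ^ (3 q) = la < 1 times the claimed bound, which leaves room for two
    defects.  The defect constant C2 does not involve M because a small W absorbs
    M W ^ (3 q) into W ^ (2 q). *)
Lemma davie_estimate eta i j : small_scale eta -> (i <= j)%N -> W i j <= eta ->
  aJ i j <= M * (W i j `^ q) ^+ 3.
Proof.
move=> [eta0 eta1 Meta _].
have [n] := ubnP (j - i)%N; elim: n i j => // n IH i j ijn ij Wij.
have rhs0 : 0 <= M * (W i j `^ q) ^+ 3.
  by rewrite mulr_ge0 ?exprn_ge0 ?powR_ge0// ltW.
have [->|/eqP nij] := eqVneq i j; first by rewrite (rs_J_diag H) mulr_ge0 ?exprn_ge0 ?powR_ge0// ltW.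
have {}ij : (i < j)%N by rewrite ltn_neqAle ij andbT; apply/eqP.
have [nij1|/eqP nij1] := eqVneq j i.+1; first by rewrite {1}nij1 (rs_J_step H).
pose W' i j := if (i <= j)%N then W i j else 0.
have [u [/andP[iu uj]]] : exists u, [/\ (i <= u < j)%N, W' i u <= W' i j / 2
    & W' u.+1 j <= W' i j / 2].
  apply: superadditive_midpoint => //.
    by move=> a b; rewrite /W'; case: ifPn => // /W0.
  move=> a b c /[dup] abc /andP[ab bc]; rewrite /W' ab bc (leq_trans ab bc).
  exact: scheme_W_super.
rewrite /W' iu uj (ltnW ij) => Wu Wu'.
have W1 : W i j <= 1 by exact: le_trans eta1.
have iuj : (i <= u <= j)%N by rewrite iu ltnW.
have uuj : (u <= u.+1 <= j)%N by rewrite leqnSn uj.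
have Wuj : W u j <= W i j by exact: scheme_W_subr.
have Wij0 : 0 <= W i j by apply: W0; exact: ltnW.
have half a b : (a <= b)%N -> W a b <= W i j / 2 ->
    M * (W a b `^ q) ^+ 3 <= M * (la / 2) * (W i j `^ q) ^+ 3.
  move=> ab Wab; rewrite -mulrA; apply: ler_wpM2l; first exact: ltW.
  apply: (@le_trans _ _ (((W i j / 2) `^ q) ^+ 3)).
    rewrite lerXn2r ?nnegrE ?powR_ge0//; apply: le_powR => //; exact: W0.
  rewrite powRM// exprMn mulrC; apply: ler_wpM2r; rewrite ?exprn_ge0 ?powR_ge0//.
  by rewrite laE mulrAC mulfV// mul1r.
have J1 : aJ i u <= M * (W i u `^ q) ^+ 3.
  apply: IH => //; last by apply: le_trans Wij; exact: scheme_W_subl.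
  by clear -ijn uj iu; lia.
have J2 : aJ u.+1 j <= M * (W u.+1 j `^ q) ^+ 3.
  apply: IH => //; first by clear -ijn uj iu; lia.
  by apply: le_trans Wij; apply: scheme_W_subr; rewrite leqW//= .
have h1 := half _ _ iu Wu; have h2 := half _ _ uj Wu'.
have Jx : aJ i u <= (W i j `^ q) ^+ 2.
  apply: le_trans J1 _; rewrite exprS mulrA.
  have Wiuj : W i u `^ q <= W i j `^ q.
    by apply: le_powR => //; [exact: W0|exact: scheme_W_subl].
  rewrite -[leRHS]mul1r; apply: ler_pM; rewrite ?exprn_ge0 ?powR_ge0//.
  - by rewrite mulr_ge0 ?powR_ge0// ltW.
  - apply: le_trans Meta; apply: ler_wpM2l; first exact: ltW.
    apply: le_powR => //; first exact: W0.
    exact: le_trans (scheme_W_subl iuj) Wij.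
  - by rewrite lerXn2r ?nnegrE ?powR_ge0.
have D1 := scheme_defect_le iuj W1 Jx.
have D2 : aJ u j <= aJ u u.+1 + aJ u.+1 j + C2 * (W i j `^ q) ^+ 3.
  apply: le_trans (scheme_defect_le uuj _ _) _.
  - exact: le_trans Wuj W1.
  - by rewrite (rs_J_step H) sqr_ge0.
  - apply: lerD => //; apply: ler_wpM2l; first exact: ltW.
    rewrite lerXn2r ?nnegrE ?powR_ge0//; apply: le_powR => //.
    by apply: W0; exact: ltnW.
rewrite (rs_J_step H) add0r in D2.
rewrite -MlaC2 mulrDl.
apply: le_trans D1 _.
have : M * la * (W i j `^ q) ^+ 3 = M * (la / 2) * (W i j `^ q) ^+ 3 + M * (la / 2) * (W i j `^ q) ^+ 3 by field.
lra_qC.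
Qed.

Context (A : R) (AE : A = 2 * C * (2 * C + 1) + 1).

Lemma scheme_w_diag i : w i i = 0.
Proof.
have /(rs_w_super H) : (i <= i <= i)%N by rewrite leqnn.
by have := w0 i i; lra_qC.
Qed.

Lemma scheme_ka_diag i : ka i i = 0.
Proof.
have /(rs_ka_add H) : (i <= i <= i)%N by rewrite leqnn.
by lra_qC.
Qed.

Lemma scheme_w_le_pow i j : 0 <= w i j <= 1 -> w i j <= w i j `^ q.
Proof.
move=> w01; rewrite -{1}(@powRr1 _ (w i j)) ?w0//.
exact: le1_powR.
Qed.

Lemma scheme_pow_sqr_le i j : w i j <= 1 -> (w i j `^ q) ^+ 2 <= w i j `^ q.
Proof.
move=> w1; rewrite expr2 ler_piMl ?powR_ge0//.
by have := le_powR qge0 (w0 i j) w1; rewrite powR1.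
Qed.

Lemma scheme_cube_le eta i j : small_scale eta -> (i <= j)%N -> W i j <= eta ->
  C * (M * (W i j `^ q) ^+ 3) <= W i j / 2.
Proof.
move=> [eta0 eta1 _ Meta] ij Wij.
have Wij0 := W0 ij.
have -> : (W i j `^ q) ^+ 3 = W i j `^ (q * 3 - 1) * W i j.
  rewrite powRX -{3}(powRr1 Wij0) -powRD; first by congr (_ `^ _); ring.
  by apply/implyP => /eqP h; exfalso; move: h; lra_qC.
rewrite !mulrA [leRHS]mulrC; apply: ler_wpM2r => //.
apply: le_trans Meta; apply: ler_wpM2l; first by apply: mulr_ge0; [lra_qC|exact: ltW].
by apply: le_powR => //; lra_qC.
Qed.

Lemma scheme_Z_le eta i j : small_scale eta -> (i <= j)%N -> W i j <= eta ->
  C * aZ i j <= 2 * C ^+ 2 * w i j `^ q + W i j / 2.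
Proof.
move=> seta ij Wij.
have w1 : w i j <= 1.
  by case: seta => _ e1 _ _; have := ka0 ij; move: Wij e1; rewrite /W; lra_qC.
have := scheme_cube_le seta ij Wij; have := davie_estimate seta ij Wij => J1.
have CJ : C * aJ i j <= C * (M * (W i j `^ q) ^+ 3).
  by apply: ler_wpM2l => //; lra_qC.
have := rs_Z_le H ij => Zle.
have CZ : C * aZ i j <= C * (C * (w i j `^ q + (w i j `^ q) ^+ 2) + aJ i j).
  by apply: ler_wpM2l => //; lra_qC.
have CC : C ^+ 2 * (w i j `^ q) ^+ 2 <= C ^+ 2 * w i j `^ q.
  by apply: ler_wpM2l; [exact: sqr_ge0|exact: scheme_pow_sqr_le].
move: CJ CZ CC; rewrite !mulrDr !mulrA -expr2; lra_qC.
Qed.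

(** By the Skorokhod estimate ka is bounded by the oscillation of the unreflected
    part, which contains M W ^ (3 q); at small scales this is at most half of
    W = w + ka, and ka / 2 is moved to the left-hand side. *)
Lemma scheme_ka_le eta i j : small_scale eta -> (i <= j)%N -> W i j <= eta ->
  ka i j <= A * w i j `^ q.
Proof.
move=> seta ij Wij.
have w1 : w i j <= 1.
  by case: seta => _ e1 _ _; have := ka0 ij; move: Wij e1; rewrite /W; lra_qC.
have wp : w i j <= w i j `^ q by apply: scheme_w_le_pow; rewrite w0.
have C0 : 0 < C by lra_qC.
have := rs_ka_le H ij (B := (2 * C ^+ 2 * w i j `^ q + W i j / 2) / C + w i j `^ q).
have bnd r : (i <= r <= j)%N -> aZ i r + w i r `^ q <=
    (2 * C ^+ 2 * w i j `^ q + W i j / 2) / C + w i j `^ q.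
  move=> irj; have ir : (i <= r)%N by case/andP: irj.
  have wr : w i r `^ q <= w i j `^ q by apply: le_powR => //; exact: scheme_w_subl.
  apply: lerD => //; rewrite ler_pdivlMr// mulrC.
  apply: le_trans (scheme_Z_le seta ir _) _; first exact: le_trans (scheme_W_subl irj) Wij.
  apply: lerD; last by rewrite ler_pM2r ?invr_gt0//; exact: scheme_W_subl.
  by apply: ler_wpM2l => //; rewrite mulr_ge0// sqr_ge0.
move=> /(_ bnd).
have -> : C * ((2 * C ^+ 2 * w i j `^ q + W i j / 2) / C + w i j `^ q)
  = 2 * C ^+ 2 * w i j `^ q + W i j / 2 + C * w i j `^ q.
  by field; rewrite gt_eqF.
rewrite {1}/W AE expr2 => h.
have -> : (2 * C * (2 * C + 1) + 1) * w i j `^ q =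
  4 * (C * C * w i j `^ q) + 2 * (C * w i j `^ q) + w i j `^ q by ring.
by move: h wp; rewrite -!mulrA; lra_qC.
Qed.

Lemma scheme_step_Z i : aZ i i.+1 <= C * (w i i.+1 `^ q + (w i i.+1 `^ q) ^+ 2).
Proof. by have := rs_Z_le H (leqnSn i); rewrite (rs_J_step H) addr0. Qed.

Lemma scheme_step_ka i : ka i i.+1 <=
  C * ((C + 1) * (w i i.+1 `^ q + (w i i.+1 `^ q) ^+ 2)).
Proof.
apply: (rs_ka_le H) => // r /andP[ir ri].
have wq0 : 0 <= w i i.+1 `^ q := powR_ge0 _ _.
have s0 : 0 <= (w i i.+1 `^ q) ^+ 2 := sqr_ge0 _.
have [->|/eqP nir] := eqVneq r i.+1.
  by rewrite mulrDl mul1r; have := scheme_step_Z i; lra_qC.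
have -> : r = i by clear -ir ri nir; lia.
have := rs_Z_le H (leqnn i); rewrite (rs_J_diag H) scheme_w_diag powR0 ?gt_eqF//.
rewrite expr0n/= !addr0 mulr0 => ?.
apply: le_trans (_ : 0 <= _) => //.
by rewrite mulr_ge0 ?addr_ge0//; lra_qC.
Qed.

(** Scales of w below which the a priori assumption on W in the previous estimates
    can be recovered; the factor 3 covers w, the reflection up to the last
    point and the reflection in the last step. *)
Definition small_control eta delta := [/\ 0 < delta, delta <= 1 & 3 * A * delta `^ q <= eta].

Let A1 : 1 <= A.
Proof. by rewrite AE lerDr !mulr_ge0//; lra_qC. Qed.

(** Smallness of the data control w forces smallness of W = w + ka.  The reflection
    might jump in one step, but a single step is bounded directly in terms of w,
    so the induction on the right end point closes. *)
Lemma scheme_bootstrap eta delta i j : small_scale eta -> small_control eta delta ->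
  (i <= j)%N -> w i j <= delta -> W i j <= eta.
Proof.
move=> seta [d0 d1 dA]; elim: j => [|j IH].
  rewrite leqn0 => /eqP -> _; rewrite /W scheme_w_diag scheme_ka_diag addr0.
  by case: seta => /ltW.
rewrite leq_eqVlt ltnS => /predU1P[-> _|ij wd].
  by rewrite /W scheme_w_diag scheme_ka_diag addr0; case: seta => /ltW.
have ijj : (i <= j <= j.+1)%N by rewrite ij leqnSn.
have wij : w i j <= delta by apply: le_trans wd; exact: scheme_w_subl.
have wj : w j j.+1 <= delta.
  by have := rs_w_super H ijj; have := w0 i j; lra_qC.
have Wij : W i j <= eta by exact: IH.
have dq0 : 0 <= delta `^ q := powR_ge0 _ _.
rewrite /W (rs_ka_add H ijj).
have h1 : ka i j <= A * delta `^ q.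
  apply: le_trans (scheme_ka_le seta ij Wij) _.
  apply: ler_wpM2l; first by have := A1; lra_qC.
  exact: le_powR.
have h2 : ka j j.+1 <= A * delta `^ q.
  apply: le_trans (scheme_step_ka j) _.
  have p2 := scheme_pow_sqr_le (le_trans wj d1).
  have pd : w j j.+1 `^ q <= delta `^ q by exact: le_powR.
  apply: (@le_trans _ _ (C * ((C + 1) * (2 * delta `^ q)))).
    by rewrite !ler_wpM2l//; lra_qC.
  rewrite !mulrA; apply: ler_wpM2r => //.
  have CC : 0 <= C * C by rewrite mulr_ge0//; lra_qC.
  rewrite (_ : C * (C + 1) * 2 = 2 * (C * C) + 2 * C); last by ring.
  rewrite AE (_ : 2 * C * (2 * C + 1) + 1 = 4 * (C * C) + 2 * C + 1); last by ring.
  by lra_qC.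
have h3 : delta <= A * delta `^ q.
  apply: (@le_trans _ _ (delta `^ q)).
    rewrite -{1}(powRr1 (ltW d0)); apply: le1_powR => //.
    by rewrite d1 ltW.
  by rewrite ler_peMl.
by move: dA; rewrite -mulrA; lra_qC.
Qed.

Context (o : R) (oE : o = 1 + Om + (1 + Om) ^+ 2).
Context (B1 : R) (B1E : B1 = A + (2 * C + 1) + (C + 1) ^+ 2 * o).

Lemma scheme_pow_w_le i j : (i <= j)%N -> w i j `^ q <= 1 + Om.
Proof.
move=> ij; apply: le_trans (le_powR_ge1 (w0 i j) _) _.
  by rewrite qge0.
by have := rs_w_le H ij; lra_qC.
Qed.

Lemma scheme_pow_w_le2 i j : (i <= j)%N -> w i j `^ q + (w i j `^ q) ^+ 2 <= o.
Proof.
move=> ij; have h := scheme_pow_w_le ij; rewrite oE; apply: lerD => //.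
by rewrite ler_sqr// nnegrE ?powR_ge0//; have := Om0; lra_qC.
Qed.

Let o0 : 0 <= o.
Proof. by have := sqr_ge0 (1 + Om); have := Om0; rewrite oE; lra_qC. Qed.

Let CC0 : 0 <= C ^+ 2. Proof. exact: sqr_ge0. Qed.

Lemma scheme_step_le i : ka i i.+1 + aZ i i.+1 <= B1.
Proof.
have h1 := scheme_step_ka i; have h2 := scheme_step_Z i.
have h := scheme_pow_w_le2 (leqnSn i).
apply: (@le_trans _ _ (C * ((C + 1) * o) + C * o)).
  apply: lerD.
    by apply: le_trans h1 _; rewrite !ler_wpM2l//; lra_qC.
  by apply: le_trans h2 _; rewrite !ler_wpM2l//; lra_qC.
have -> : C * ((C + 1) * o) + C * o = (C + 1) ^+ 2 * o - o by ring.
by rewrite B1E; have := o0; have := A1; lra_qC.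
Qed.

Definition scheme_block_le eta delta i j : small_scale eta -> small_control eta delta ->
  (i <= j)%N -> w i j <= delta -> ka i j + aZ i j <= B1.
Proof.
move=> seta td ij wij; have Wij := scheme_bootstrap seta td ij wij.
have [_ e1 _ _] := seta.
have kW := scheme_ka_le seta ij Wij; have zW := scheme_Z_le seta ij Wij.
have wd1 : w i j <= 1 by case: td => _ d1 _; exact: le_trans d1.
have wq1 : w i j `^ q <= 1 by have := le_powR qge0 (w0 i j) wd1; rewrite powR1.
have kA : ka i j <= A.
  by apply: le_trans kW _; rewrite ler_piMr//; have := A1; lra_qC.
have z1 : aZ i j <= 2 * C + 1.
  rewrite -(@ler_pM2l _ C); last by lra_qC.
  apply: le_trans zW _; have : W i j <= 1 by exact: le_trans e1.
  have : 2 * C ^+ 2 * w i j `^ q <= 2 * C ^+ 2.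
    by rewrite ler_piMr// mulr_ge0.
  by rewrite mulrDr mulr1 expr2; lra_qC.
have : 0 <= (C + 1) ^+ 2 * o by rewrite mulr_ge0 ?sqr_ge0.
by rewrite B1E; move: z1 kA; lra_qC.
Qed.

(** Cut the grid greedily into blocks on which w <= delta, each followed by one
    further step: every block and every step contributes at most B1, and
    superadditivity bounds the number of blocks by 1 + w / delta, whatever the
    number of grid points. *)
Lemma scheme_global_le eta delta i j : small_scale eta -> small_control eta delta ->
  (i <= j)%N -> ka i j + aZ i j <= 2 * B1 * (1 + w i j / delta).
Proof.
move=> seta td; have [d0 d1 _] := td.
have B10 : 0 <= B1.
  by apply: le_trans (scheme_step_le 0); rewrite addr_ge0 ?ka0 ?(rs_Z_ge0 H).
have [n] := ubnP (j - i)%N; elim: n i j => // n IH i j ijn ij.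
have wd0 a b : 0 <= w a b / delta by rewrite divr_ge0 ?w0// ltW.
have [wd|wd] := leP (w i j) delta.
  apply: le_trans (scheme_block_le seta td ij wd) _.
  apply: (@le_trans _ _ (2 * B1)); first by lra_qC.
  by rewrite ler_peMr ?mulr_ge0//; have := wd0 i j; lra_qC.
pose P u := (i <= u < j)%N && (w i u <= delta).
have {}ij : (i < j)%N.
  rewrite ltn_neqAle ij andbT; apply: contraTneq wd => ->.
  by rewrite scheme_w_diag -leNgt ltW.
have exP : exists u, P u by exists i; rewrite /P leqnn ij scheme_w_diag ltW.
have Pb u : P u -> (u <= j)%N by case/andP => /andP[_ /ltnW].
case: (ex_maxnP exP Pb) => u /andP[/andP[iu uj] wu] umax.
have iuj : (i <= u <= j)%N by rewrite iu ltnW.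
have uuj : (u <= u.+1 <= j)%N by rewrite leqnSn uj.
have N1 := scheme_block_le seta td iu wu; have N2 := scheme_step_le u.
have k1 := rs_ka_add H iuj; have k2 := rs_ka_add H uuj.
have z1 := rs_Z_sub H iuj; have z2 := rs_Z_sub H uuj.
have wij1 : 1 < w i j / delta by rewrite ltr_pdivlMr// mul1r.
have [uj1|/eqP uj1] := eqVneq u.+1 j.
  have : 2 * B1 <= 2 * B1 * (1 + w i j / delta).
    by rewrite ler_peMr ?mulr_ge0//; lra_qC.
  rewrite uj1 in N2; lra_qC.
have {}uj1 : (u.+1 < j)%N by clear -uj uj1; lia.
have wu1 : delta < w i u.+1.
  rewrite ltNge; apply/negP => h.
  have /umax : P u.+1 by rewrite /P h uj1 andbT andbT leqW.
  by rewrite ltnn.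
have IHu : ka u.+1 j + aZ u.+1 j <= 2 * B1 * (1 + w u.+1 j / delta).
  by apply: IH; clear -ijn iu uj; lia.
have /(rs_w_super H) : (i <= u.+1 <= j)%N by rewrite uj leqW.
move=> ww.
have : 2 * B1 * (1 + w u.+1 j / delta) <= 2 * B1 * (w i j / delta).
  apply: ler_wpM2l; first exact: mulr_ge0.
  rewrite -(@mulfV _ delta) ?gt_eqF// -mulrDl ler_pM2r ?invr_gt0//; lra_qC.
by move=> ?; rewrite [leRHS]mulrDr mulr1; lra_qC.
Qed.

(** At small scales the local bounds apply; at large scales w and W are bounded
    below, and the bound of scheme_global_le has the required form.  In the last
    estimate the final step makes no error, so aJ i j.+1 reduces to aJ i j and a
    defect, both small with w i j. *)
Lemma scheme_bounds eta delta Q Cb Cj E C' : small_scale eta -> small_control eta delta ->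
  Q = 2 * B1 * (1 + Om / delta) ->
  Cb = 2 * C + 1 + A + Q / delta `^ q ->
  Cj = M + (C * o + Q) / (eta `^ q) ^+ 3 ->
  E = 4 * Cb ^+ 2 + (1 + Om + Q) * (1 + Cj) + 1 ->
  C' = Cb + Cj + (Cj + C * (E + 2 * Cb)) * (1 + Om + Cb) `^ (q * 3 - 1) ->
  0 <= C' /\ forall i j, (i <= j)%N ->
  [/\ ka i j <= C' * w i j `^ q, aZ i j <= C' * w i j `^ q,
      aJ i j <= C' * (W i j `^ q) ^+ 3 &
      aJ i j.+1 <= C' * (w i j `^ q) `^ (q * 3 - 1) * W i j.+1].
Proof.
move=> seta td QE CbE CjE EE C'E.
have [d0 d1 _] := td; have [e0 e1 _ _] := seta.
have B10 : 0 <= B1.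
  by apply: le_trans (scheme_step_le 0); rewrite addr_ge0 ?ka0 ?(rs_Z_ge0 H).
have C0 : 0 < C by lra_qC.
have Q0 : 0 <= Q.
  rewrite QE !mulr_ge0 ?addr_ge0 ?divr_ge0//; exact: ltW.
have dq0 : 0 < delta `^ q by rewrite powR_gt0.
have eq0 : 0 < (eta `^ q) ^+ 3 by rewrite exprn_gt0// powR_gt0.
have Cb0 : 0 <= Cb.
  have : 0 <= Q / delta `^ q by rewrite divr_ge0// ltW.
  by have := A1; rewrite CbE; lra_qC.
have Co0 : 0 <= C * o by rewrite mulr_ge0// ltW.
have Cj0 : 0 <= Cj.
  rewrite CjE addr_ge0 ?divr_ge0 ?addr_ge0//; exact: ltW.
have OQ0 : 0 <= 1 + Om + Q by have := Om0; lra_qC.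
have E0 : 0 <= E.
  rewrite EE !addr_ge0 ?mulr_ge0 ?sqr_ge0//; have := Om0; lra_qC.
have F0 : 0 <= (Cj + C * (E + 2 * Cb)) * (1 + Om + Cb) `^ (q * 3 - 1).
  rewrite mulr_ge0 ?powR_ge0// addr_ge0// mulr_ge0 ?addr_ge0 ?mulr_ge0//.
  exact: ltW.
have NQ i j : (i <= j)%N -> ka i j + aZ i j <= Q.
  move=> ij; apply: le_trans (scheme_global_le seta td ij) _; rewrite QE.
  apply: ler_wpM2l; first exact: mulr_ge0.
  by rewrite lerD2l ler_pM2r ?invr_gt0//; exact: (rs_w_le H).
have kZ i j : (i <= j)%N -> ka i j <= Cb * w i j `^ q /\ aZ i j <= Cb * w i j `^ q.
  move=> ij; have wq0 : 0 <= w i j `^ q := powR_ge0 _ _.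
  have kaij := ka0 ij; have aZij := rs_Z_ge0 H i j.
  have [wd|wd] := leP (w i j) delta.
    have Wij := scheme_bootstrap seta td ij wd.
    have k1 := scheme_ka_le seta ij Wij; have z1 := scheme_Z_le seta ij Wij.
    have wp : w i j <= w i j `^ q.
      by apply: scheme_w_le_pow; rewrite w0/=; lra_qC.
    have X0 : 0 <= Q / delta `^ q * w i j `^ q.
      by rewrite mulr_ge0 ?divr_ge0 ?powR_ge0.
    have X1 : 0 <= C * w i j `^ q by rewrite mulr_ge0// ltW.
    rewrite CbE !mulrDl mul1r -mulrA; split; first by lra_qC.
    rewrite -(@ler_pM2l _ C)//; apply: le_trans z1 _.
    have W2 : W i j <= w i j `^ q + A * w i j `^ q by rewrite /W; lra_qC.
    have X2 : w i j `^ q + A * w i j `^ q <= C * (w i j `^ q + A * w i j `^ q).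
      rewrite ler_peMl// addr_ge0// mulr_ge0//; have := A1; lra_qC.
    have X3 : 0 <= C * (Q / delta `^ q * w i j `^ q) by rewrite mulr_ge0// ltW.
    have X4 : 0 <= w i j `^ q + A * w i j `^ q.
      by rewrite addr_ge0// mulr_ge0//; have := A1; lra_qC.
    move: X1 X2 X3 W2 X4; rewrite !mulrDr expr2 !mulrA; lra_qC.
  have Nij := NQ _ _ ij.
  suff h : Q <= Cb * w i j `^ q by split; apply: le_trans h; lra_qC.
  have h : delta `^ q <= w i j `^ q by apply: le_powR => //; exact: ltW.
  apply: (@le_trans _ _ (Q / delta `^ q * delta `^ q)).
    by rewrite -mulrA mulVf ?mulr1// gt_eqF.
  apply: ler_pM => //; [by rewrite divr_ge0// ltW|exact: ltW|].
  by rewrite CbE; have := A1; lra_qC.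
have JJ i j : (i <= j)%N -> aJ i j <= Cj * (W i j `^ q) ^+ 3.
  move=> ij; have [We|We] := leP (W i j) eta.
    apply: le_trans (davie_estimate seta ij We) _; apply: ler_wpM2r.
      by rewrite exprn_ge0 ?powR_ge0.
    by rewrite CjE lerDl divr_ge0 ?addr_ge0// ltW.
  apply: (@le_trans _ _ (C * o + Q)).
    apply: le_trans (rs_J_le H ij) _; apply: lerD.
      by apply: ler_wpM2l; [exact: ltW|exact: scheme_pow_w_le2].
    by have := NQ _ _ ij; have := ka0 ij; lra_qC.
  apply: (@le_trans _ _ ((C * o + Q) / (eta `^ q) ^+ 3 * (eta `^ q) ^+ 3)).
    by rewrite -mulrA mulVf ?mulr1// gt_eqF.
  apply: ler_pM.
  - by rewrite divr_ge0 ?addr_ge0// ltW.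
  - by rewrite ltW.
  - by rewrite CjE lerDr ltW.
  - by rewrite lerXn2r ?nnegrE ?powR_ge0//; apply: le_powR => //; exact: ltW.
split; first by rewrite C'E !addr_ge0.
move=> i j ij.
have wq0 : 0 <= w i j `^ q := powR_ge0 _ _.
have [k1 z1] := kZ _ _ ij; have J1 := JJ _ _ ij.
split.
- apply: le_trans k1 _; apply: ler_wpM2r => //; rewrite C'E; lra_qC.
- apply: le_trans z1 _; apply: ler_wpM2r => //; rewrite C'E; lra_qC.
- apply: le_trans J1 _; apply: ler_wpM2r; first by rewrite exprn_ge0 ?powR_ge0.
  by rewrite C'E; lra_qC.
have ijj : (i <= j <= j.+1)%N by rewrite ij leqnSn.
have Om1 : 0 <= Om by exact: Om0.
have WD : W i j <= W i j.+1 by exact: scheme_W_subl.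
have w'D : w j j.+1 <= W i j.+1.
  by apply: le_trans (scheme_W_subr ijj); rewrite /W lerDl ka0.
have kQ : ka i j <= Q.
  by apply: le_trans (NQ _ _ ij); rewrite lerDl (rs_Z_ge0 H).
rewrite C'E; apply: le_trans (_ : (Cj + C * (E + 2 * Cb)) *
    (1 + Om + Cb) `^ (q * 3 - 1) * (w i j `^ q) `^ (q * 3 - 1) * W i j.+1 <= _); last first.
  apply: ler_wpM2r; first by apply: W0; exact: leqW.
  by apply: ler_wpM2r; [exact: powR_ge0|rewrite lerDr addr_ge0].
apply: (@le_trans _ _ ((Cj + C * (E + 2 * Cb)) * (W i j `^ (q * 3 - 1) * W i j.+1))).
  have := rs_J_defect H ijj; rewrite (rs_J_step H) addr0 => Jd.
  apply: le_trans Jd _; rewrite [leRHS]mulrDl; apply: lerD.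
    apply: le_trans J1 _; apply: ler_wpM2l => //.
    by apply: cube_le_split => //; exact: W0.
  rewrite EE -[leRHS]mulrA; apply: ler_wpM2l; first exact: ltW.
  by case: (@defect_le R q (w i j) (w j j.+1) (ka i j) (aZ i j) (aJ i j)
    (W i j.+1) Om Q Cb Cj); rewrite ?w0 ?ka0 ?(rs_Z_ge0 H) ?(rs_J_ge0 H) ?(rs_w_le H).
rewrite -[leRHS]mulrA -[leRHS]mulrA; apply: ler_wpM2l.
  by rewrite addr_ge0// mulr_ge0 ?addr_ge0 ?mulr_ge0// ltW.
rewrite mulrA; apply: ler_wpM2r; first by apply: W0; exact: leqW.
by apply: powR_add_le => //; apply/andP; split;
  rewrite ?w0 ?ka0 ?(rs_w_le H).
Qed.

End one_scheme.
End rough_scheme_bounds.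

(** Bounds with a constant independent of the scheme, in particular of the
    grid.  The last one involves only the control up to the point before the last:
    it is what survives a jump at the right end of an interval. *)
Lemma rough_scheme_bounds (R : realType) (q C Om : R) :
  1 < q * 3 -> q * 2 <= 1 -> 1 <= C -> 0 <= Om ->
  exists2 C' : R, 0 <= C' & forall w ka aZ aJ, rough_scheme q C Om w ka aZ aJ ->
  forall i j, (i <= j)%N ->
  [/\ ka i j <= C' * w i j `^ q, aZ i j <= C' * w i j `^ q,
      aJ i j <= C' * ((w i j + ka i j) `^ q) ^+ 3 &
      aJ i j.+1 <= C' * (w i j `^ q) `^ (q * 3 - 1) * (w i j.+1 + ka i j.+1)].
Proof.
move=> q3 q2 C1 Om0.
pose la : R := 2 * (2^-1 `^ q) ^+ 3.
pose C2 : R := C * ((2 * C + 2) ^+ 2 + (2 * C + 5)).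
pose M : R := 2 * C2 / (1 - la).
have [eta seta] := @exists_small_scale R q C q3 q2 C1 la erefl C2 erefl M erefl.
pose A : R := 2 * C * (2 * C + 1) + 1.
have A1 : 1 <= A by rewrite /A lerDr !mulr_ge0//; lra.
have A3 : 0 < 3 * A by lra.
have e0 : 0 < eta by case: seta.
pose delta := Num.min 1 ((eta / (3 * A)) `^ q^-1).
have q0 : 0 < q by lra.
have td : small_control q A eta delta.
  have d0 : 0 < delta by rewrite lt_min ltr01 powR_gt0 ?divr_gt0.
  split=> //; first by rewrite ge_min lexx.
  rewrite -ler_pdivlMl//.
  have : delta <= (eta / (3 * A)) `^ q^-1 by rewrite ge_min lexx orbT.
  move=> /(le_powR (ltW q0) (ltW d0)) /le_trans; apply.
  rewrite -powRrM mulVf ?gt_eqF// powRr1 ?divr_ge0 ?(ltW A3) ?(ltW e0)//.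
  by rewrite mulrC.
pose o : R := 1 + Om + (1 + Om) ^+ 2.
pose B1 : R := A + (2 * C + 1) + (C + 1) ^+ 2 * o.
pose Q := 2 * B1 * (1 + Om / delta).
pose Cb := 2 * C + 1 + A + Q / delta `^ q.
pose Cj := M + (C * o + Q) / (eta `^ q) ^+ 3.
pose E := 4 * Cb ^+ 2 + (1 + Om + Q) * (1 + Cj) + 1.
pose C' := Cb + Cj + (Cj + C * (E + 2 * Cb)) * (1 + Om + Cb) `^ (q * 3 - 1).
have F w ka aZ aJ (H : rough_scheme q C Om w ka aZ aJ) :=
  @scheme_bounds R q C Om q3 q2 C1 Om0 la erefl C2 erefl M erefl w ka aZ aJ H A erefl
    o erefl B1 erefl eta delta Q Cb Cj E C' seta td erefl erefl erefl erefl erefl.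
exists (Num.max 0 C'); first by rewrite le_max lexx.
move=> w ka aZ aJ H; have [C'0 B] := F _ _ _ _ H.
by rewrite max_r.
Qed.

(** * Variation, controls and partitions *)

Lemma partition_sum_nil (R : realType) (V : zmodType) (Xi : R -> R -> V) s :
  partition_sum Xi s [::] = 0.
Proof. by rewrite /partition_sum big_geq. Qed.

Lemma partition_sum_cons (R : realType) (V : zmodType) (Xi : R -> R -> V) s x P :
  partition_sum Xi s (x :: P) = Xi s x + partition_sum Xi x P.
Proof.
rewrite /partition_sum big_nat_recl//=; congr (_ + _).
apply: eq_big_nat => i /andP[_ iP].
by congr (Xi _ _); apply: set_nth_default => //=; exact: leqW.
Qed.

Lemma mesh_cons (R : realType) (s x : R) P :
  mesh s (x :: P) = Num.max (x - s) (mesh x P).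
Proof.
rewrite /mesh big_nat_recl//=; congr (Num.max _ _).
apply: eq_big_nat => i /andP[_ iP].
by congr (_ - _); apply: set_nth_default => //=; exact: leqW.
Qed.

Lemma partition_sum_cat (R : realType) (V : zmodType) (Xi : R -> R -> V) s P Q :
  partition_sum Xi s (P ++ Q) = partition_sum Xi s P + partition_sum Xi (last s P) Q.
Proof.
elim: P s => [|x P IH] s /=; first by rewrite partition_sum_nil add0r.
by rewrite !partition_sum_cons IH addrA.
Qed.

Lemma itv_partition_ind (R : realType) (t : R) (Q : R -> seq R -> Prop) :
  Q t [::] ->
  (forall s x P, s < x -> x <= t -> itv_partition x t P -> Q x P -> Q s (x :: P)) ->
  forall s P, itv_partition s t P -> Q s P.
Proof.
move=> Q0 QS s P; elim: P s => [|x P IH] s.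
  by move/itv_partition_nil => ->.
move=> sP; have [/=/andP[sx _] _] := sP.
have xP := itv_partition_cons sP.
by apply: QS => //; [exact: itv_partition_le xP|exact: IH].
Qed.

Lemma exists_itv_partition (R : realType) (s t : R) : s <= t ->
  exists P, itv_partition s t P.
Proof.
rewrite le_eqVlt => /predU1P[->|st]; first by exists [::]; split => //=.
by exists [:: t]; exact: itv_partition1.
Qed.

Lemma partition_sum_ge0 (R : realType) (a : R -> R -> R) s P :
  (forall u v, 0 <= a u v) -> 0 <= partition_sum a s P.
Proof. by move=> a0; apply: sumr_ge0. Qed.

Section total_variation.
Context {R : realType}.

Definition power_variation (a : R -> R -> R) (s t : R) : \bar R :=
  ereal_sup [set (partition_sum a s P)%:E | P in itv_partition s t].

Variables (T : R) (a : R -> R -> R).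
Hypothesis a0 : forall u v, 0 <= a u v.

Lemma power_variation_ge0 s t : s <= t -> (0 <= power_variation a s t)%E.
Proof.
move=> /exists_itv_partition[P sP]; apply: ereal_sup_ge; exists (partition_sum a s P)%:E.
  by exists P.
by rewrite lee_fin partition_sum_ge0.
Qed.

Lemma le_power_variation s t P : itv_partition s t P ->
  ((partition_sum a s P)%:E <= power_variation a s t)%E.
Proof. by move=> sP; apply: ereal_sup_ubound; exists P. Qed.

Lemma power_variation_super s u t : s <= u <= t ->
  (power_variation a s u + power_variation a u t <= power_variation a s t)%E.
Proof.
move=> /andP[su ut].
have h P Q : itv_partition s u P -> itv_partition u t Q ->
    ((partition_sum a s P)%:E + (partition_sum a u Q)%:E
      <= power_variation a s t)%E.
  move=> sP uQ; rewrite -EFinD -[X in partition_sum a X Q](eqP (proj2 sP)).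
  by rewrite -partition_sum_cat; apply: le_power_variation; exact: itv_partition_cat sP uQ.
have [P0 sP0] := exists_itv_partition su.
have [Q0 uQ0] := exists_itv_partition ut.
have [->|ft] := eqVneq (power_variation a s t) +oo%E; first by rewrite leey.
have st : s <= t by exact: le_trans ut.
have fst : power_variation a s t \is a fin_num.
  by rewrite fin_numE ft andbT gt_eqF// (lt_le_trans _ (power_variation_ge0 st))// ltNye.
have hQ Q : itv_partition u t Q ->
    (power_variation a s u <= power_variation a s t - (partition_sum a u Q)%:E)%E.
  move=> uQ; apply: ge_ereal_sup => _ [P sP <-].
  by rewrite leeBrDr//; exact: h.
have fsu : power_variation a s u \is a fin_num.
  rewrite ge0_fin_numE ?power_variation_ge0//.
  apply: le_lt_trans (hQ _ uQ0) _.
  by rewrite ltey_eq fin_numB fst.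
rewrite -leeBrDl//; apply: ge_ereal_sup => _ [Q uQ <-].
by rewrite leeBrDl// -leeBrDr//; exact: hQ.
Qed.

Hypothesis fin : (power_variation a 0 T < +oo)%E.

Definition variation_control (s t : R) : R := fine (power_variation a s t).

Lemma power_variation_fin s t : 0 <= s -> s <= t -> t <= T ->
  power_variation a s t \is a fin_num.
Proof.
move=> s0 st tT; rewrite ge0_fin_numE ?power_variation_ge0//.
apply: le_lt_trans fin.
have h1 : 0 <= s <= T by rewrite s0 (le_trans st).
have h2 : s <= t <= T by rewrite st.
apply: le_trans (power_variation_super h1).
apply: le_trans (leeDr _ (power_variation_ge0 s0)).
apply: le_trans (power_variation_super h2).
exact: leeDl (power_variation_ge0 tT).
Qed.

Lemma variation_control_ge0 s t : 0 <= variation_control s t.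
Proof.
have [st|ts] := leP s t; first by rewrite fine_ge0// power_variation_ge0.
rewrite /variation_control; suff -> : power_variation a s t = -oo%E by [].
rewrite /power_variation -(ereal_sup0 R); congr ereal_sup.
by rewrite -subset0 => y [P /itv_partition_le]; rewrite leNgt ts.
Qed.

Lemma le_variation_control s t P : 0 <= s -> t <= T -> itv_partition s t P ->
  partition_sum a s P <= variation_control s t.
Proof.
move=> s0 tT sP; have st := itv_partition_le sP.
by rewrite -lee_fin fineK ?power_variation_fin//; exact: le_power_variation.
Qed.

Lemma variation_control_super s u t : 0 <= s -> s <= u -> u <= t -> t <= T ->
  variation_control s u + variation_control u t <= variation_control s t.
Proof.
move=> s0 su ut tT; have u0 := le_trans s0 su; have uT := le_trans ut tT.
have st := le_trans su ut.
rewrite -lee_fin EFinD !fineK ?power_variation_fin//.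
by apply: power_variation_super; rewrite su.
Qed.

Lemma variation_control_approx s t e : 0 <= s -> s <= t -> t <= T -> 0 < e ->
  exists2 P, itv_partition s t P & variation_control s t - e < partition_sum a s P.
Proof.
move=> s0 st tT e0.
have [_ [P sP <-]] := ub_ereal_sup_adherent e0 (power_variation_fin s0 st tT).
move=> h; exists P => //; move: h; rewrite -/(power_variation a s t).
by rewrite -[X in (X - _)%E](fineK (power_variation_fin s0 st tT)) -EFinB lte_fin.
Qed.

(** In a partition of [s, T] that nearly attains the variation, the first point s can
    be moved to a nearby t > s at small cost, because a is right-continuous in
    its first argument; superadditivity then leaves almost nothing on [s, t]. *)
Lemma variation_control_right s :
  (forall v, s < v <= T -> a u v @[u --> s^'+] --> a s v) ->
  0 <= s < T -> forall e, 0 < e -> exists2 d, 0 < d &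
    forall t, s <= t -> t < s + d -> t <= T -> variation_control s t < e.
Proof.
move=> acont /andP[s0 sT] e e0.
have e20 : 0 < e / 3 by rewrite divr_gt0.
have [P sP approx] := variation_control_approx s0 (ltW sT) (lexx T) e20.
case: P sP approx => [/itv_partition_nil sT'|v P sP].
  by move: sT; rewrite sT' ltxx.
rewrite partition_sum_cons => approx.
have [/=/andP[sv _] _] := sP; have vP := itv_partition_cons sP.
have vT := itv_partition_le vP.
have /cvgrPdist_lt/(_ _ e20) : a u v @[u --> s^'+] --> a s v.
  by apply: acont; rewrite sv vT.
move=> [d /= d0 dist]; exists (Num.min d (v - s)).
  by rewrite lt_min d0 subr_gt0.
move=> t st; rewrite -ltrBlDl lt_min => /andP[td tv] tT.
move: st; rewrite le_eqVlt => /predU1P[<-|st].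
  have := @variation_control_super s s s s0 (lexx _) (lexx _) (ltW sT).
  by have := variation_control_ge0 s s; lra.
have := dist t; rewrite /= distrC ger0_norm ?subr_ge0 ?ltW// => /(_ td st).
move=> /ltr_normlP[_ close].
have tv' : t < v by lra.
have tP : itv_partition t T (v :: P) by case: sP => /= /andP[_ pP] lP; split=> //=; rewrite tv'.
have := le_variation_control (le_trans s0 (ltW st)) (lexx T) tP.
rewrite partition_sum_cons.
have := variation_control_super s0 (ltW st) tT (lexx T).
lra.
Qed.

End total_variation.

(** control_right is one-sided: a jump of the driving path at t keeps w s t away from 0
    as s increases to t. *)
Record control (R : realType) (T : R) (w : R -> R -> R) : Prop := Control {
  control_ge0 : forall s t, 0 <= w s t;
  control_super : forall s u t, 0 <= s -> s <= u -> u <= t -> t <= T ->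
    w s u + w u t <= w s t;
  control_right : forall s, 0 <= s < T -> forall e, 0 < e ->
    exists2 d, 0 < d &
    forall t, s <= t -> t < s + d -> t <= T -> w s t < e }.

Lemma controlD (R : realType) (T : R) w1 w2 : control T w1 -> control T w2 ->
  control T (fun s t => w1 s t + w2 s t).
Proof.
move=> c1 c2; split.
- by move=> s t; rewrite addr_ge0 ?(control_ge0 c1) ?(control_ge0 c2).
- move=> s u t s0 su ut tT.
  have := control_super c1 s0 su ut tT; have := control_super c2 s0 su ut tT.
  lra.
- move=> s sT e e0; have e2 : 0 < e / 2 by rewrite divr_gt0.
  have [d1 d10 h1] := control_right c1 sT e2.
  have [d2 d20 h2] := control_right c2 sT e2.
  exists (Num.min d1 d2); first by rewrite lt_min d10.
  move=> t st; rewrite -ltrBlDl lt_min => /andP[t1 t2] tT.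
  have := h1 t st; have := h2 t st; lra.
Qed.

Section control_theory.
Context {R : realType} (T : R) (w : R -> R -> R).
Hypothesis cw : control T w.

Lemma control_diag s : 0 <= s <= T -> w s s = 0.
Proof.
move=> /andP[s0 sT]; have := control_super cw s0 (lexx s) (lexx s) sT.
by have := control_ge0 cw s s; lra.
Qed.

Lemma control_subl s u t : 0 <= s -> s <= u -> u <= t -> t <= T -> w s u <= w s t.
Proof.
move=> s0 su ut tT; have := control_super cw s0 su ut tT.
by have := control_ge0 cw u t; lra.
Qed.

Lemma control_subr s u t : 0 <= s -> s <= u -> u <= t -> t <= T -> w u t <= w s t.
Proof.
move=> s0 su ut tT; have := control_super cw s0 su ut tT.
by have := control_ge0 cw s u; lra.
Qed.

(** Before a jump the control is small, for otherwise infinitely many disjoint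
    intervals would accumulate at t and exhaust w 0 T. *)
Lemma control_left t e : 0 < t <= T -> 0 < e -> exists2 d, 0 < d &
  forall s s', 0 <= s -> t - d < s -> s <= s' -> s' < t -> w s s' <= e.
Proof.
move=> /andP[t0 tT] e0; apply: contrapT => nh.
have step s : 0 <= s < t -> exists s1 s2, [/\ s <= s1, s1 <= s2, s2 < t & e < w s1 s2].
  move=> /andP[s0 st]; apply: contrapT => nex; apply: nh.
  exists (t - s); first by rewrite subr_gt0.
  move=> s1 s2 s10 ts1 s12 s2t; rewrite leNgt; apply/negP => ew; apply: nex.
  by exists s1, s2; split=> //; lra.
have big n : exists2 s, 0 <= s < t & n%:R * e <= w 0 s.
  elim: n => [|n [s /andP[s0 st] ws]].
    by exists 0; rewrite ?lexx// mul0r (control_ge0 cw).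
  have [|s1 [s2 [ss1 s12 s2t ew]]] := step s; first by rewrite s0.
  exists s2; first by apply/andP; split => //; lra.
  have h1 : 0 <= s1 by lra.
  have h2 : s2 <= T by lra.
  have := control_super cw (lexx 0) h1 s12 h2.
  have h3 : s1 <= T by lra.
  have := control_subl (lexx 0) s0 ss1 h3.
  by rewrite -natr1 mulrDl mul1r; lra.
have [s /andP[s0 st]] := big (Num.bound (w 0 T / e)).
have wT : 0 <= w 0 T / e by rewrite divr_ge0 ?(control_ge0 cw)// ltW.
rewrite -ler_pdivlMr// leNgt => /negP; apply.
apply: le_lt_trans (archi_boundP wT).
by rewrite ler_pM2r ?invr_gt0//; apply: control_subl => //; lra.
Qed.

Lemma cadlag_of_control (V : completeNormedModType R) (Z : R -> V) (q C : R) :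
  0 < q -> 0 <= C ->
  (forall s t, 0 <= s -> s <= t -> t <= T -> `|Z t - Z s| <= C * w s t `^ q) ->
  cadlag 0 T Z.
Proof.
move=> q0 C0 Zw.
have modulus e (e0 : 0 < e) := powR_modulus q0 C0 e0.
split=> t.
- move=> /andP[t0 tT]; apply/cvgrPdist_lt => e e0.
  have [h h0 hC] := modulus e e0.
  have tT' : 0 <= t < T by rewrite t0.
  have [d d0 dw] := control_right cw tT' h0.
  near=> u; rewrite distrC.
  have tu : t < u by near: u; exact: nbhs_right_gt.
  have uT : u <= T by near: u; exact: nbhs_right_le.
  apply: le_lt_trans (Zw _ _ t0 (ltW tu) uT) _; apply: hC.
  rewrite (control_ge0 cw) ltW// dw ?(ltW tu)//.
  by near: u; apply: nbhs_right_lt; rewrite ltrDl.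
- move=> tT; apply/cvg_ex/cauchy_cvgP/cauchy_exP => e e0.
  have [h h0 hC] := modulus e e0.
  have [d d0 dw] := control_left tT h0.
  have [t0 tT'] := andP tT.
  pose s := Num.max 0 (t - d / 2).
  have st : s < t by rewrite gt_max t0/= ltrBlDr ltrDl divr_gt0.
  have s0 : 0 <= s by rewrite le_max lexx.
  have ds : t - d < s.
    by rewrite lt_max; apply/orP; right; rewrite ltrD2l ltrN2 ltr_pdivrMr// ltr_pMr// ltr1n.
  exists (Z s); suff : \forall u \near t^'-, ball (Z s) e (Z u) by [].
  near=> u.
  have su : s <= u by near: u; exact: nbhs_left_ge.
  have ut : u < t by near: u; exact: nbhs_left_lt.
  rewrite -ball_normE/= distrC.
  apply: le_lt_trans (Zw _ _ s0 su (le_trans (ltW ut) tT')) _; apply: hC.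
  by rewrite (control_ge0 cw) dw.
Unshelve. all: by end_near. Qed.

(** A sufficiently short interval contains at most one large jump, located at tau: the
    control is small strictly before tau and after tau.  Each point of [0, T]
    has a neighbourhood of this kind, and compactness makes its size uniform. *)
Lemma control_one_jump e : 0 < T -> 0 < e -> exists2 d, 0 < d &
  forall u v, 0 <= u -> u <= v -> v <= T -> v - u < d ->
  exists tau, [/\ u <= tau, tau <= v, forall x, u <= x < tau -> w u x <= e
    & w tau v <= e].
Proof.
move=> T0 e0.
have := segment_compact (a := 0) (b := T); rewrite compact_near_coveringP.
pose P (d : R) (u : R) := forall v, 0 <= u -> u <= v -> v <= T -> v - u < d ->
  exists tau, [/\ u <= tau, tau <= v, forall x, u <= x < tau -> w u x <= e
    & w tau v <= e].
move=> /(_ R (0^'+) P _); case => [|d /= d0 dP].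
  move=> t /=; rewrite in_itv/= => /andP[t0 tT].
  have [r1 r10 left] : exists2 d, 0 < d &
    forall s s', 0 <= s -> t - d < s -> s <= s' -> s' < t -> w s s' <= e.
    have [t00|tn0] := ltP 0 t; first by apply: control_left => //; rewrite t00.
    exists 1 => // s s' s0 _ ss' s't; exfalso; lra.
  have [r2 r20 right] : exists2 d, 0 < d &
    forall s, t <= s -> s < t + d -> s <= T -> w t s <= e.
    have [tT'|Tt] := ltP t T.
      have [|d d0 dw] := control_right cw (s := t) _ e0; first by rewrite t0.
      by exists d => // s ts sd sT; rewrite ltW// dw.
    exists 1 => // s ts _ sT; have -> : s = t by lra.
    by rewrite control_diag ?t0// ltW.
  pose r := Num.min r1 r2.
  have r0 : 0 < r by rewrite lt_min r10.
  have rr1 : r <= r1 by rewrite ge_min lexx.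
  have rr2 : r <= r2 by rewrite ge_min lexx orbT.
  exists (`](t - r / 2), (t + r / 2)[%classic, [set d : R | 0 < d < r / 2]) => /=.
    split; first by apply: near_in_itvoo; rewrite in_itv/=; apply/andP; split; lra.
    near=> d => /=; apply/andP; split=> //.
    by near: d; apply: nbhs_right_lt; rewrite divr_gt0.
  move=> [u d] /= []; rewrite in_itv/= => /andP[u1 u2] /andP[d0 dr].
  move=> v u0 uv vT vud.
  have [tu|ut] := leP t u.
    exists u; split=> //; first by move=> x /andP[ux xu]; exfalso; lra.
    apply: le_trans (control_subr t0 tu uv vT) _.
    by apply: right => //; lra.
  have [tv|vt] := leP t v.
    exists t; split=> //; first exact: ltW.
      by move=> x /andP[ux xt]; apply: left => //; lra.
    by apply: right => //; lra.
  exists v; split=> //.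
    by move=> x /andP[ux xv]; apply: left => //; lra.
  by rewrite control_diag ?(ltW e0)// (le_trans u0).
exists (d / 2); first by rewrite divr_gt0.
move=> u v u0 uv vT vud.
have uT : u <= T by exact: le_trans vT.
apply: (dP (d / 2)) => //=.
- by rewrite sub0r normrN gtr0_norm ?divr_gt0//; lra.
- by rewrite divr_gt0.
- by rewrite in_itv/= u0.
Unshelve. all: by end_near. Qed.

End control_theory.

Lemma finite_pvariation (R : realType) (V : normedModType R) (r T : R)
    (Xi : R -> R -> V) (C : R) (W : R -> R -> R) : r != 0 -> 0 <= C ->
  (forall s u t, 0 <= s -> s <= u -> u <= t -> t <= T -> W s u + W u t <= W s t) ->
  (forall t, 0 <= t -> t <= T -> 0 <= W t t) ->
  (forall s t, 0 <= s -> s < t -> t <= T -> `|Xi s t| `^ r <= C * W s t) ->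
  (pvariation r Xi 0 T < +oo)%E.
Proof.
move=> r0 C0 Wsup W0 XW.
have h s P : itv_partition s T P -> 0 <= s ->
    partition_sum (fun u v => `|Xi u v| `^ r) s P <= C * W s T.
  move: s P; apply: itv_partition_ind.
    by move=> T0; rewrite partition_sum_nil mulr_ge0// W0.
  move=> s x P sx xT xP IH s0; rewrite partition_sum_cons.
  have x0 : 0 <= x by exact: le_trans (ltW sx).
  apply: (@le_trans _ _ (C * (W s x + W x T))).
    by rewrite mulrDr; apply: lerD; [exact: XW|exact: IH].
  by apply: ler_wpM2l => //; apply: Wsup => //; exact: ltW.
rewrite /pvariation.
set S := ereal_sup _.
have : (S <= (C * W 0 T)%:E)%E.
  by apply: ge_ereal_sup => _ [P sP <-]; rewrite lee_fin; exact: h.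
case: S => [x| |] //= _; first by rewrite ltry.
by rewrite invr_eq0 (negbTE r0) ltry.
Qed.

Lemma powR_norm_cvg (R : realType) (V : normedModType R) (I : Type)
    (F : set_system I) {FF : Filter F} (g : I -> V) (l : V) (r : R) : 0 < r ->
  g i @[i --> F] --> l -> `|g i| `^ r @[i --> F] --> `|l| `^ r.
Proof.
move=> r0 gl; have ngl : `|g i| @[i --> F] --> `|l| by exact: cvg_norm.
apply/cvgrPdist_lt => e e0.
have [l0|ln0] := eqVneq l 0.
  have ngl0 : `|g i| @[i --> F] --> 0 by move: ngl; rewrite l0 normr0.
  near=> i; rewrite l0 normr0 powR0 ?gt_eqF// sub0r normrN ger0_norm ?powR_ge0//.
  apply: (@lt_le_trans _ _ ((e `^ r^-1) `^ r)).
    apply: gt0_ltr_powR; rewrite ?nnegrE ?powR_ge0//.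
    near: i; have /cvgrPdist_lt/(_ (e `^ r^-1)) := ngl0; rewrite powR_gt0// => /(_ isT).
    by apply: filterS => i; rewrite sub0r normrN normr_id.
  by rewrite -powRrM mulVf ?gt_eqF// powRr1// ltW.
have hc : x `^ r @[x --> `|l|] --> `|l| `^ r; last first.
  by move/cvgrPdist_lt: (cvg_comp _ _ ngl hc) => /(_ _ e0).
suff /differentiable_continuous : differentiable (fun x : R^o => (x : R) `^ r : R^o) `|l| by [].
apply/derivable1_diffP/derivable_powR.
by rewrite in_itv/= andbT normr_gt0.
Unshelve. all: by end_near. Qed.

(** The r-th power of the r-variation over [s, t] is the natural control. *)
Lemma pvariation_control (R : realType) (V : normedModType R) (r T : R)
    (Xi : R -> R -> V) : 0 < r ->
  (pvariation r Xi 0 T < +oo)%E ->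
  (forall s v, 0 <= s -> s < v -> v <= T -> Xi u v @[u --> s^'+] --> Xi s v) ->
  exists2 w, control T w & 
    forall s t, 0 <= s -> s < t -> t <= T -> `|Xi s t| `^ r <= w s t.
Proof.
move=> r_gt0 fin cont; have r0 : r != 0 by rewrite gt_eqF.
pose a u v := `|Xi u v| `^ r.
have a0 u v : 0 <= a u v by exact: powR_ge0.
have {}fin : (power_variation a 0 T < +oo)%E.
  move: fin; rewrite /pvariation -/(power_variation a 0 T).
  case: (power_variation a 0 T) => [x _| |_]; rewrite ?ltry//.
  by rewrite /= invr_eq0 (negbTE r0).
exists (variation_control a).
  split.
  - exact: variation_control_ge0.
  - by move=> s u t s0 su ut tT; apply: (variation_control_super a0 fin).
  - move=> s sT; apply: variation_control_right => // v /andP[sv vT].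
    apply: powR_norm_cvg=> //.
    by apply: cont => //; case/andP: sT.
move=> s t s0 st tT.
have := le_variation_control a0 fin s0 tT (itv_partition1 st).
by rewrite partition_sum_cons partition_sum_nil addr0.
Qed.

(** The error of the Riemann sum is the sum of the local errors, which the
    superadditive W bounds by its value on the whole interval. *)
Lemma rough_sum_telescope (R : realType) (V : normedModType R) (Z : R -> V)
    (Xi : R -> R -> V) (W : R -> R -> R) (c d T : R) : 0 <= c ->
  (forall s u t, 0 <= s -> s <= u -> u <= t -> t <= T -> W s u + W u t <= W s t) ->
  (forall t, 0 <= t -> t <= T -> 0 <= W t t) ->
  (forall u v, 0 <= u -> u < v -> v <= T -> v - u < d ->
     `|Z v - Z u - Xi u v| <= c * W u v) ->
  forall t P, t <= T -> itv_partition 0 t P -> mesh 0 P < d ->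
  `|Z t - Z 0 - partition_sum Xi 0 P| <= c * W 0 t.
Proof.
move=> c0 Wsup W0 ZXi t P tT; move: P.
suff h s P : itv_partition s t P -> 0 <= s -> mesh s P < d ->
    `|Z t - Z s - partition_sum Xi s P| <= c * W s t.
  by move=> P tP; exact: h.
move: s P; apply: itv_partition_ind.
  by move=> t0 _; rewrite partition_sum_nil subrr subr0 normr0 mulr_ge0// W0.
move=> s x P sx xt xP IH s0; rewrite mesh_cons gt_max => /andP[xsd mP].
rewrite partition_sum_cons; have x0 : 0 <= x by exact: le_trans (ltW sx).
have -> : Z t - Z s - (Xi s x + partition_sum Xi x P) =
    (Z x - Z s - Xi s x) + (Z t - Z x - partition_sum Xi x P).
  by rewrite [RHS]addrACA -opprD; congr (_ - _); rewrite addrC subrKA.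
apply: (@le_trans _ _ (c * (W s x + W x t))).
  rewrite mulrDr; apply: le_trans (ler_normD _ _) _; apply: lerD.
    by apply: ZXi => //; exact: le_trans tT.
  exact: IH.
by apply: ler_wpM2l => //; apply: Wsup => //; exact: ltW.
Qed.

(** * Regularity of the vector field *)

Section matrix_norm.
Context {R : realType}.

Lemma mx_norm_ge_entry m n (A : 'M[R]_(m, n)) i j : `|A i j| <= `|A|.
Proof.
rewrite [leRHS]/Num.norm/= mx_normrE.
by apply/bigmax_geP; right; exists (i, j).
Qed.

Lemma mx_norm_le m n (A : 'M[R]_(m, n)) (c : R) : 0 <= c ->
  (forall i j, `|A i j| <= c) -> `|A| <= c.
Proof.
move=> c0 Ac; rewrite [leLHS]/Num.norm/= mx_normrE.
by apply/bigmax_leP; split=> //= -[i j] _.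
Qed.

Lemma mx_norm_mul m n k (A : 'M[R]_(m, n)) (B : 'M[R]_(n, k)) :
  `|A *m B| <= n%:R * (`|A| * `|B|).
Proof.
apply: mx_norm_le => [|i j]; first by rewrite !mulr_ge0.
rewrite mxE; apply: le_trans (ler_norm_sum _ _ _) _.
apply: (@le_trans _ _ (\sum_(l < n) `|A| * `|B|)).
  apply: ler_sum => l _; rewrite normrM.
  by apply: ler_pM => //; exact: mx_norm_ge_entry.
by rewrite sumr_const card_ord mulr_natl.
Qed.

Lemma mx_norm_row m n (A : 'M[R]_(m, n)) i : `|row i A| <= `|A|.
Proof. by apply: mx_norm_le => // k j; rewrite mxE mx_norm_ge_entry. Qed.

Lemma mx_norm_delta m n i j : `|delta_mx i j : 'M[R]_(m, n)| <= 1.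
Proof.
apply: mx_norm_le => // k l; rewrite mxE.
by case: (_ && _); rewrite ?normr1// normr0.
Qed.

Lemma norm_mxvec m n (A : 'M[R]_(m, n)) : `|mxvec A| = `|A|.
Proof.
apply/eqP; rewrite eq_le; apply/andP; split; apply: mx_norm_le => // i j.
  by rewrite ord1; case/mxvec_indexP: j => k l; rewrite mxvecE mx_norm_ge_entry.
by rewrite -mxvecE mx_norm_ge_entry.
Qed.

Lemma norm_le_sum n (v : 'rV[R]_n) :
  (forall c, 0 <= v 0 c) -> `|v| <= \sum_c v 0 c.
Proof.
move=> v0; apply: mx_norm_le => [|r c]; first exact: sumr_ge0.
by rewrite ord1 ger0_norm// (bigD1 c)//= lerDl; exact: sumr_ge0.
Qed.

End matrix_norm.

Section mean_value.
Context {R : realType} (n a b : nat).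
Implicit Type g : 'rV[R]_n -> 'M[R]_(a, b).

(** The mean value theorem on the segment from x to x + v holds for each entry
    separately; the intermediate point depends on the entry. *)
Lemma mean_value_entry g x v i j : (forall x, differentiable g x) ->
  exists2 c : R, 0 < c < 1 & (g (x + v) - g x) i j = ('d g (x + c *: v) v) i j.
Proof.
move=> dg.
pose h (t : R) : R := g (x + t *: v) i j.
have dh (t : R^o) : is_derive t (1 : R^o) (h : R^o -> R^o) (('d g (x + t *: v) v) i j).
  pose l (t : R^o) : 'rV[R]_n := x + t *: v.
  have dl : is_diff t l (fun t => t *: v).
    by apply: is_diff_eq; apply/funext => r; change (0 + r *: v = r *: v); rewrite add0r.
  have dgl : differentiable (g \o l) t.
    by apply: differentiable_comp => //; case: dl.
  have @co : {linear 'M[R]_(a, b) -> R^o}.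
    by exists (fun N : 'M[R]_(_, _) => N i j); do 2![eexists]; do ?[constructor];
       rewrite ?mxE// => ? *; rewrite ?mxE//; move=> ?; rewrite !mxE.
  have cco : continuous co by exact: coord_continuous.
  have dc M : differentiable co M by exact: linear_differentiable.
  have dh : differentiable (co \o (g \o l)) t by exact: differentiable_comp.
  have -> : h = co \o (g \o l) by [].
  apply: DeriveDef; first exact: diff_derivable.
  have dll : differentiable l t by case: dl.
  rewrite deriveE// (diff_comp dgl (dc _)) (diff_comp dll (dg _)).
  by rewrite (diff_lin _ cco) (@diff_val _ _ _ _ _ _ _ dl)/= scale1r.
have ch : continuous h.
  move=> t; apply: differentiable_continuous; apply/derivable1_diffP.
  exact: ex_derive.
have [|c c01 hc] := @MVT R h (fun t => ('d g (x + t *: v) v) i j) 0 1 ltr01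
  (fun t _ => dh t).
  exact: continuous_subspaceT.
exists c; first by move: c01; rewrite in_itv.
by move: hc; rewrite /h subr0 mulr1 scale1r scale0r addr0 !mxE.
Qed.

End mean_value.

Section bounded_derivative.
Context {R : realType} (n a b : nat).
Implicit Type g : 'rV[R]_n -> 'M[R]_(a, b).

Lemma mxvec_diff g x v : mxvec ('d g x v) = mxvec v *m lin_mx ('d g x).
Proof. by rewrite mul_vec_lin. Qed.

Lemma norm_diff_le g x v : `|'d g x v| <= (1 * n)%:R * `|lin_mx ('d g x)| * `|v|.
Proof.
rewrite -norm_mxvec mxvec_diff; apply: le_trans (mx_norm_mul _ _) _.
by rewrite norm_mxvec -mulrA [`|v| * _]mulrC.
Qed.

Lemma norm_diffB_le g x y v : `|'d g y v - 'd g x v| <=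
  (1 * n)%:R * `|lin_mx ('d g y) - lin_mx ('d g x)| * `|v|.
Proof.
rewrite -norm_mxvec.
have -> : mxvec ('d g y v - 'd g x v) = mxvec v *m (lin_mx ('d g y) - lin_mx ('d g x)).
  rewrite mulmxBr (raddfB mxvec).
  exact: (f_equal2 (fun u w => u - w) (mxvec_diff g y v) (mxvec_diff g x v)).
apply: le_trans (mx_norm_mul _ _) _.
by rewrite norm_mxvec -mulrA [`|v| * _]mulrC.
Qed.

Lemma lipschitz_bounded_diff g (B : R) : 0 <= B ->
  (forall x, differentiable g x) -> (forall x, `|lin_mx ('d g x)| <= B) ->
  forall x y, `|g y - g x| <= (1 * n)%:R * B * `|y - x|.
Proof.
move=> B0 dg gB x y; apply: mx_norm_le => [|i j]; first by rewrite !mulr_ge0.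
have [c _] := mean_value_entry x (y - x) i j dg.
rewrite (addrC x) subrK => ->; apply: le_trans (mx_norm_ge_entry _ _ _) _.
apply: le_trans (norm_diff_le _ _ _) _; apply: ler_wpM2r => //.
by apply: ler_wpM2l.
Qed.

Lemma taylor_lipschitz_diff g (B : R) : 0 <= B ->
  (forall x, differentiable g x) ->
  (forall x y, `|lin_mx ('d g y) - lin_mx ('d g x)| <= B * `|y - x|) ->
  forall x y, `|g y - g x - 'd g x (y - x)| <= (1 * n)%:R * B * `|y - x| ^+ 2.
Proof.
move=> B0 dg gB x y; apply: mx_norm_le => [|i j].
  by rewrite !mulr_ge0// sqr_ge0.
have [c /andP[c0 c1]] := mean_value_entry x (y - x) i j dg.
have xv : x + (y - x) = y by rewrite addrC subrK.
rewrite xv => e; set v := y - x in e *.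
have -> : (g y - g x - 'd g x v) i j = ('d g (x + c *: v) v - 'd g x v) i j.
  have sub (A A' : 'M[R]_(a, b)) : (A - A') i j = A i j - A' i j by rewrite !mxE.
  by rewrite !sub -sub e.
apply: le_trans (mx_norm_ge_entry _ _ _) _.
apply: le_trans (norm_diffB_le _ _ _ _) _.
rewrite expr2 mulrA; apply: ler_wpM2r => //.
rewrite -mulrA; apply: ler_wpM2l => //.
apply: le_trans (gB _ _) _; apply: ler_wpM2l => //.
rewrite addrAC subrr add0r normrZ gtr0_norm//.
by apply: ler_piMl => //; exact: ltW.
Qed.

End bounded_derivative.

Lemma linear_telescope (R : pzRingType) (U V : lmodType R)
    (F F' : {linear U -> V}) u u' : F' u' - F u = F' (u' - u) + (F' u - F u).
Proof. by rewrite linearB subrKA. Qed.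

Section vector_field.
Context {R : realType} (n d : nat).

(** The coefficient of the second-order term of the rough integral of f (Y), when the
    derivative of Y with respect to X is f (Y): Df(y) f(y) applied to M. *)
Definition second_order (f : 'rV[R]_n -> 'M[R]_(d, n)) (y : 'rV[R]_n) (M : 'M[R]_d) :=
  tensor_apply ('d f y \o mulmxr (f y)) M.

Lemma second_orderB f y M N :
  second_order f y (M - N) = second_order f y M - second_order f y N.
Proof.
rewrite /second_order /tensor_apply -sumrB; apply: eq_bigr => i _.
by rewrite linearB/= mulmxBl.
Qed.

Lemma second_orderD f y M N :
  second_order f y (M + N) = second_order f y M + second_order f y N.
Proof.
rewrite /second_order /tensor_apply -big_split; apply: eq_bigr => i _.
by rewrite linearD/= mulmxDl.
Qed.

(** The estimates on f used below, with one common constant.  In rf_taylor the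
    increment y' - y need not be the direction v of the derivative: the
    difference y' - y - v will be the remainder of a controlled path. *)
Record regular_field (C : R) (f : 'rV[R]_n -> 'M[R]_(d, n)) : Prop := RegularField {
  rf_bound : forall y (x : 'rV[R]_d), `|x *m f y| <= C * `|x|;
  rf_lipschitz : forall y y', `|f y' - f y| <= C * `|y' - y|;
  rf_mul_lipschitz : forall y y' (x : 'rV[R]_d), `|x *m (f y' - f y)| <= C * (`|x| * `|y' - y|);
  rf_taylor : forall y y' v (x : 'rV[R]_d), `|x *m (f y' - f y - 'd f y v)| <=
    C * (`|x| * (`|y' - y| ^+ 2 + `|y' - y - v|));
  rf_second : forall y M, `|second_order f y M| <= C * `|M|;
  rf_second_lipschitz : forall y y' M,
    `|second_order f y' M - second_order f y M| <= C * (`|y' - y| * `|M|) }.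

Lemma Cb_regular_field (f : 'rV[R]_n -> 'M[R]_(d, n)) : Cb 3 f ->
  exists2 C : R, 1 <= C & regular_field C f.
Proof.
move=> [fcont [B0 fB0] [fdiff [dfcont [B1 fB1] [dfdiff [_ [B2 fB2] _]]]]].
have B00 : 0 <= B0 by exact: le_trans (fB0 0).
have B10 : 0 <= B1 by exact: le_trans (fB1 0).
have B20 : 0 <= B2 by exact: le_trans (fB2 0).
pose N : R := (1 * n)%:R; pose D : R := d%:R.
have N0 : 0 <= N by []. have D0 : 0 <= D by [].
have dlip := lipschitz_bounded_diff B20 dfdiff fB2.
pose L1 := N * B1; pose L2 := N * (N * B2).
have lip x y : `|f y - f x| <= L1 * `|y - x| by exact: lipschitz_bounded_diff.
have L10 : 0 <= L1 by exact: mulr_ge0.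
have L20 : 0 <= L2 by rewrite !mulr_ge0.
have tay x y : `|f y - f x - 'd f x (y - x)| <= L2 * `|y - x| ^+ 2.
  apply: taylor_lipschitz_diff => //; first exact: mulr_ge0.
have dfle x v : `|'d f x v| <= L1 * `|v|.
  apply: le_trans (norm_diff_le _ _ _) _; apply: ler_wpM2r => //.
  by apply: ler_wpM2l.
have dfBle x y v : `|'d f y v - 'd f x v| <= L2 * `|y - x| * `|v|.
  apply: le_trans (norm_diffB_le _ _ _ _) _; apply: ler_wpM2r => //.
  by rewrite -[leRHS]mulrA; apply: ler_wpM2l.
have le_ef y i : `|delta_mx 0 i *m f y : 'rV_n| <= D * B0.
  apply: le_trans (mx_norm_mul _ _) _; apply: ler_wpM2l => //.
  by rewrite -[leRHS]mul1r; apply: ler_pM => //; exact: mx_norm_delta.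
clearbody L1 L2.
pose K2 := D * (D * (L1 * (D * B0))).
pose K3 := D * (D * (L1 * (D * L1) + L2 * (D * B0))).
pose K1 := D * (L1 + L2).
have [K10 K20 K30] : [/\ 0 <= K1, 0 <= K2 & 0 <= K3].
  by split; rewrite !(mulr_ge0, addr_ge0).
have DB0 : 0 <= D * B0 by exact: mulr_ge0.
have DL1 : 0 <= D * L1 by exact: mulr_ge0.
pose C := 1 + D * B0 + L1 + D * L1 + K1 + K2 + K3.
have upgrade c z : 0 <= z -> c <= C -> c * z <= C * z by move=> *; exact: ler_wpM2r.
exists C; first by rewrite /C; lra.
split.
- move=> y x; apply: le_trans (mx_norm_mul _ _) _.
  apply: le_trans (upgrade (D * B0) _ _ _) => //; last by rewrite /C; lra.
  rewrite -mulrA; apply: ler_wpM2l => //; rewrite mulrC.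
  exact: ler_wpM2r.
- move=> y y'; apply: le_trans (lip _ _) _.
  by apply: upgrade => //; rewrite /C; lra.
- move=> y y' x; apply: le_trans (mx_norm_mul _ _) _.
  apply: le_trans (upgrade (D * L1) _ _ _) => //; last by rewrite /C; lra.
    rewrite -mulrA; apply: ler_wpM2l => //; rewrite mulrCA.
    by apply: ler_wpM2l => //; exact: lip.
- move=> y y' v x; apply: le_trans (mx_norm_mul _ _) _.
  have z0 : 0 <= `|y' - y| ^+ 2 + `|y' - y - v| by rewrite addr_ge0// sqr_ge0.
  apply: le_trans (upgrade K1 _ _ _) => //; last by rewrite /C; lra.
    rewrite -mulrA; apply: ler_wpM2l => //; rewrite mulrCA.
    apply: ler_wpM2l => //.
    have -> : f y' - f y - 'd f y v =
        (f y' - f y - 'd f y (y' - y)) + 'd f y (y' - y - v).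
      have e : 'd f y (y' - y - v) = 'd f y (y' - y) - 'd f y v by exact: linearB.
      by rewrite e addrA subrK.
    apply: le_trans (ler_normD _ _) _.
    apply: (@le_trans _ _ (L2 * `|y' - y| ^+ 2 + L1 * `|y' - y - v|)).
      by apply: lerD; [exact: tay|exact: dfle].
    rewrite mulrDl !mulrDr.
    have := mulr_ge0 L10 (sqr_ge0 `|y' - y|).
    have := mulr_ge0 L20 (normr_ge0 (y' - y - v)); lra.
- move=> y M; apply: (@le_trans _ _ (K2 * `|M|)); last by apply: upgrade => //; rewrite /C; lra.
  apply: le_trans (ler_norm_sum _ _ _) _.
  apply: (@le_trans _ _ (\sum_(i < d) D * (L1 * (D * B0)) * `|M|)).
    apply: ler_sum => i _; apply: le_trans (mx_norm_mul _ _) _.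
    rewrite -!mulrA; apply: ler_wpM2l => //; rewrite mulrC !mulrA.
    apply: ler_pM => //; last exact: mx_norm_row.
    apply: le_trans (dfle _ _) _; rewrite -!mulrA; apply: ler_wpM2l => //.
    exact: le_ef.
  by rewrite sumr_const card_ord -mulr_natl -/D /K2 !mulrA.
- move=> y y' M; apply: (@le_trans _ _ (K3 * (`|y' - y| * `|M|))); last first.
    by apply: upgrade; rewrite ?mulr_ge0// /C; lra.
  rewrite /second_order /tensor_apply -sumrB; apply: le_trans (ler_norm_sum _ _ _) _.
  apply: (@le_trans _ _ (\sum_(i < d) D * (L1 * (D * L1) + L2 * (D * B0)) * (`|y' - y| * `|M|))).
    apply: ler_sum => i _; rewrite -mulmxBr; apply: le_trans (mx_norm_mul _ _) _.
    rewrite -[leRHS]mulrA; apply: ler_wpM2l => //; rewrite [leRHS]mulrA [leLHS]mulrC.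
    apply: ler_pM => //; last exact: mx_norm_row.
    set e : 'rV_d := delta_mx 0 i.
    have -> : ('d f y' \o mulmxr (f y')) e - ('d f y \o mulmxr (f y)) e =
        'd f y' (e *m f y' - e *m f y) + ('d f y' (e *m f y) - 'd f y (e *m f y)).
      exact: (linear_telescope ('d f y) ('d f y') (e *m f y) (e *m f y')).
    apply: le_trans (ler_normD _ _) _; rewrite mulrDl; apply: lerD.
      apply: le_trans (dfle _ _) _; rewrite -mulmxBr; rewrite -!mulrA; apply: ler_wpM2l => //.
      apply: le_trans (mx_norm_mul _ _) _; apply: ler_wpM2l => //.
      rewrite -[leRHS]mul1r; apply: ler_pM => //; exact: mx_norm_delta.
    apply: le_trans (dfBle _ _ _) _; rewrite mulrAC; apply: ler_wpM2r => //.
    by apply: ler_wpM2l => //; exact: le_ef.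
  by rewrite sumr_const card_ord -mulr_natl -/D /K3 !mulrA.
Qed.

End vector_field.

(** * The reflected Euler scheme *)

Section germ.
Context {R : realType} (n d : nat).
Implicit Types (f : 'rV[R]_n -> 'M[R]_(d, n)) (y z k : 'rV[R]_n) (x : 'rV[R]_d) (M : 'M[R]_d).

Definition germ f y x M : 'rV[R]_n := x *m f y + second_order f y M.

(** Chen's relation contributes x1 (x) x2 to the second level, and the second-order
    term turns it into the first-order Taylor term of f along x1 f(y). *)
Lemma germ_defect f y y' x1 x2 M1 M2 :
  germ f y (x1 + x2) (M1 + M2 + x1^T *m x2) - germ f y x1 M1 - germ f y' x2 M2 =
  - (x2 *m (f y' - f y - 'd f y (x1 *m f y))
     + (second_order f y' M2 - second_order f y M2)).
Proof.
rewrite /germ !second_orderD mulmxDl.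
have -> : second_order f y (x1^T *m x2) = x2 *m 'd f y (x1 *m f y).
  exact: tensor_applyE.
rewrite !mulmxBr.
move: (x2 *m 'd f y (x1 *m f y)) (x2 *m f y') (x2 *m f y) (x1 *m f y)
  (second_order f y M1) (second_order f y M2) (second_order f y' M2).
move=> a b c e g h l; apply/rowP => i; rewrite !mxE; ring.
Qed.

Lemma norm_germ_le C f y x M : regular_field C f ->
  `|germ f y x M| <= C * (`|x| + `|M|).
Proof.
move=> rf; apply: le_trans (ler_normD _ _) _; rewrite mulrDr.
by apply: lerD; [exact: rf_bound|exact: rf_second].
Qed.

(** The error made over one interval when the increment of the unreflected part is
    replaced by the germ at the left end point. *)
Definition local_error f y z z' x M : 'rV[R]_n := z' - z - germ f y x M.

(** The Taylor remainder of f over the first interval involves y2 - y1 - x1 f(y1),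
    which consists of the reflection, the local error and the second-order term. *)
Lemma local_error_defect C f (y1 y2 : 'rV[R]_n) (z1 z2 z3 : 'rV[R]_n) x1 x2 M1 M2 (ka a a' : R) :
  1 <= C -> regular_field C f ->
  0 <= a -> 0 <= a' -> `|x2| <= a' -> `|M2| <= a' ^+ 2 -> `|M1| <= a ^+ 2 ->
  `|(y2 - z2) - (y1 - z1)| <= ka ->
  `|local_error f y1 z1 z3 (x1 + x2) (M1 + M2 + x1^T *m x2)| <=
  `|local_error f y1 z1 z2 x1 M1| + `|local_error f y2 z2 z3 x2 M2| +
  C * C * (a' * ((`|z2 - z1| + ka) ^+ 2 + ka + `|local_error f y1 z1 z2 x1 M1| + a ^+ 2)
           + (`|z2 - z1| + ka) * a' ^+ 2).
Proof.
move=> C1 rf a0 a'0 x2a M2a M1a Kka.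
have ka0 : 0 <= ka by exact: le_trans Kka.
have C0 : 0 <= C by lra.
have -> : local_error f y1 z1 z3 (x1 + x2) (M1 + M2 + x1^T *m x2) =
  local_error f y1 z1 z2 x1 M1 + local_error f y2 z2 z3 x2 M2 +
  (x2 *m (f y2 - f y1 - 'd f y1 (x1 *m f y1))
     + (second_order f y2 M2 - second_order f y1 M2)).
  rewrite -[X in _ = _ + X]opprK -(germ_defect f y1 y2 x1 x2 M1 M2) /local_error.
  move: (germ f y1 (x1 + x2) _) (germ f y1 x1 M1) (germ f y2 x2 M2) => g1 g2 g3.
  by apply/rowP => i; rewrite !mxE; ring.
apply: le_trans (ler_normD _ _) _; apply: lerD; first exact: ler_normD.
set J := local_error f y1 z1 z2 x1 M1.
have dy : `|y2 - y1| <= `|z2 - z1| + ka.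
  have -> : y2 - y1 = (z2 - z1) + ((y2 - z2) - (y1 - z1)).
    by apply/rowP => i; rewrite !mxE; ring.
  by apply: le_trans (ler_normD _ _) _; rewrite lerD2l.
have rest : `|y2 - y1 - x1 *m f y1| <= ka + `|J| + C * a ^+ 2.
  have -> : y2 - y1 - x1 *m f y1 =
      ((y2 - z2) - (y1 - z1)) + J + second_order f y1 M1.
    rewrite /J /local_error /germ; move: (x1 *m f y1) (second_order f y1 M1) => u v.
    by apply/rowP => i; rewrite !mxE; ring.
  apply: le_trans (ler_normD _ _) _; apply: lerD.
    by apply: le_trans (ler_normD _ _) _; rewrite lerD2r.
  by apply: le_trans (rf_second rf _ _) _; apply: ler_wpM2l.
have zk0 : 0 <= `|z2 - z1| + ka by exact: addr_ge0.
apply: le_trans (ler_normD _ _) _.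
apply: (@le_trans _ _ (C * (a' * ((`|z2 - z1| + ka) ^+ 2 + (ka + `|J| + C * a ^+ 2)))
   + C * ((`|z2 - z1| + ka) * a' ^+ 2))).
  apply: lerD.
    apply: le_trans (rf_taylor rf _ _ _ _) _; apply: ler_wpM2l => //.
    apply: ler_pM => //.
    by apply: lerD => //; rewrite ler_sqr// nnegrE.
  apply: le_trans (rf_second_lipschitz rf _ _ _) _; apply: ler_wpM2l => //.
  by apply: ler_pM.
rewrite [leRHS]mulrDr; apply: lerD; last first.
  by rewrite -[leRHS]mulrA; apply: ler_wpM2l => //; rewrite ler_peMl// mulr_ge0// sqr_ge0.
rewrite -[leRHS]mulrA; apply: ler_wpM2l => //; rewrite [leRHS]mulrCA; apply: ler_wpM2l => //.
have J0 : 0 <= `|J| by [].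
have s0 := sqr_ge0 (`|z2 - z1| + ka).
have up t : 0 <= t -> t <= C * t by move=> t0; exact: ler_peMl.
have := up _ s0; have := up _ ka0; have := up _ J0; rewrite !mulrDr; lra.
Qed.

End germ.

Section reflected_euler.
Context {R : realType} (n d : nat) (f : 'rV[R]_n -> 'M[R]_(d, n)) (y : 'rV[R]_n).
Variables (x : nat -> 'rV[R]_d) (xx : nat -> nat -> 'M[R]_d) (l : nat -> 'rV[R]_n).

(** The pair (Z, K): Z makes one step along the germ at Z + K, then K is raised, in each
    component, just enough for Z + K to stay above the barrier l. *)
Fixpoint euler (k : nat) : 'rV[R]_n * 'rV[R]_n :=
  if k is k'.+1 then
    let: (z, c) := euler k' in
    let z' := z + germ f (z + c) (x k'.+1 - x k') (xx k' k'.+1) in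
    (z', \row_i Num.max (c 0 i) (l k'.+1 0 i - z' 0 i))
  else (y, 0).

Definition euler_Z k := (euler k).1.
Definition euler_K k := (euler k).2.
Definition euler_Y k := euler_Z k + euler_K k.
Definition euler_J i j :=
  local_error f (euler_Y i) (euler_Z i) (euler_Z j) (x j - x i) (xx i j).
Definition euler_ka i j := \sum_c (euler_K j 0 c - euler_K i 0 c).

Lemma euler_ZS k : euler_Z k.+1 =
  euler_Z k + germ f (euler_Y k) (x k.+1 - x k) (xx k k.+1).
Proof. by rewrite /euler_Y /euler_Z /euler_K /=; case: (euler k). Qed.

Lemma euler_KS k c : euler_K k.+1 0 c =
  Num.max (euler_K k 0 c) (l k.+1 0 c - euler_Z k.+1 0 c).
Proof. by rewrite /euler_Y /euler_Z /euler_K /=; case: (euler k) => a b; rewrite mxE. Qed.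

Hypothesis yl : forall c, l 0 0 c <= y 0 c.

Lemma euler_K_mono c i j : (i <= j)%N -> euler_K i 0 c <= euler_K j 0 c.
Proof.
elim: j => [|j IH]; first by rewrite leqn0 => /eqP ->.
rewrite leq_eqVlt => /predU1P[->//|/IH/le_trans]; apply.
by rewrite euler_KS le_max lexx.
Qed.

Lemma euler_Y_ge k c : l k 0 c <= euler_Y k 0 c.
Proof.
case: k => [|k]; first by rewrite mxE mxE addr0.
by rewrite mxE euler_KS addrC -lerBlDr le_max lexx orbT.
Qed.

Lemma euler_K_skorokhod k c : l k.+1 0 c < euler_Y k.+1 0 c ->
  euler_K k.+1 0 c = euler_K k 0 c.
Proof.
rewrite mxE euler_KS addrC -ltrBlDr => h.
by move: h; rewrite maxEle; case: ifP => //; rewrite ltxx.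
Qed.

Lemma norm_euler_K i j : (i <= j)%N -> `|euler_K j - euler_K i| <= euler_ka i j.
Proof.
move=> ij; apply: le_trans (norm_le_sum _) _ => [c|].
  by rewrite !mxE subr_ge0 euler_K_mono.
by under eq_bigr => c _ do rewrite !mxE.
Qed.

Variables (q C Om : R) (w : nat -> nat -> R).
Hypothesis C1 : 1 <= C.
Hypothesis rf : regular_field C f.
Hypothesis chen : forall i j k, (i <= j <= k)%N ->
  xx i k - xx i j - xx j k = (x j - x i)^T *m (x k - x j).
Hypothesis w0 : forall i j, 0 <= w i j.
Hypothesis wsup : forall i j k, (i <= j <= k)%N -> w i j + w j k <= w i k.
Hypothesis wOm : forall i j, (i <= j)%N -> w i j <= Om.
Hypothesis xw : forall i j, (i <= j)%N -> `|x j - x i| <= w i j `^ q.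
Hypothesis xxw : forall i j, (i <= j)%N -> `|xx i j| <= (w i j `^ q) ^+ 2.
Hypothesis lw : forall i j, (i <= j)%N -> `|l j - l i| <= w i j `^ q.

(** For the Skorokhod estimate: K only rises to a value l - Z, and the path is above l
    at the initial point i, so K - K i is bounded by the oscillations of l and Z. *)
Lemma euler_rough_scheme :
  rough_scheme q (C * C + n%:R) Om w euler_ka
    (fun i j => `|euler_Z j - euler_Z i|) (fun i j => `|euler_J i j|).
Proof.
have C0 : 0 <= C by move: C1; lra.
have CC : C <= C * C by rewrite ler_peMl.
have CCn : C <= C * C + n%:R by rewrite (le_trans CC)// lerDl.
have chen_diag i : xx i i = 0.
  have := @chen i i i; rewrite leqnn => /(_ isT).
  rewrite !subrr trmx0 mul0mx sub0r => /eqP; rewrite oppr_eq0.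
  by move/eqP.
have germ_w a i j : (i <= j)%N -> `|germ f a (x j - x i) (xx i j)| <=
    (C * C + n%:R) * (w i j `^ q + (w i j `^ q) ^+ 2).
  move=> ij; apply: le_trans (norm_germ_le _ _ _ rf) _.
  by apply: ler_pM => //; rewrite ?addr_ge0//; apply: lerD; [exact: xw|exact: xxw].
split => //.
- move=> i j ij; apply: sumr_ge0 => c _.
  by rewrite subr_ge0 euler_K_mono.
- move=> i j k ijk; rewrite /euler_ka -big_split/=; apply: eq_bigr => c _.
  by rewrite addrC subrKA.
- move=> i j k ijk.
  have -> : euler_Z k - euler_Z i = (euler_Z j - euler_Z i) + (euler_Z k - euler_Z j).
    by rewrite [RHS]addrC subrKA.
  exact: ler_normD.
- move=> i; rewrite /euler_J /local_error chen_diag !subrr /germ mul0mx.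
  have := second_orderB f (euler_Y i) 0 0; rewrite !subrr => ->.
  by rewrite addr0 subrr normr0.
- by move=> i; rewrite /euler_J /local_error euler_ZS [euler_Z i + _]addrC addrK subrr normr0.
- move=> i j ij.
  have -> : euler_Z j - euler_Z i = germ f (euler_Y i) (x j - x i) (xx i j) + euler_J i j.
    by rewrite /euler_J /local_error [RHS]addrC subrK.
  apply: le_trans (ler_normD _ _) _; apply: lerD => //; exact: germ_w.
- move=> i j ij; apply: le_trans (ler_normB _ _) _; rewrite addrC.
  by apply: lerD => //; exact: germ_w.
- move=> i j B ij bnd.
  have B0 : 0 <= B.
    by apply: le_trans (bnd i _); rewrite ?leqnn// addr_ge0// powR_ge0.
  have Kc c r : (i <= r <= j)%N -> euler_K r 0 c <= euler_K i 0 c + B.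
    elim: r => [|r IH].
      by rewrite leqn0 => /andP[/eqP -> _]; rewrite lerDl.
    move=> /andP[ir rj]; move: ir; rewrite leq_eqVlt => /predU1P[->|ir].
      by rewrite lerDl.
    rewrite euler_KS ge_max IH/=; last by rewrite (ltnW rj) -ltnS ir.
    have irj : (i <= r.+1 <= j)%N by rewrite rj ltnW.
    have := bnd _ irj.
    have le1 := le_trans (mx_norm_ge_entry (l r.+1 - l i) 0 c) (lw (ltnW ir)).
    have le2 := mx_norm_ge_entry (euler_Z r.+1 - euler_Z i) 0 c.
    have := euler_Y_ge i c; move: le1 le2; rewrite !mxE !ler_norml.
    by move=> /andP[_ ?] /andP[? _]; lra.
  apply: (@le_trans _ _ (\sum_(c < n) B)).
    apply: ler_sum => c _; have := Kc c j; rewrite ij leqnn => /(_ isT); lra.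
  rewrite sumr_const card_ord -[leLHS]mulr_natl.
  apply: ler_wpM2r => //.
  by rewrite lerDr mulr_ge0.
- move=> i j k /[dup] ijk /andP[ij jk].
  have xe : x k - x i = (x j - x i) + (x k - x j) by rewrite [RHS]addrC subrKA.
  have xxe : xx i k = xx i j + xx j k + (x j - x i)^T *m (x k - x j).
    by rewrite -(chen ijk) [RHS]addrC (addrC (xx i j)) addrA !subrK.
  have Kij : `|(euler_Y j - euler_Z j) - (euler_Y i - euler_Z i)| <= euler_ka i j.
    have Ye m : euler_Y m - euler_Z m = euler_K m by rewrite /euler_Y addrAC subrr add0r.
    by rewrite !Ye; exact: norm_euler_K.
  have ka0 : 0 <= euler_ka i j by exact: le_trans Kij.
  rewrite {1}/euler_J xe xxe.
  apply: le_trans (local_error_defect _ _ C1 rf (powR_ge0 _ _) (powR_ge0 _ _)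
    (xw jk) (xxw jk) (xxw ij) Kij) _.
  rewrite -/(euler_J _ _) -/(euler_J _ _).
  apply: lerD => //; apply: ler_wpM2r; last by rewrite lerDl.
  by rewrite addr_ge0// mulr_ge0 ?powR_ge0 ?addr_ge0 ?sqr_ge0.
Qed.

End reflected_euler.

(** * Limits of schemes along an ultrafilter *)

(** Along an ultrafilter every cluster point is a limit, and balls are compact. *)
Lemma ultra_bounded_cvg (R : realType) n (I : Type) (U : set_system I)
    {FU : UltraFilter U} (g : I -> 'rV[R]_n) (B : R) :
  (\forall i \near U, `|g i| <= B) -> exists l : 'rV[R]_n, g i @[i --> U] --> l.
Proof.
move=> gB; pose A := [set v : 'rV[R]_n | `|v| <= B].
have cA : compact A.
  apply: bounded_closed_compact.
    exists B; split; first exact: num_real.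
    by move=> x Bx v /= vB; exact: le_trans vB (ltW Bx).
  rewrite (_ : A = (fun v : 'rV[R]_n => `|v|) @^-1` [set x | x <= B])//.
  apply: closed_comp; last exact: closed_le.
  move=> x _. exact: (@norm_continuous R 'rV[R]_n).
have [l [_ cl]] := cA (g @ U) _ gB.
exists l => V Vl; have [//|nV] := in_ultra_setVsetC (g @^-1` V) FU.
by have [v [/= nVv Vv]] := cl (~` V) V nV Vl.
Qed.

Lemma cvg_real_sum (R : realType) (I J : Type) (F : set_system I) {FF : Filter F}
    (r : seq J) (u : J -> I -> R) (l : J -> R) :
  (forall c, u c i @[i --> F] --> l c) ->
  \sum_(c <- r) u c i @[i --> F] --> \sum_(c <- r) l c.
Proof.
move=> ul; elim: r => [|c r IH].
  by rewrite big_nil; under eq_cvg do rewrite big_nil; exact: cvg_cst.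
rewrite big_cons; under eq_cvg do rewrite big_cons.
exact: cvgD.
Qed.

Lemma le_cvg_limits (R : realType) (I : Type) (F : set_system I)
    {FF : ProperFilter F} (g h : I -> R) (a b : R) :
  g i @[i --> F] --> a -> h i @[i --> F] --> b ->
  (\forall i \near F, g i <= h i) -> a <= b.
Proof.
move=> ga hb gh; rewrite -subr_ge0; apply: (cvgr_to_ge (cvgB hb ga)).
by apply: filterS gh => i; rewrite subr_ge0.
Qed.

Section euler_limit.
Context {R : realType} (n d : nat) (T q C : R) (f : 'rV[R]_n -> 'M[R]_(d, n)).
Variables (X : R -> 'rV[R]_d) (XX : R -> R -> 'M[R]_d) (L : R -> 'rV[R]_n).
Variables (w : R -> R -> R) (y : 'rV[R]_n).

(** Z + K solves the reflected equation at the points of D, up to errors controlled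
    by A.  All clauses are stable under pointwise limits.  rsc_left and rsc_right
    express complementarity without an integral: where Z + K is strictly
    above L, K does not jump, respectively stays constant for a while.  In rsc_J_left and
    rsc_left, a bounds the control strictly before t. *)
Record reflected_scheme (D : set R) (A : R) (Z K : R -> 'rV[R]_n) : Prop :=
  ReflectedScheme {
  rsc_Z0 : Z 0 = y;
  rsc_K0 : K 0 = 0;
  rsc_Z : forall s t, D s -> D t -> s <= t -> `|Z t - Z s| <= A * w s t `^ q;
  rsc_K_mono : forall s t c, D s -> D t -> s <= t -> K s 0 c <= K t 0 c;
  rsc_K : forall s t, D s -> D t -> s <= t ->
    \sum_c (K t 0 c - K s 0 c) <= A * w s t `^ q;
  rsc_J : forall s t, D s -> D t -> s <= t ->
    `|local_error f (Z s + K s) (Z s) (Z t) (X t - X s) (XX s t)| <=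
    A * ((w s t + \sum_c (K t 0 c - K s 0 c)) `^ q) ^+ 3;
  rsc_J_left : forall s t a, D s -> D t -> s < t ->
    (forall u, s <= u < t -> w s u <= a) ->
    `|local_error f (Z s + K s) (Z s) (Z t) (X t - X s) (XX s t)| <=
    A * (a `^ q) `^ (q * 3 - 1) * (w s t + \sum_c (K t 0 c - K s 0 c));
  rsc_ge : forall t c, D t -> L t 0 c <= Z t 0 c + K t 0 c;
  rsc_left : forall s t a c, D s -> D t -> s < t ->
    (forall u, s <= u < t -> w s u <= a) ->
    L t 0 c < Z t 0 c + K t 0 c -> K t 0 c - K s 0 c <= A * a `^ q;
  rsc_right : forall s t c, D s -> D t -> s <= t ->
    (2 * A + 1) * w s t `^ q < Z s 0 c + K s 0 c - L s 0 c ->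
    K t 0 c = K s 0 c }.

Hypothesis (T0 : 0 <= T) (q3 : 1 < q * 3) (q2 : q * 2 <= 1) (C1 : 1 <= C).
Hypothesis rf : regular_field C f.
Hypothesis cw : control T w.
Hypothesis chen : forall s u t, 0 <= s -> s <= u -> u <= t -> t <= T ->
  XX s t - XX s u - XX u t = (X u - X s)^T *m (X t - X u).
Hypothesis Xw : forall s t, 0 <= s -> s <= t -> t <= T -> `|X t - X s| <= w s t `^ q.
Hypothesis XXw : forall s t, 0 <= s -> s <= t -> t <= T -> `|XX s t| <= (w s t `^ q) ^+ 2.
Hypothesis Lw : forall s t, 0 <= s -> s <= t -> t <= T -> `|L t - L s| <= w s t `^ q.
Hypothesis yL : forall c, L 0 0 c <= y 0 c.

(** Points of S outside [0, T] are discarded so that every finite list defines a grid;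
    the default value T continues the grid by a constant. *)
Definition grid (S : seq R) : seq R :=
  0 :: sort <=%O [seq t <- S | 0 <= t <= T].

Lemma grid_sorted S : sorted <=%O (grid S).
Proof.
rewrite /= path_sortedE; last exact: le_trans.
rewrite sort_sorted ?andbT; last exact: le_total.
by apply/allP => t; rewrite mem_sort mem_filter => /andP[/andP[]].
Qed.

Lemma mem_grid S t : (t \in grid S) = (t == 0) || ((0 <= t <= T) && (t \in S)).
Proof. by rewrite inE mem_sort mem_filter. Qed.

Lemma grid_itv S t : t \in grid S -> 0 <= t <= T.
Proof. by rewrite mem_grid => /orP[/eqP ->|/andP[]//]; rewrite lexx. Qed.

Definition grid_point S k := nth T (grid S) k.

Lemma grid_point_itv S k : 0 <= grid_point S k <= T.
Proof.
have [kS|kS] := ltnP k (size (grid S)); first by apply: (@grid_itv S); exact: mem_nth.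
by rewrite /grid_point nth_default// T0 lexx.
Qed.

Lemma grid_point_mono S i j : (i <= j)%N -> grid_point S i <= grid_point S j.
Proof.
move=> ij; have [jS|jS] := ltnP j (size (grid S)); last first.
  by rewrite {2}/grid_point nth_default//; case/andP: (grid_point_itv S i).
have iS := leq_ltn_trans ij jS.
exact: (sorted_leq_nth le_trans le_refl T (grid_sorted S)).
Qed.

Lemma grid_index_mono S s t : s \in grid S -> t \in grid S -> s <= t ->
  (index s (grid S) <= index t (grid S))%N.
Proof.
move=> sS tS st; rewrite leqNgt; apply/negP => ts.
have := sorted_ltn_index le_trans (grid_sorted S) _ _ tS sS ts.
by move=> ts'; have e : s = t; [apply/le_anti; rewrite st|rewrite e ltnn in ts].
Qed.

Lemma grid_point_index S t : t \in grid S -> grid_point S (index t (grid S)) = t.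
Proof. by move=> tS; rewrite /grid_point nth_index. Qed.

Lemma grid_point_pred S t k : t \in grid S -> index t (grid S) = k.+1 ->
  grid_point S k < t.
Proof.
move=> tS tk; rewrite lt_neqAle -{2}(grid_point_index tS) tk grid_point_mono// andbT.
apply/eqP => e; have kS : (k < size (grid S))%N.
  by apply: ltnW; rewrite -tk index_mem.
by have := index_nth T kS; rewrite -/(grid_point S k) e tk ltnn.
Qed.


Section one_grid.
Variable S : seq R.
Let x k := X (grid_point S k).
Let xx i j := XX (grid_point S i) (grid_point S j).
Let l k := L (grid_point S k).
Let wd i j := w (grid_point S i) (grid_point S j).

Lemma grid_rough_scheme : rough_scheme q (C * C + n%:R) (w 0 T) wd
  (euler_ka f y x xx l)
  (fun i j => `|euler_Z f y x xx l j - euler_Z f y x xx l i|)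
  (fun i j => `|euler_J f y x xx l i j|).
Proof.
apply: euler_rough_scheme => //.
- move=> i j k /andP[ij jk]; have /andP[i0 _] := grid_point_itv S i.
  have /andP[_ kT] := grid_point_itv S k.
  by apply: chen => //; exact: grid_point_mono.
- by move=> i j; exact: control_ge0 cw _ _.
- move=> i j k /andP[ij jk]; have /andP[i0 _] := grid_point_itv S i.
  have /andP[_ kT] := grid_point_itv S k.
  by apply: (control_super cw) => //; exact: grid_point_mono.
- move=> i j ij; have /andP[i0 iT] := grid_point_itv S i.
  have /andP[j0 jT] := grid_point_itv S j.
  apply: (@le_trans _ _ (w 0 (grid_point S j))).
    by apply: (control_subr cw) => //; exact: grid_point_mono.
  by apply: (control_subl cw).
- move=> i j ij; have /andP[i0 _] := grid_point_itv S i.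
  have /andP[_ jT] := grid_point_itv S j.
  by apply: Xw => //; exact: grid_point_mono.
- move=> i j ij; have /andP[i0 _] := grid_point_itv S i.
  have /andP[_ jT] := grid_point_itv S j.
  by apply: XXw => //; exact: grid_point_mono.
- move=> i j ij; have /andP[i0 _] := grid_point_itv S i.
  have /andP[_ jT] := grid_point_itv S j.
  by apply: Lw => //; exact: grid_point_mono.
Qed.

Definition grid_Z t := euler_Z f y x xx l (index t (grid S)).
Definition grid_K t := euler_K f y x xx l (index t (grid S)).

Lemma grid_reflected_scheme (A : R) : 0 <= A ->
  (forall i j, (i <= j)%N ->
   [/\ euler_ka f y x xx l i j <= A * wd i j `^ q,
       `|euler_Z f y x xx l j - euler_Z f y x xx l i| <= A * wd i j `^ q,
       `|euler_J f y x xx l i j| <=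
          A * ((wd i j + euler_ka f y x xx l i j) `^ q) ^+ 3 &
       `|euler_J f y x xx l i j.+1| <= A * (wd i j `^ q) `^ (q * 3 - 1) *
          (wd i j.+1 + euler_ka f y x xx l i j.+1)]) ->
  reflected_scheme [set` grid S] A grid_Z grid_K.
Proof.
have q0 : 0 <= q by move: q3; lra.
move=> A0 bounds; have g0 : index 0 (grid S) = 0%N by rewrite /= eqxx.
have gw s t : s \in grid S -> t \in grid S ->
    wd (index s (grid S)) (index t (grid S)) = w s t.
  by move=> sS tS; rewrite /wd !grid_point_index.
have mono c i j : (i <= j)%N -> euler_K f y x xx l i 0 c <= euler_K f y x xx l j 0 c.
  exact: euler_K_mono.
have pred_t s t : s \in grid S -> t \in grid S -> s < t ->
    exists2 k, index t (grid S) = k.+1 & (index s (grid S) <= k)%N.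
  move=> sS tS st; have := grid_index_mono sS tS (ltW st).
  case e : (index t (grid S)) => [|k].
    rewrite leqn0 => /eqP e'; have : s = t by apply: (@index_inj _ 0 (grid S)) => //; rewrite e e'.
    by move=> st'; rewrite st' ltxx in st.
  rewrite leq_eqVlt => /predU1P[e'|]; last by exists k.
  have : s = t by apply: (@index_inj _ 0 (grid S)) => //; rewrite e e'.
  by move=> st'; rewrite st' ltxx in st.
have pred_w s t a k : s \in grid S -> t \in grid S -> 
    index t (grid S) = k.+1 -> (index s (grid S) <= k)%N ->
    (forall u, s <= u < t -> w s u <= a) -> wd (index s (grid S)) k <= a.
  move=> sS tS tk sk wa; rewrite /wd grid_point_index//; apply: wa.
  rewrite (grid_point_pred tS tk) andbT -{1}(grid_point_index sS).
  exact: grid_point_mono.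
split.
- by rewrite /grid_Z g0.
- by rewrite /grid_K g0.
- move=> s t /= sS tS st; have [_ + _ _] := bounds _ _ (grid_index_mono sS tS st).
  by rewrite gw.
- by move=> s t c /= sS tS st; apply: mono; exact: grid_index_mono.
- move=> s t /= sS tS st; have [+ _ _ _] := bounds _ _ (grid_index_mono sS tS st).
  by rewrite gw.
- move=> s t /= sS tS st; have [_ _ + _] := bounds _ _ (grid_index_mono sS tS st).
  by rewrite gw// /euler_J /x /xx !grid_point_index.
- move=> s t a /= sS tS st wa.
  have [k tk sk] := pred_t _ _ sS tS st.
  have h m : m = k.+1 -> `|euler_J f y x xx l (index s (grid S)) m| <=
      A * (wd (index s (grid S)) k `^ q) `^ (q * 3 - 1) *
      (wd (index s (grid S)) m + euler_ka f y x xx l (index s (grid S)) m).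
    by move=> ->; have [_ _ _] := bounds _ _ sk.
  have := h _ tk.
  rewrite (gw _ _ sS tS) /euler_J /x /xx (grid_point_index sS) (grid_point_index tS).
  move=> /le_trans; apply.
  apply: ler_wpM2r.
    rewrite addr_ge0 ?(control_ge0 cw)//; apply: sumr_ge0 => c _.
    by rewrite subr_ge0; apply: mono; exact: grid_index_mono (ltW st).
  apply: ler_wpM2l => //; apply: le_powR; [by move: q3; lra|exact: powR_ge0|].
  apply: le_powR => //; first exact: (control_ge0 cw).
  exact: pred_w sS tS tk sk wa.
- move=> t c /= tS; have := @euler_Y_ge _ _ _ f y x xx l yL (index t (grid S)) c.
  by rewrite /euler_Y mxE /l grid_point_index.
- move=> s t a c /= sS tS st wa Lt.
  have [k tk sk] := pred_t _ _ sS tS st.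
  have h m : m = k.+1 -> l m 0 c < euler_Y f y x xx l m 0 c ->
      euler_K f y x xx l m 0 c = euler_K f y x xx l k 0 c.
    by move=> ->; exact: euler_K_skorokhod.
  have := h _ tk; rewrite /euler_Y mxE /l (grid_point_index tS) => /(_ Lt).
  rewrite /grid_K => ->.
  have [ka _ _ _] := bounds _ _ sk.
  apply: (@le_trans _ _ (euler_ka f y x xx l (index s (grid S)) k)).
    rewrite /euler_ka (bigD1 c)//= lerDl; apply: sumr_ge0 => c' _.
    by rewrite subr_ge0; exact: mono.
  apply: le_trans ka _; apply: ler_wpM2l => //; apply: le_powR => //.
    exact: (control_ge0 cw).
  exact: pred_w sS tS tk sk wa.
- move=> s t c /= sS tS st small.
  have ist := grid_index_mono sS tS st.
  have [s0 tT] : 0 <= s /\ t <= T by move: (grid_itv sS) (grid_itv tS) => /andP[? _] /andP[_ ?].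
  suff h k : (index s (grid S) <= k <= index t (grid S))%N ->
      euler_K f y x xx l k 0 c = euler_K f y x xx l (index s (grid S)) 0 c.
    by rewrite /grid_K h// ist leqnn.
  elim: k => [|k IH]; first by rewrite leqn0 => /andP[/eqP -> _].
  rewrite leq_eqVlt ltnS => /andP[/predU1P[->//|sk] kt].
  rewrite -IH ?sk ?(ltnW kt)//; apply: euler_K_skorokhod.
  have sk1 := leqW sk.
  have gsk : s <= grid_point S k.+1.
    by rewrite -{1}(grid_point_index sS) grid_point_mono.
  have gkt : grid_point S k.+1 <= t.
    by rewrite -[leRHS](grid_point_index tS) grid_point_mono.
  have wk : wd (index s (grid S)) k.+1 `^ q <= w s t `^ q.
    apply: le_powR => //; first exact: (control_ge0 cw).
    by rewrite /wd grid_point_index//; apply: (control_subl cw).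
  have [kab Zb _ _] := bounds _ _ sk1.
  have Lb := Lw s0 gsk (le_trans gkt tT).
  have wks : w s (grid_point S k.+1) `^ q <= w s t `^ q.
    by move: wk; rewrite /wd grid_point_index.
  have := le_trans (mx_norm_ge_entry (euler_Z f y x xx l k.+1 - euler_Z f y x xx l (index s (grid S))) 0 c)
     (le_trans Zb (ler_wpM2l A0 wk)).
  have := le_trans (mx_norm_ge_entry (L (grid_point S k.+1) - L s) 0 c)
     (le_trans Lb wks).
  have := mono c _ _ sk1.
  have Aw0 : 0 <= A * w s t `^ q by rewrite mulr_ge0 ?powR_ge0.
  move: small; rewrite /euler_Y /grid_Z /grid_K /l !mxE mulrDl mul1r -[2 * A * _]mulrA.
  rewrite !ler_norml => sm K1 /andP[_ L1] /andP[Z1 _].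
  lra.
Qed.

End one_grid.

(** Continuity of f and of its second-order term in the base point. *)
Lemma cvg_local_error (I : Type) (F : set_system I) {FF : Filter F}
    (u v v' : I -> 'rV[R]_n) a b b' x M :
  u i @[i --> F] --> a -> v i @[i --> F] --> b -> v' i @[i --> F] --> b' ->
  local_error f (u i) (v i) (v' i) x M @[i --> F] --> local_error f a b b' x M.
Proof.
move=> ua vb vb'; apply: cvgB; first exact: cvgB.
apply/cvgrPdist_le => e e0.
have C0 : 0 <= C by move: C1; lra.
have c0 : 0 < C * (`|x| + `|M|) + 1 by rewrite ltr_wpDl// mulr_ge0// addr_ge0.
move/cvgrPdist_le : ua => /(_ (e / (C * (`|x| + `|M|) + 1))).
rewrite divr_gt0// => /(_ isT); apply: filterS => i ui.
apply: (@le_trans _ _ (C * (`|x| + `|M|) * `|a - u i|)).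
  have -> : germ f a x M - germ f (u i) x M = x *m (f a - f (u i)) +
      (second_order f a M - second_order f (u i) M).
    by rewrite /germ mulmxBr opprD addrACA.
  apply: le_trans (ler_normD _ _) _; rewrite mulrDr mulrDl; apply: lerD.
    by rewrite -mulrA; exact: (rf_mul_lipschitz rf).
  by rewrite -mulrA [`|M| * _]mulrC; exact: (rf_second_lipschitz rf).
apply: (@le_trans _ _ ((C * (`|x| + `|M|) + 1) * `|a - u i|)).
  by apply: ler_wpM2r => //; rewrite lerDl.
by rewrite -ler_pdivlMl// mulrC.
Qed.

(** The limit is taken along an ultrafilter containing, for every t, the grids that
    contain t.  Every point of [0, T] thus belongs eventually to the grids, so the
    estimates, uniform in the grid, pass to the limit at all points at once, jump
    times included. *)
Lemma reflected_scheme_limit (A : R) (ZS KS : seq R -> R -> 'rV[R]_n) : 0 <= A ->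
  (forall S, reflected_scheme [set` grid S] A (ZS S) (KS S)) ->
  exists Z K, reflected_scheme [set t | 0 <= t <= T] A Z K.
Proof.
move=> A0 HS; have q0 : 0 < q by move: q3; lra.
pose F : set_system (seq R) :=
  [set B : set (seq R) | exists S0 : seq R, forall S : seq R, {subset S0 <= S} -> B S].
have FF : ProperFilter F.
  split; first by move=> [S0 /(_ S0)]; apply.
  split; first by exists [::].
  - move=> B B' [S0 HB] [S0' HB']; exists (S0 ++ S0') => S sub; split.
      by apply: HB => t tS; apply: sub; rewrite mem_cat tS.
    by apply: HB' => t tS; apply: sub; rewrite mem_cat tS orbT.
  - by move=> B B' BB' [S0 HB]; exists S0 => S /HB /BB'.
have [U [FU sFU]] := ultraFilterLemma FF.
have Ut t : 0 <= t <= T -> \forall S \near U, t \in grid S.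
  move=> tT; apply: sFU; exists [:: t] => S /(_ t); rewrite inE eqxx => /(_ isT).
  by move=> /= tS; rewrite mem_grid tT tS orbT.
have zin : (0 : R) <= 0 <= T by rewrite lexx T0.
have cZ (t : R) : exists z : 'rV[R]_n, 0 <= t <= T -> ZS S t @[S --> U] --> z.
  have [tT|nt] := pselect (0 <= t <= T); last by exists 0.
  have [z cz] : exists z : 'rV[R]_n, ZS S t @[S --> U] --> z; last by exists z.
  apply: (@ultra_bounded_cvg _ _ _ _ _ _ (`|y| + A * w 0 t `^ q)).
  have [t0 _] := andP tT.
  near=> S; have tS : t \in grid S by near: S; exact: Ut.
  have := rsc_Z (HS S) (s := 0) (t := t); rewrite (rsc_Z0 (HS S)) /= => h.
  rewrite -[ZS S t](subrK y) addrC; apply: le_trans (ler_normD _ _) _.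
  rewrite lerD2l; apply: h => //.
  by rewrite mem_grid eqxx.
have cK (t : R) : exists z : 'rV[R]_n, 0 <= t <= T -> KS S t @[S --> U] --> z.
  have [tT|nt] := pselect (0 <= t <= T); last by exists 0.
  have [z cz] : exists z : 'rV[R]_n, KS S t @[S --> U] --> z; last by exists z.
  apply: (@ultra_bounded_cvg _ _ _ _ _ _ (A * w 0 t `^ q)).
  have [t0 _] := andP tT.
  near=> S; have tS : t \in grid S by near: S; exact: Ut.
  have z0 : 0 \in grid S by rewrite mem_grid eqxx.
  have mono c : 0 <= KS S t 0 c.
    by have := rsc_K_mono (HS S) c z0 tS t0; rewrite (rsc_K0 (HS S)) mxE.
  have := rsc_K (HS S) z0 tS t0; rewrite (rsc_K0 (HS S)) => le.
  apply: mx_norm_le => [|i c]; first by rewrite mulr_ge0 ?powR_ge0.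
  rewrite ord1 ger0_norm//; apply: le_trans le.
  rewrite (bigD1 c)//= mxE subr0 lerDl; apply: sumr_ge0 => c' _.
  by rewrite mxE subr0.
have {cZ}[Z cZ] := choice cZ.
have {cK}[K cK] := choice cK.
have cKc t c : 0 <= t <= T -> KS S t 0 c @[S --> U] --> K t 0 c.
  by move=> tT; apply: (cvg_comp _ _ (cK t tT) (@coord_continuous R 1 n 0 c (K t))).
have cZc t c : 0 <= t <= T -> ZS S t 0 c @[S --> U] --> Z t 0 c.
  by move=> tT; apply: (cvg_comp _ _ (cZ t tT) (@coord_continuous R 1 n 0 c (Z t))).
have cka s t : 0 <= s <= T -> 0 <= t <= T ->
    \sum_c (KS S t 0 c - KS S s 0 c) @[S --> U] --> \sum_c (K t 0 c - K s 0 c).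
  move=> sT tT.
  apply: cvg_real_sum => c.
  by apply: cvgB; exact: cKc.
have cJ s t : 0 <= s <= T -> 0 <= t <= T ->
    `|local_error f (ZS S s + KS S s) (ZS S s) (ZS S t) (X t - X s) (XX s t)| @[S --> U]
    --> `|local_error f (Z s + K s) (Z s) (Z t) (X t - X s) (XX s t)|.
  move=> sT tT; apply: cvg_norm; apply: cvg_local_error; try exact: cZ.
  by apply: cvgD; [exact: cZ|exact: cK].
have ka0 s t S : s \in grid S -> t \in grid S -> s <= t ->
    0 <= \sum_c (KS S t 0 c - KS S s 0 c).
  move=> sS tS st; apply: sumr_ge0 => c _.
  by rewrite subr_ge0; apply: (rsc_K_mono (HS S)).
exists Z, K; split.
- apply: (cvg_unique _ (cZ _ zin)) => //.
  rewrite (_ : (fun S => ZS S 0) = fun=> y); first exact: cvg_cst.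
  by apply/funext => S; exact: (rsc_Z0 (HS S)).
- apply: (cvg_unique _ (cK _ zin)) => //.
  rewrite (_ : (fun S => KS S 0) = fun=> 0); first exact: cvg_cst.
  by apply/funext => S; exact: (rsc_K0 (HS S)).
- move=> s t /= sT tT st.
  apply: (cvgr_to_le (cvg_norm (cvgB (cZ _ tT) (cZ _ sT)))); near=> S.
  by apply: (rsc_Z (HS S)) => //=; near: S; exact: Ut.
- move=> s t c /= sT tT st.
  apply: (le_cvg_limits (cKc _ c sT) (cKc _ c tT)); near=> S.
  by apply: (rsc_K_mono (HS S)) => //=; near: S; exact: Ut.
- move=> s t /= sT tT st; apply: (cvgr_to_le (cka _ _ sT tT)); near=> S.
  by apply: (rsc_K (HS S)) => //=; near: S; exact: Ut.
- move=> s t /= sT tT st.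
  have W0 : 0 <= w s t by exact: (control_ge0 cw).
  have cW : A * (`|w s t + \sum_c (KS S t 0 c - KS S s 0 c)| `^ q) ^+ 3 @[S --> U]
      --> A * (`|w s t + \sum_c (K t 0 c - K s 0 c)| `^ q) ^+ 3.
    apply: cvgM; first exact: cvg_cst.
    have h : `|w s t + \sum_c (KS S t 0 c - KS S s 0 c)| `^ q @[S --> U]
        --> `|w s t + \sum_c (K t 0 c - K s 0 c)| `^ q.
      apply: (@powR_norm_cvg _ R^o) => //; apply: cvgD; first exact: cvg_cst.
      exact: cka.
    by rewrite !exprS expr0 mulr1; apply: cvgM => //; apply: cvgM.
  have kalim : 0 <= \sum_c (K t 0 c - K s 0 c).
    apply: (cvgr_to_ge (cka _ _ sT tT)); near=> S.
    by apply: ka0 => //; near: S; exact: Ut.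
  rewrite -[X in X `^ q]ger0_norm ?addr_ge0//.
  apply: (le_cvg_limits (cJ _ _ sT tT) cW); near=> S.
  have sS : s \in grid S by near: S; exact: Ut.
  have tS : t \in grid S by near: S; exact: Ut.
  rewrite ger0_norm ?addr_ge0 ?ka0//.
  exact: (rsc_J (HS S)).
- move=> s t a /= sT tT st wa.
  have cW : A * (a `^ q) `^ (q * 3 - 1) * (w s t + \sum_c (KS S t 0 c - KS S s 0 c)) @[S --> U]
      --> A * (a `^ q) `^ (q * 3 - 1) * (w s t + \sum_c (K t 0 c - K s 0 c)).
    apply: cvgM; first exact: cvg_cst.
    by apply: cvgD; [exact: cvg_cst|exact: cka].
  apply: (le_cvg_limits (cJ _ _ sT tT) cW); near=> S.
  by apply: (rsc_J_left (HS S)) => //=; near: S; exact: Ut.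
- move=> t c /= tT.
  apply: (cvgr_to_ge (cvgD (cZc _ c tT) (cKc _ c tT))); near=> S.
  by apply: (rsc_ge (HS S)); near: S; exact: Ut.
- move=> s t a c /= sT tT st wa Lt.
  apply: (cvgr_to_le (cvgB (cKc _ c tT) (cKc _ c sT))); near=> S.
  apply: (rsc_left (HS S)) => //=; first by near: S; exact: Ut.
    by near: S; exact: Ut.
  near: S; exact: (cvgr_gt _ (cvgD (cZc _ c tT) (cKc _ c tT))).
- move=> s t c /= sT tT st small; apply/eqP; rewrite -subr_eq0; apply/eqP.
  apply: (cvg_unique _ (cvgB (cKc _ c tT) (cKc _ c sT))) => //.
  apply: cvg_near_cst; near=> S; apply/eqP; rewrite subr_eq0; apply/eqP.
  apply: (rsc_right (HS S)) => //=; first by near: S; exact: Ut.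
    by near: S; exact: Ut.
  near: S.
  exact: (cvgr_gt _ (cvgB (cvgD (cZc _ c sT) (cKc _ c sT)) (cvg_cst (L s 0 c)))).
Unshelve. all: by end_near. Qed.

Lemma exists_reflected_limit : exists A Z K, 0 <= A /\
  reflected_scheme [set t | 0 <= t <= T] A Z K.
Proof.
have CCn : 1 <= C * C + n%:R.
  have : 1 <= C * C by rewrite mulr_ege1.
  by have := ler0n R n; lra.
have [A A0 bounds] := rough_scheme_bounds q3 q2 CCn (control_ge0 cw 0 T).
have [Z [K ZK]] := @reflected_scheme_limit A grid_Z grid_K A0
  (fun S => @grid_reflected_scheme S A A0 (bounds _ _ _ _ (grid_rough_scheme S))).
by exists A, Z, K.
Qed.

End euler_limit.

(** * Stieltjes integrals *)

Section nonnegative_integral.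
Import HBNNSimple.

(** The integral of a nonnegative function is the supremum of the integrals of the
    simple functions below it, and these vanish almost everywhere. *)
Lemma integral_negligible_support (R : realType) d (T : measurableType d)
    (mu : {measure set T -> \bar R}) (D : set T) (g : T -> \bar R) :
  (forall x, D x -> (0 <= g x)%E) ->
  mu.-negligible [set x | D x /\ g x != 0%E] ->
  (\int[mu]_(x in D) g x = 0)%E.
Proof.
move=> g0 [N [mN N0 gN]].
apply/eqP; rewrite eq_le integral_ge0// andbT ge0_integralE//.
apply: ge_ereal_sup => _ /= [h hg <-].
rewrite -integralT_nnsfun (@ae_eq_integral _ _ _ mu setT (cst 0%E))//.
- by rewrite integral0.
- by apply/measurable_realfun.measurable_EFinP; exact: measurable_funPT.
exists N; split => // x /= /not_implyP[_ hx].
apply: gN => /=; have := hg x; rewrite patchE; case: ifPn => [/set_mem Dx|_] le.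
  split => //; apply/eqP => gx; apply: hx; apply/eqP; rewrite eq_le.
  by rewrite -{1}gx le lee_fin /=.
by exfalso; apply: hx; apply/eqP; rewrite eq_le le lee_fin /=.
Qed.

End nonnegative_integral.

Section stieltjes.
Context {R : realType}.

Lemma lebesgue_stieltjes_itvoc (k : cumulative R R) (a b : R) : a <= b ->
  lebesgue_stieltjes_measure k `]a, b]%classic = (k b - k a)%:E.
Proof.
move=> ab; rewrite /lebesgue_stieltjes_measure/= /measure_extension/=.
by rewrite measurable_mu_extE/= ?wlength_itv_bnd//; exact: is_ocitv.
Qed.

(** The points r from which k is constant up to q and at which k does not jump.  They
    lie in an interval ending at q, starting at their infimum: if the infimum is
    such a point the closed interval is null, otherwise the half-open one is, by
    right-continuity. *)
Lemma negligible_left_flat (k : cumulative R R) (q : R) :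
  (lebesgue_stieltjes_measure k).-negligible
    [set r | 0 < r <= q /\ k r = k q /\
      forall e, 0 < e -> exists2 s, s < r & k r - k s <= e].
Proof.
set B := [set r | _].
have [B0|nB] := pselect (B = set0); first by rewrite B0; exact: negligible_set0.
have [r0 Br0] : B !=set0 by apply/set0P/eqP.
have nd : {homo k : x y / x <= y} := cumulative_is_nondecreasing k.
have null r : B r -> lebesgue_stieltjes_measure k `[r, q]%classic = 0%E.
  move=> [/andP[r_gt0 rq] [krq flat]]; apply/eqP; rewrite -measure_le0.
  apply/lee_addgt0Pr => e e0; rewrite add0e.
  have [s sr ks] := flat e e0.
  apply: (@le_trans _ _ (lebesgue_stieltjes_measure k `]s, q]%classic)).
    apply: le_measure; rewrite ?inE; try exact: measurable_itv.
    move=> x /=; rewrite !in_itv/= => /andP[rx ->]; rewrite andbT.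
    exact: lt_le_trans rx.
  rewrite lebesgue_stieltjes_itvoc; last exact: ltW (lt_le_trans sr rq).
  by rewrite lee_fin -krq.
have hB : has_inf B.
  by split; [exists r0|exists 0 => r [/andP[/ltW]]].
have Bq r : B r -> r <= q by move=> [/andP[]].
have aB r : B r -> inf B <= r by move=> Br; apply: ge_inf => //; case: hB.
have [Ba|nBa] := pselect (B (inf B)).
  exists `[inf B, q]%classic; split; [exact: measurable_itv|exact: null|].
  by move=> r Br /=; rewrite in_itv/= aB//= Bq.
have lt_aB r : B r -> inf B < r.
  move=> Br; rewrite lt_neqAle aB// andbT; apply/eqP => e; apply: nBa.
  by rewrite e.
have aq : inf B < q by exact: lt_le_trans (lt_aB _ Br0) (Bq _ Br0).
exists `]inf B, q]%classic; split; [exact: measurable_itv| |]; last first.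
  by move=> r Br /=; rewrite in_itv/= lt_aB//= Bq.
rewrite lebesgue_stieltjes_itvoc ?(ltW aq)//.
suff -> : k (inf B) = k q by rewrite subrr.
have rc := cumulative_is_right_continuous k (inf B).
apply: (cvg_unique _ rc) => //.
apply: cvg_near_cst; near=> u.
have au : inf B < u by near: u; exact: nbhs_right_gt.
have [r Br ru] : exists2 r, B r & r < u.
  have e0 : 0 < u - inf B by rewrite subr_gt0.
  have [r Br] := inf_adherent e0 hB.
  by rewrite addrC subrK => ru; exists r.
have uq : u <= q by near: u; exact: nbhs_right_le.
apply/eqP; rewrite eq_le nd//=.
by case: Br => _ [<- _]; exact: nd (ltW ru).
Unshelve. all: by end_near. Qed.

End stieltjes.

Section clamp.
Context {R : realType} (T : R) (k : R -> R).
Hypothesis T0 : 0 < T.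
Hypothesis k_mono : forall s t, 0 <= s -> s <= t -> t <= T -> k s <= k t.
Hypothesis k_right : forall t, 0 <= t < T -> k u @[u --> t^'+] --> k t.

(** The extension of k to the real line by its values at 0 and at T. *)
Definition clamp (t : R) : R := k (Num.max 0 (Num.min t T)).

Lemma clampE t : 0 <= t <= T -> clamp t = k t.
Proof. by move=> /andP[t0 tT]; rewrite /clamp (min_idPl tT) (max_idPr t0). Qed.

Lemma clamp_geT t : T <= t -> clamp t = k T.
Proof. by move=> Tt; rewrite /clamp (min_idPr Tt) (max_idPr (ltW T0)). Qed.

Lemma clamp_nondecreasing : nondecreasing clamp.
Proof.
move=> s t st; apply: k_mono; first by rewrite le_max lexx.
  by rewrite ge_max le_max lexx/= le_max le_min !ge_min st lexx !orbT.
by rewrite ge_max (ltW T0) ge_min lexx orbT.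
Qed.

Lemma clamp_right_continuous : right_continuous clamp.
Proof.
move=> t; have [t0|t0] := ltP t 0.
  have e u : u <= 0 -> clamp u = k 0.
    move=> u0; rewrite /clamp; congr k; apply/max_idPl.
    by rewrite ge_min u0.
  rewrite e ?(ltW t0)//; apply: cvg_near_cst; near=> u; apply: e.
  by near: u; exact: nbhs_right_le.
have [tT|tT] := ltP t T.
  rewrite clampE ?t0 ?ltW//.
  apply: cvg_trans (k_right _); last by rewrite t0.
  apply: near_eq_cvg; near=> u; rewrite clampE//.
  have tu : t < u by near: u; exact: nbhs_right_gt.
  by rewrite (le_trans t0 (ltW tu))/=; near: u; exact: nbhs_right_le.
rewrite clamp_geT//; apply: cvg_near_cst; near=> u; apply: clamp_geT.
by apply: (le_trans tT); near: u; exact: nbhs_right_ge.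
Unshelve. all: by end_near. Qed.

HB.instance Definition _ :=
  isCumulative.Build R _ R clamp clamp_nondecreasing clamp_right_continuous.

(** Every point of ]0, T] where Z > 0 starts a half-open interval of constancy of k,
    without an atom at its left end.  Such an interval contains a rational number, so
    countably many null sets cover these points. *)
Lemma null_stieltjes_skorokhod (Z : R -> R) :
  (forall t, 0 <= t <= T -> 0 <= Z t) ->
  (forall r, 0 < r < T -> 0 < Z r -> exists2 d, 0 < d &
     forall t, r <= t -> t < r + d -> t <= T -> k t = k r) ->
  (forall r, 0 < r <= T -> 0 < Z r -> forall e, 0 < e ->
     exists2 s, 0 <= s < r & k r - k s <= e) ->
  null_stieltjes_integral T Z k.
Proof.
move=> Z0 right left; exists (clamp : cumulative R R); first exact: clampE.
move=> t /andP[t0 tT].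
apply: integral_negligible_support.
  move=> x /=; rewrite in_itv/= lee_fin => /andP[x0 xt].
  by apply: Z0; rewrite (ltW x0) (le_trans xt).
pose B q : set R := [set r | 0 < r <= q /\ clamp r = clamp q /\
      forall e, 0 < e -> exists2 s, s < r & clamp r - clamp s <= e].
pose F n : set R := if unpickle n is Some q then B (ratr q) else set0.
have N : (lebesgue_stieltjes_measure (clamp : cumulative R R)).-negligible
    (\bigcup_n F n).
  apply: negligible_bigcup => n; rewrite /F; case: unpickle => [q|].
    exact: negligible_left_flat.
  exact: negligible_set0.
apply: negligibleS N => r /= []; rewrite in_itv/= eqe => /andP[r0 rt] Zr.
have rT := le_trans rt tT.
have {}Zr : 0 < Z r by rewrite lt_neqAle eq_sym Zr Z0// ltW.
have [q rq kq] : exists2 q : rat, r <= ratr q & clamp r = clamp (ratr q).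
  move: rT; rewrite le_eqVlt => /predU1P[rT|rT].
    have rr1 : r < r + 1 by rewrite ltrDl ltr01.
    have [q] := rat_in_itvoo rr1; rewrite in_itv/= => /andP[rq _].
    exists q; first exact: ltW.
    by rewrite !clamp_geT -?rT// ltW.
  have [|d d0 dk] := right r _ Zr; first by rewrite r0.
  have rd : r < Num.min (r + d) T by rewrite lt_min rT ltrDl d0.
  have [q] := rat_in_itvoo rd; rewrite in_itv/= lt_min => /and3P[rq qd qT].
  exists q; first exact: ltW.
  rewrite !clampE ?(ltW r0) ?(ltW rT)//.
    by rewrite dk// ltW.
  by rewrite (ltW qT) (le_trans (ltW r0) (ltW rq)).
suff Bqr : B (ratr q) r.
  apply: (ex_intro2 _ _ (pickle q) I); rewrite /F pickleK; exact: Bqr.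
split; first by rewrite r0.
split => // e e0; have [|s /andP[s0 sr] ks] := left r _ Zr e e0; first by rewrite r0.
exists s => //; rewrite !clampE ?s0 ?(ltW r0) ?(le_trans (ltW sr))//.
Qed.

End clamp.

(** * The limit is a solution *)

HB.instance Definition _ (R : realType) m n :=
  Uniform_isComplete.Build 'M[R]_(m, n) cauchy_cvg.

Section cadlag_algebra.
Context {R : realType}.

Lemma cvg_mulmx (I : Type) (F : set_system I) {FF : Filter F} m n k
    (u : I -> 'M[R]_(m, n)) (v : I -> 'M[R]_(n, k)) (a : 'M[R]_(m, n)) (b : 'M[R]_(n, k)) :
  u i @[i --> F] --> a -> v i @[i --> F] --> b ->
  u i *m v i @[i --> F] --> a *m b.
Proof.
move=> ua vb.
have nu : `|a - u i| @[i --> F] --> (0 : R).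
  by have /(_ FF FF FF) := cvg_norm (cvgB (cvg_cst a) ua); rewrite subrr normr0.
have nv : `|b - v i| @[i --> F] --> (0 : R).
  by have /(_ FF FF FF) := cvg_norm (cvgB (cvg_cst b) vb); rewrite subrr normr0.
pose g i : R := n%:R * (`|a| * `|b - v i| + `|a - u i| * `|b| + `|a - u i| * `|b - v i|).
have g0 : g i @[i --> F] --> (0 : R).
  have -> : (0 : R) = n%:R * (`|a| * 0 + 0 * `|b| + 0 * 0) by ring.
  apply: cvgM; first exact: cvg_cst.
  apply: cvgD; last exact: cvgM.
  by apply: cvgD; apply: cvgM => //; exact: cvg_cst.
apply/cvgrPdist_le => e e0.
have ge : \forall i \near F, `|g i| <= e.
  move/cvgrPdist_le : g0 => /(_ e e0); apply: filterS => i.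
  by rewrite sub0r normrN.
apply: filterS ge => i; apply: le_trans.
have -> : a *m b - u i *m v i =
    a *m (b - v i) + (a - u i) *m b - (a - u i) *m (b - v i).
  rewrite !mulmxBl !mulmxBr; move: (a *m b) (a *m v i) (u i *m b) (u i *m v i).
  by move=> A1 A2 A3 A4; apply/matrixP => r c; rewrite !mxE; ring.
apply: le_trans (ler_norm _); rewrite /g 2!mulrDr.
apply: le_trans (ler_normB _ _) _; apply: lerD; last exact: mx_norm_mul.
by apply: le_trans (ler_normD _ _) _; apply: lerD; exact: mx_norm_mul.
Qed.

Lemma cadlagS (V : normedModType R) a b a' b' (Z : R -> V) : a <= a' -> b' <= b ->
  cadlag a b Z -> cadlag a' b' Z.
Proof.
move=> aa bb [r l]; split => t /andP[h1 h2].
  by apply: r; rewrite (le_trans aa)//= (lt_le_trans h2).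
by apply: l; rewrite (le_lt_trans aa)//= (le_trans h2).
Qed.

Lemma cadlag_cst (V : normedModType R) a b (v : V) : cadlag a b (fun=> v).
Proof. by split=> [t _|t _]; [exact: cvg_cst|exists v; exact: cvg_cst]. Qed.

Lemma cadlagB (V : normedModType R) a b (Z Z' : R -> V) :
  cadlag a b Z -> cadlag a b Z' -> cadlag a b (fun t => Z t - Z' t).
Proof.
move=> [r l] [r' l']; split => t tab.
  by apply: cvgB; [exact: r|exact: r'].
have [z zl] := l t tab; have [z' zl'] := l' t tab.
by exists (z - z'); exact: cvgB.
Qed.

Lemma cadlag_mulmx m n k a b (Z : R -> 'M[R]_(m, n)) (Z' : R -> 'M[R]_(n, k)) :
  cadlag a b Z -> cadlag a b Z' -> cadlag a b (fun t => Z t *m Z' t).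
Proof.
move=> [r l] [r' l']; split => t tab.
  by apply: cvg_mulmx; [exact: r|exact: r'].
have [z zl] := l t tab; have [z' zl'] := l' t tab.
by exists (z *m z'); exact: cvg_mulmx.
Qed.

(** The remainder is obtained from X, Y and Y' by sums and products. *)
Lemma cadlag_remainder n d T (X : R -> 'rV[R]_d) (Y : R -> 'rV[R]_n)
    (Y' : R -> 'M[R]_(d, n)) :
  cadlag 0 T X -> cadlag 0 T Y -> cadlag 0 T Y' ->
  (forall t, 0 <= t <= T -> cadlag 0 t (fun s => remainder X Y Y' s t)) /\
  (forall s, 0 <= s <= T -> cadlag s T (fun t => remainder X Y Y' s t)).
Proof.
move=> cX cY cY'; split => t /andP[t0 tT].
  have h (V : normedModType R) (Z : R -> V) : cadlag 0 T Z -> cadlag 0 t Z.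
    exact: cadlagS.
  apply: cadlagB; first by apply: cadlagB; [exact: cadlag_cst|exact: h].
  by apply: cadlag_mulmx; [apply: cadlagB; [exact: cadlag_cst|exact: h]|exact: h].
have h (V : normedModType R) (Z : R -> V) : cadlag 0 T Z -> cadlag t T Z.
  exact: cadlagS.
apply: cadlagB; first by apply: cadlagB; [exact: h|exact: cadlag_cst].
by apply: cadlag_mulmx; [apply: cadlagB; [exact: h|exact: cadlag_cst]|exact: cadlag_cst].
Qed.

End cadlag_algebra.

Lemma D_path_of_control (R : realType) (V : completeNormedModType R) (p T B : R)
    (w : R -> R -> R) (Z : R -> V) : 0 < p -> 0 <= B -> control T w ->
  (forall s t, 0 <= s -> s <= t -> t <= T -> `|Z t - Z s| <= B * w s t `^ p^-1) ->
  D_path p T Z.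
Proof.
move=> p0 B0 cw ZB; split.
  by apply: (cadlag_of_control cw _ B0 ZB); rewrite invr_gt0.
apply: (@finite_pvariation _ _ _ _ _ (B `^ p) w).
- by rewrite gt_eqF.
- exact: powR_ge0.
- exact: (control_super cw).
- by move=> t _ _; exact: (control_ge0 cw).
- move=> s t s0 st tT; have Zst := ZB _ _ s0 (ltW st) tT.
  apply: le_trans (le_powR (ltW p0) (normr_ge0 _) Zst) _.
  rewrite powRM ?powR_ge0// -powRrM mulVf ?gt_eqF// powRr1//.
  exact: (control_ge0 cw).
Qed.

(* A limit of the schemes solves the reflected equation.  As before W = w + ka,
   with ka the increment of the sum of the components of K. *)
Section limit_solves.
Context {R : realType} (n d : nat) (p T q C A : R) (f : 'rV[R]_n -> 'M[R]_(d, n)).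
Variables (X : R -> 'rV[R]_d) (XX : R -> R -> 'M[R]_d) (L : R -> 'rV[R]_n).
Variables (w : R -> R -> R) (y : 'rV[R]_n) (Z K : R -> 'rV[R]_n).
Hypothesis (p0 : 0 < p) (qE : q = p^-1).
Hypothesis (T0 : 0 < T) (q3 : 1 < q * 3) (q2 : q * 2 <= 1) (C1 : 1 <= C) (A0 : 0 <= A).
Hypothesis rf : regular_field C f.
Hypothesis cw : control T w.
Hypothesis chen : forall s u t, 0 <= s -> s <= u -> u <= t -> t <= T ->
  XX s t - XX s u - XX u t = (X u - X s)^T *m (X t - X u).
Hypothesis Xw : forall s t, 0 <= s -> s <= t -> t <= T -> `|X t - X s| <= w s t `^ q.
Hypothesis XXw : forall s t, 0 <= s -> s <= t -> t <= T -> `|XX s t| <= (w s t `^ q) ^+ 2.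
Hypothesis cX : cadlag 0 T X.
Hypothesis H : reflected_scheme q f X XX L w y [set t | 0 <= t <= T] A Z K.

Let Y t := Z t + K t.
Let ka s t := \sum_c (K t 0 c - K s 0 c).
Let W s t := w s t + ka s t.
Let J s t := local_error f (Y s) (Z s) (Z t) (X t - X s) (XX s t).

Let q0 : 0 < q. Proof. by rewrite qE invr_gt0. Qed.
Let qge0 : 0 <= q. Proof. exact: ltW. Qed.
Let C0 : 0 <= C. Proof. exact: le_trans ler01 C1. Qed.

Let range s t : 0 <= s -> s <= t -> t <= T -> (0 <= s <= T) /\ (0 <= t <= T).
Proof. by move=> s0 st tT; rewrite s0 tT (le_trans st) // (le_trans s0). Qed.

Let ka0 s t : 0 <= s -> s <= t -> t <= T -> 0 <= ka s t.
Proof.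
move=> s0 st tT; have [sT tT'] := range s0 st tT.
by apply: sumr_ge0 => c _; rewrite subr_ge0; exact: (rsc_K_mono H).
Qed.

Let ka_add s u t : ka s u + ka u t = ka s t.
Proof.
rewrite /ka -big_split/=; apply: eq_bigr => c _.
by rewrite addrC subrKA.
Qed.

Let ka_le s t : 0 <= s -> s <= t -> t <= T -> ka s t <= A * w s t `^ q.
Proof. by move=> s0 st tT; have [sT tT'] := range s0 st tT; exact: (rsc_K H). Qed.

Let K_le s t : 0 <= s -> s <= t -> t <= T -> `|K t - K s| <= ka s t.
Proof.
move=> s0 st tT; have [sT tT'] := range s0 st tT.
apply: le_trans (norm_le_sum _) _ => [c|].
  by rewrite !mxE subr_ge0; exact: (rsc_K_mono H).
by under eq_bigr => c _ do rewrite !mxE.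
Qed.

Let Z_le s t : 0 <= s -> s <= t -> t <= T -> `|Z t - Z s| <= A * w s t `^ q.
Proof. by move=> s0 st tT; have [sT tT'] := range s0 st tT; exact: (rsc_Z H). Qed.

Let Y_incr s t : Y t - Y s = (Z t - Z s) + (K t - K s).
Proof. by rewrite /Y opprD addrACA. Qed.

Let Y_le s t : 0 <= s -> s <= t -> t <= T -> `|Y t - Y s| <= 2 * A * w s t `^ q.
Proof.
move=> s0 st tT; rewrite Y_incr; apply: le_trans (ler_normD _ _) _.
have := Z_le s0 st tT; have := K_le s0 st tT; have := ka_le s0 st tT.
by move=> h1 h2 h3; rewrite -mulrA; lra.
Qed.

Let W0 s t : 0 <= s -> s <= t -> t <= T -> 0 <= W s t.
Proof. by move=> s0 st tT; rewrite addr_ge0 ?ka0// (control_ge0 cw). Qed.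

Let W_super s u t : 0 <= s -> s <= u -> u <= t -> t <= T -> W s u + W u t <= W s t.
Proof.
move=> s0 su ut tT; rewrite /W -(ka_add s u t).
by have := control_super cw s0 su ut tT; lra.
Qed.

Let W_sub s u v t : 0 <= s -> s <= u -> u <= v -> v <= t -> t <= T -> W u v <= W s t.
Proof.
move=> s0 su uv vt tT; have u0 := le_trans s0 su.
have uT := le_trans (le_trans uv vt) tT; have ut := le_trans uv vt.
have := W_super s0 su ut tT; have := W_super u0 uv vt tT.
have := W0 s0 su uT; have := W0 (le_trans u0 uv) vt tT.
lra.
Qed.

Let W_tot s t : 0 <= s -> s <= t -> t <= T -> W s t <= W 0 T.
Proof. by move=> s0 st tT; exact: W_sub. Qed.

Let J_le s t : 0 <= s -> s <= t -> t <= T -> `|J s t| <= A * (W s t `^ q) ^+ 3.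
Proof. by move=> s0 st tT; have [sT tT'] := range s0 st tT; exact: (rsc_J H). Qed.

(** The remainder is the local error, of order 3 q, plus a second-order term, of
    order 2 q, plus the increment of K, which is of order 1 with respect to ka but
    only of order q with respect to w: whence the control W = w + ka. *)
Lemma limit_controlled_path : controlled_path p T X Y (f \o Y).
Proof.
have DY : D_path p T Y.
  apply: (@D_path_of_control _ _ _ _ (2 * A) w) => //; first exact: mulr_ge0.
  by move=> s t s0 st tT; rewrite -qE; exact: Y_le.
have DY' : D_path p T (f \o Y).
  apply: (@D_path_of_control _ _ _ _ (C * (2 * A)) w) => //; first by rewrite !mulr_ge0.
  move=> s t s0 st tT; rewrite -qE; apply: le_trans (rf_lipschitz rf _ _) _.
  by rewrite -mulrA; apply: ler_wpM2l => //; exact: Y_le.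
split => //.
have [c1 c2] := cadlag_remainder cX (proj1 DY) (proj1 DY').
split => //.
pose c := A * (W 0 T `^ q) + C + (1 + W 0 T).
have WT0 : 0 <= W 0 T by exact: W0 (lexx _) (ltW T0) (lexx _).
have AW0 : 0 <= A * (W 0 T `^ q) by rewrite mulr_ge0// powR_ge0.
have c0 : 0 <= c by move: AW0 WT0 C0; rewrite /c; lra.
apply: (@finite_pvariation _ _ _ _ _ (c `^ (p / 2)) W).
- by rewrite gt_eqF// divr_gt0.
- exact: powR_ge0.
- exact: W_super.
- by move=> t t0 tT; exact: W0.
move=> s t s0 st tT; have st' := ltW st.
have Wst := W0 s0 st' tT.
have Rle : `|remainder X Y (f \o Y) s t| <= c * (W s t `^ q) ^+ 2.
  have -> : remainder X Y (f \o Y) s t =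
      J s t + second_order f (Y s) (XX s t) + (K t - K s).
    rewrite /remainder /increment /J /local_error /germ Y_incr/=.
    move: ((X t - X s) *m f (Y s)) (second_order f (Y s) (XX s t)) => a b.
    by apply/rowP => i; rewrite !mxE; ring.
  apply: le_trans (ler_normD _ _) _; rewrite /c mulrDl; apply: lerD.
    apply: le_trans (ler_normD _ _) _; rewrite mulrDl; apply: lerD.
      apply: le_trans (J_le s0 st' tT) _.
      rewrite exprS mulrA; apply: ler_wpM2r; first exact: sqr_ge0.
      by apply: ler_wpM2l => //; apply: le_powR => //; exact: W_tot.
    apply: le_trans (rf_second rf _ _) _; apply: ler_wpM2l => //.
    apply: le_trans (XXw s0 st' tT) _.
    rewrite ler_sqr ?nnegrE ?powR_ge0//; apply: le_powR => //.
      exact: (control_ge0 cw).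
    by rewrite /W lerDl ka0.
  apply: le_trans (K_le s0 st' tT) _.
  apply: (@le_trans _ _ (W s t)); first by rewrite /W lerDr (control_ge0 cw).
  rewrite -{1}(@powR1_split _ (W s t) (q * 2))// -powRX.
  apply: ler_wpM2r; first exact: sqr_ge0.
  apply: le_trans (le_powR_ge1 Wst _) _; first by move: q3 q2; lra.
  by rewrite lerD2l; exact: W_tot.
have p20 : 0 <= p / 2 by rewrite divr_ge0// ltW.
apply: le_trans (le_powR p20 (normr_ge0 _) Rle) _.
rewrite powRM ?sqr_ge0// powRX -powRrM.
rewrite (_ : q * 2 * (p / 2) = 1) ?powRr1//.
by rewrite qE mulrA -(mulrA p^-1) mulrCA mulVf ?gt_eqF// mulr1 mulfV.
Qed.

Lemma limit_K_path : D_path 1 T K.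
Proof.
split.
  apply: (@cadlag_of_control _ _ _ cw _ _ q A) => // s t s0 st tT.
  by apply: le_trans (K_le s0 st tT) _; exact: ka_le.
apply: (@finite_pvariation _ _ _ _ _ 1 ka) => //.
- by move=> s u t *; rewrite ka_add.
- by move=> t t0 tT; exact: ka0.
- by move=> s t s0 st tT; rewrite powRr1// mul1r; exact: K_le (ltW st) tT.
Qed.

Let J_diag s : 0 <= s <= T -> `|J s s| = 0.
Proof.
move=> /andP[s0 sT]; apply/eqP; rewrite eq_le normr_ge0 andbT.
apply: le_trans (J_le s0 (lexx _) sT) _.
have -> : W s s = 0.
  rewrite /W (control_diag cw) ?s0// add0r; apply: big1 => c _; exact: subrr.
by rewrite powR0 ?gt_eqF// expr0n mulr0.
Qed.

Let ga : R := q * 3 - 1.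
Let ga0 : 0 < ga. Proof. by rewrite subr_gt0. Qed.
Let ga_ge0 : 0 <= ga. Proof. exact: ltW. Qed.

(** Cut [u, v] at the large jump tau.  Up to tau the local error does not see
    the jump, after tau the control is small, and the defect is small because the
    interval after tau is. *)
Lemma local_error_one_jump : exists2 B : R, 0 <= B &
  forall a u v tau, 0 <= a <= 1 -> 0 <= u -> u <= tau -> tau <= v -> v <= T ->
  (forall x, u <= x < tau -> w u x <= a) -> w tau v <= a ->
  `|J u v| <= B * (a `^ q) `^ ga * W u v.
Proof.
pose Om := w 0 T; pose Q := ka 0 T.
pose E := 4 * A ^+ 2 + (1 + Om + Q) * (1 + A) + 1.
have Om0 : 0 <= Om by exact: (control_ge0 cw).
have Q0 : 0 <= Q by exact: ka0 (lexx _) (ltW T0) (lexx _).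
have E0 : 0 <= E by rewrite /E !addr_ge0// ?mulr_ge0 ?sqr_ge0// addr_ge0// addr_ge0.
pose B1 := A * (1 + Om + A) `^ ga.
pose B2 := C * C * (E + 2 * A).
have B10 : 0 <= B1 by rewrite mulr_ge0// powR_ge0.
have B20 : 0 <= B2 by rewrite !mulr_ge0// addr_ge0// mulr_ge0.
exists (A + B1 + B2); first by rewrite !addr_ge0.
move=> a u v tau /andP[a0 a1] u0 ut tv vT wl wr.
have tau0 := le_trans u0 ut; have tauT := le_trans tv vT; have uv := le_trans ut tv.
have [uT vT'] := range u0 uv vT; have [_ tT'] := range u0 ut tauT.
have Wuv := W0 u0 uv vT; have Wut := W0 u0 ut tauT; have Wtv := W0 tau0 tv vT.
have WutD : W u tau <= W u v by exact: W_sub.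
have WtvD : W tau v <= W u v by exact: W_sub.
have aq0 : 0 <= (a `^ q) `^ ga := powR_ge0 _ _.
have pow_a x : 0 <= x <= a -> (x `^ q) `^ ga <= (a `^ q) `^ ga.
  move=> /andP[x0 xa]; apply: le_powR => //; first exact: powR_ge0.
  exact: le_powR.
have J1 : `|J u tau| <= A * (a `^ q) `^ ga * W u v.
  move: ut; rewrite le_eqVlt => /predU1P[<-|ut'].
    by rewrite J_diag// !mulr_ge0.
  apply: le_trans (rsc_J_left H uT tT' ut' wl) _.
  by apply: ler_wpM2l => //; exact: mulr_ge0.
have wtv0 : 0 <= w tau v := control_ge0 cw _ _.
have wtvOm : w tau v <= Om.
  apply: (@le_trans _ _ (w 0 v)); first exact: (control_subr cw).
  by apply: (control_subl cw) => //; exact: le_trans tv.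
have J2 : `|J tau v| <= B1 * (a `^ q) `^ ga * W u v.
  apply: le_trans (J_le tau0 tv vT) _.
  apply: (@le_trans _ _ (A * (W tau v `^ ga * W u v))).
    by apply: ler_wpM2l => //; exact: cube_le_split.
  rewrite mulrA; apply: ler_wpM2r => //; rewrite /B1 -!mulrA; apply: ler_wpM2l => //.
  apply: le_trans (@powR_add_le _ q (w tau v) (ka tau v) Om A q3 q2 A0 _ _) _.
  - by rewrite wtv0.
  - by rewrite ka0// ka_le.
  - by apply: ler_wpM2l; [exact: powR_ge0|apply: pow_a; rewrite wtv0].
have xe : X v - X u = (X tau - X u) + (X v - X tau) by rewrite [RHS]addrC subrKA.
have xxe : XX u v = XX u tau + XX tau v + (X tau - X u)^T *m (X v - X tau).
  by rewrite -(chen u0 ut tv vT) [RHS]addrC (addrC (XX u tau)) addrA !subrK.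
have Kut : `|(Y tau - Z tau) - (Y u - Z u)| <= ka u tau.
  have Ye t : Y t - Z t = K t by rewrite /Y addrAC subrr add0r.
  by rewrite !Ye; exact: K_le.
have wut0 : 0 <= w u tau := control_ge0 cw _ _.
have wutOm : w u tau <= Om.
  apply: (@le_trans _ _ (w 0 tau)); first exact: (control_subr cw).
  exact: (control_subl cw).
have kutQ : ka u tau <= Q.
  rewrite /Q -(ka_add 0 u T) -(ka_add u tau T).
  have := ka0 (lexx _) u0 (le_trans uv vT); have := ka0 tau0 tauT (lexx _); lra.
have wtvD : w tau v <= W u v.
  by apply: le_trans WtvD; rewrite /W lerDl ka0.
have Zut0 : 0 <= `|Z tau - Z u| by [].
have [_ D] := @defect_le _ q (w u tau) (w tau v) (ka u tau) `|Z tau - Z u|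
  `|J u tau| (W u v) Om Q A A q3 q2 A0 A0
  (introT andP (conj wut0 wutOm)) wtv0 (introT andP (conj (ka0 u0 ut tauT) kutQ))
  Zut0 (normr_ge0 _) (ka_le u0 ut tauT) (Z_le u0 ut tauT) (J_le u0 ut tauT) WutD wtvD.
rewrite {1}/J xe xxe.
apply: le_trans (local_error_defect _ _ C1 rf (powR_ge0 _ _) (powR_ge0 _ _)
  (Xw tau0 tv vT) (XXw tau0 tv vT) (XXw u0 ut tauT) Kut) _.
rewrite -/(J u tau) -/(J tau v).
have -> : (A + B1 + B2) * (a `^ q) `^ ga * W u v = A * (a `^ q) `^ ga * W u v +
  B1 * (a `^ q) `^ ga * W u v + B2 * ((a `^ q) `^ ga * W u v).
  by rewrite [in LHS]mulrDl [in LHS]mulrDl [in LHS]mulrDl [in LHS]mulrDl -(mulrA B2).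
apply: lerD; first exact: lerD.
rewrite /B2 -(mulrA (C * C)); apply: ler_wpM2l; first exact: mulr_ge0.
apply: le_trans D _; apply: ler_wpM2l; first by rewrite addr_ge0// mulr_ge0.
apply: ler_wpM2r => //.
apply: (@le_trans _ _ (a `^ ga)); first exact: le_powR.
apply: le_powR => //; rewrite -{1}(powRr1 a0); apply: le1_powR => //.
  by rewrite a0.
by move: q2 q0; lra.
Qed.

(** On a partition of small mesh all local errors are a small multiple of W. *)
Lemma limit_rough_integral t : 0 <= t <= T ->
  is_rough_integral X XX (f \o Y) (compose_derivative f Y (f \o Y)) 0 t (Z t - y).
Proof.
move=> /andP[t0 tT]; have [B B0 JB] := local_error_one_jump.
have WT0 : 0 <= W 0 T by exact: W0 (lexx _) (ltW T0) (lexx _).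
apply/cvgrPdist_le => e e0.
pose e1 := e / (1 + W 0 T).
have W1 : 0 < 1 + W 0 T by rewrite ltr_wpDr.
have e10 : 0 < e1 by rewrite divr_gt0.
have [h h0 hB] := powR_modulus (mulr_gt0 q0 ga0) B0 e10.
pose a := Num.min 1 h.
have a0 : 0 < a by rewrite lt_min ltr01.
have a1 : a <= 1 by rewrite ge_min lexx.
have Ba : B * (a `^ q) `^ ga <= e1.
  by rewrite -powRrM; apply/ltW/hB; rewrite (ltW a0)/= ge_min lexx orbT.
have [dl dl0 jump] := control_one_jump cw T0 a0.
exists dl => //= P [tP mP].
have tel := @rough_sum_telescope _ _ Z (fun u v => germ f (Y u) (X v - X u) (XX u v))
  W e1 dl T (ltW e10) W_super _ _ t P tT tP mP.
rewrite -(rsc_Z0 H).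
apply: le_trans (tel _ _) _.
- by move=> s s0 sT; exact: W0.
- move=> u v u0 uv vT vud.
  have [tau [utau tauv wl wr]] := jump u v u0 (ltW uv) vT vud.
  apply: le_trans (JB a u v tau _ u0 utau tauv vT wl wr) _.
    by rewrite (ltW a0).
  by apply: ler_wpM2r => //; exact: W0 (ltW uv) vT.
rewrite /e1 -mulrA ger_pMr// mulrC ler_pdivrMr// mul1r.
by have := W_tot (lexx 0) t0 tT; lra.
Qed.

(** The continuity of the control to the right of r, and its smallness strictly before r,
    turn rsc_right and rsc_left into the two local conditions on K at r. *)
Lemma limit_skorokhod i :
  null_stieltjes_integral T (fun s => Y s 0 i - L s 0 i) (fun s => K s 0 i).
Proof.
apply: null_stieltjes_skorokhod => //.
- move=> s t s0 st tT; have [sT tT'] := range s0 st tT.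
  exact: (rsc_K_mono H).
- move=> t tT; have [[Kr _] _] := limit_K_path.
  exact: (cvg_comp _ _ (Kr t tT) (@coord_continuous R 1 n 0 i (K t))).
- move=> t tT; rewrite subr_ge0 mxE; exact: (rsc_ge H).
- move=> r /andP[r0 rT] Yr.
  have [h h0 hA] := powR_modulus q0 (addr_ge0 (mulr_ge0 (ler0n _ 2) A0) ler01) Yr.
  have rT' : 0 <= r < T by rewrite (ltW r0).
  have [dl dl0 wd] := control_right cw rT' h0.
  exists dl => // t rt td tT.
  have [sT tT'] := range (ltW r0) rt tT.
  apply: (rsc_right H) => //; move: (hA (w r t)); rewrite mxE; apply.
  by rewrite (control_ge0 cw) ltW// wd.
- move=> r rT Yr e e0; have [h h0 hA] := powR_modulus q0 A0 e0.
  have [dl dl0 wd] := control_left cw rT h0.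
  have [r0 rT'] := andP rT.
  pose s := Num.max 0 (r - dl / 2).
  have sr : s < r by rewrite gt_max r0/= ltrBlDr ltrDl divr_gt0.
  have s0 : 0 <= s by rewrite le_max lexx.
  have ds : r - dl < s.
    by rewrite lt_max; apply/orP; right; rewrite ltrD2l ltrN2 ltr_pdivrMr// ltr_pMr// ltr1n.
  exists s; first by rewrite s0.
  have [sT rT''] := range s0 (ltW sr) rT'.
  apply: le_trans (rsc_left H (a := h) sT rT'' sr _ _) _.
  + by move=> u /andP[su ur]; exact: wd.
  + by move: Yr; rewrite subr_gt0 mxE.
  + by apply: ltW; apply: hA; rewrite lexx ltW.
Qed.

Lemma limit_rrde_solution : rrde_solution p T X XX L f y Y (f \o Y) K.
Proof.
split.
- exact: limit_controlled_path.
- exact: limit_K_path.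
- move=> t tT; exists (Z t - y); first exact: limit_rough_integral.
  by rewrite addrCA subrr addr0.
- move=> i; split; first by move=> t tT; rewrite mxE; exact: (rsc_ge H).
  split; last exact: limit_skorokhod.
  + by move=> s t s0 st tT; have [sT tT'] := range s0 st tT; exact: (rsc_K_mono H).
  + by rewrite (rsc_K0 H) mxE.
Qed.

End limit_solves.

(** * Existence *)

Lemma cadlag_increment_left (R : realType) (V : normedModType R) (T : R) (Z : R -> V) :
  cadlag 0 T Z -> forall s v, 0 <= s -> s < v -> v <= T ->
  increment Z u v @[u --> s^'+] --> increment Z s v.
Proof.
move=> [Zr _] s v s0 sv vT; apply: cvgB; first exact: cvg_cst.
by apply: Zr; rewrite s0 (lt_le_trans sv).
Qed.

Lemma le_powR_root (R : realType) (a b r : R) : 0 < r -> 0 <= a ->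
  a `^ r <= b -> a <= b `^ r^-1.
Proof.
move=> r0 a0 ab; have ri : 0 <= r^-1 by rewrite invr_ge0 ltW.
have := le_powR ri (powR_ge0 a r) ab.
by rewrite -powRrM mulfV ?gt_eqF// powRr1.
Qed.

Lemma rough_path_diag (R : realType) d (p T : R) (X : R -> 'rV[R]_d) XX s :
  rough_path p T X XX -> 0 <= s <= T -> XX s s = 0.
Proof.
move=> [_ _ chen] /andP[s0 sT]; have := chen s s s s0 (lexx _) (lexx _) sT.
rewrite /increment !subrr trmx0 mul0mx sub0r => /eqP.
by rewrite oppr_eq0 => /eqP.
Qed.

Lemma path_control (R : realType) n (p T : R) (Z : R -> 'rV[R]_n) : 0 < p ->
  D_path p T Z -> exists2 w, control T w &
  forall s t, 0 <= s -> s <= t -> t <= T -> `|Z t - Z s| <= w s t `^ p^-1.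
Proof.
move=> p0 [cZ vZ].
have [w cw Zw] := pvariation_control p0 vZ (cadlag_increment_left cZ).
exists w => // s t s0; rewrite le_eqVlt => /predU1P[<- _|st tT].
  by rewrite subrr normr0 powR_ge0.
by apply: le_powR_root => //; exact: Zw.
Qed.

Theorem theorem3p5 (R : realType) (n d : nat) (hn : (1 <= n)%N)
    (hd : (1 <= d)%N) (p T : R) (hp : 2 <= p < 3) (hT : 0 < T)
    (X : R -> 'rV[R]_d) (XX : R -> R -> 'M[R]_d) (hX : rough_path p T X XX)
    (L : R -> 'rV[R]_n) (hL : D_path p T L)
    (f : 'rV[R]_n -> 'M[R]_(d, n)) (hf : Cb 3 f)
    (y : 'rV[R]_n) (hy : forall i : 'I_n, L 0 0 i <= y 0 i) :
  exists (Y : R -> 'rV[R]_n) (Y' : R -> 'M[R]_(d, n)) (K : R -> 'rV[R]_n),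
    rrde_solution p T X XX L f y Y Y' K.
Proof.
have [p2 p3] := andP hp; have p0 : 0 < p by exact: lt_le_trans p2.
have [DX [cXX _ vXX] chen] := hX.
have [w1 cw1 Xw1] := path_control p0 DX.
have [w3 cw3 Lw3] := path_control p0 hL.
have p20 : 0 < p / 2 by rewrite divr_gt0.
have [|w2 cw2 XXw2] := pvariation_control p20 vXX.
  move=> s v s0 sv vT; have v0 : 0 <= v by rewrite (le_trans s0)// ltW.
  have [Xr _] := cXX v (introT andP (conj v0 vT)).
  by apply: Xr; rewrite s0.
pose w s t := w1 s t + w2 s t + w3 s t.
have cw : control T w by exact: controlD (controlD cw1 cw2) cw3.
have q0 : 0 <= p^-1 by rewrite invr_ge0 ltW.
have wle s t : [/\ w1 s t <= w s t, w2 s t <= w s t & w3 s t <= w s t].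
  have := control_ge0 cw1 s t; have := control_ge0 cw2 s t.
  by have := control_ge0 cw3 s t; rewrite /w; split; lra.
have Xw s t : 0 <= s -> s <= t -> t <= T -> `|X t - X s| <= w s t `^ p^-1.
  move=> s0 st tT; apply: le_trans (Xw1 _ _ s0 st tT) _.
  by apply: le_powR => //; [exact: (control_ge0 cw1)|case: (wle s t)].
have Lw s t : 0 <= s -> s <= t -> t <= T -> `|L t - L s| <= w s t `^ p^-1.
  move=> s0 st tT; apply: le_trans (Lw3 _ _ s0 st tT) _.
  by apply: le_powR => //; [exact: (control_ge0 cw3)|case: (wle s t)].
have XXw s t : 0 <= s -> s <= t -> t <= T -> `|XX s t| <= (w s t `^ p^-1) ^+ 2.
  move=> s0; rewrite le_eqVlt => /predU1P[<- sT|st tT].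
    by rewrite (rough_path_diag hX) ?s0// normr0 sqr_ge0.
  have := le_powR_root p20 (normr_ge0 _) (XXw2 s t s0 st tT).
  rewrite powRX invf_div mulrC => /le_trans; apply.
  rewrite mulrC; apply: le_powR; first by rewrite mulr_ge0.
    exact: (control_ge0 cw2).
  by case: (wle s t).
have q3 : 1 < p^-1 * 3 by rewrite -ltr_pdivrMl ?invr_gt0// invrK mulr1.
have q2 : p^-1 * 2 <= 1 by rewrite -ler_pdivlMl ?invr_gt0// invrK mulr1.
have [C C1 rf] := Cb_regular_field hf.
have [A [Z [K [A0 H]]]] :=
  exists_reflected_limit (ltW hT) q3 q2 C1 rf cw chen Xw XXw Lw hy.
exists (fun t => Z t + K t), (f \o (fun t => Z t + K t)), K.
exact: (limit_rrde_solution p0 erefl hT q3 q2 C1 A0 rf cw chen Xw XXw (proj1 DX) H).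
Qed.
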